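(* Let $d \geq 3$ be an integer, and let $p,q \geq 1$ and $r > \frac{d}{d-2}$ be exponents satisfying $\frac{1}{p}+\frac{1}{q} \geq \frac{1}{r}$. Then the discrete bilinear spherical maximal operator $T^*$ is bounded from $l^{p}(\mathbb{Z}^d)\times l^{q}(\mathbb{Z}^d)$ to $l^{r}(\mathbb{Z}^d)$; that is, there is a constant $C = C(d,p,q,r)<\infty$ such that for all $f \in l^p(\mathbb{Z}^d)$ and $g \in l^q(\mathbb{Z}^d)$, $$\|T^*(f,g)\|_{l^r(\mathbb{Z}^d)} \leq C\, \|f\|_{l^p(\mathbb{Z}^d)}\,\|g\|_{l^q(\mathbb{Z}^d)}.$$
   Context: For $u \in \mathbb{Z}^d$ write $u^2 = u_1^2 + \dots + u_d^2$. For $\lambda \in \mathbb{N} = \{1,2,3,\dots\}$ let $N(\lambda) = \#\{(u,v) \in \mathbb{Z}^d\times\mathbb{Z}^d : u^2+v^2 = \lambda\}$, the number of lattice points on the sphere of radius $\lambda^{1/2}$ in $\mathbb{R}^{2d}$ (positive for every $\lambda$ when $d\geq 3$). For functions $f,g:\mathbb{Z}^d \to \mathbb{C}$ the discrete bilinear spherical maximal function is $$T^*(f,g)(x) = \sup_{\lambda \in \mathbb{N}}\left| \frac{1}{N(\lambda)}\sum_{\substack{u,v\in\mathbb{Z}^d\\ u^2+v^2=\lambda}} f(x-u)\,g(x-v)\right|, \qquad x \in \mathbb{Z}^d.$$ Exponents may take the value $\infty$, with the convention $1/\infty = 0$. *)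

(* Defs.v *)
From HB Require Import structures.
From mathcomp Require Import all_boot all_order all_algebra finmap.
From mathcomp Require Import complex zify.
From mathcomp Require Import all_classical all_reals all_analysis.

Set Implicit Arguments.
Unset Strict Implicit.
Unset Printing Implicit Defensive.

Import Order.TTheory GRing.Theory Num.Theory.

Local Open Scope classical_set_scope.
Local Open Scope ring_scope.

(* An alias of 'rV[int]_d carrying the discrete sigma-algebra, so that every
   function on it is measurable and the library's L^p norm for the counting
   measure is the norm of l^p(Z^d). *)
Definition lattice (d : nat) : Type := 'rV[int]_d.

HB.instance Definition _ (d : nat) := GRing.Zmodule.on (lattice d).
HB.instance Definition _ (d : nat) := isPointed.Build (lattice d) 0.
HB.instance Definition _ (d : nat) :=
  @isMeasurable.Build default_measure_display (lattice d)
    discrete_measurable discrete_measurable0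
    (@discrete_measurableC _) (@discrete_measurableU _).

(* For finite p > 0 this is (\sum_x |F x| `^ p) `^ p^-1. For p = +oo it is the
   essential supremum of |F|, i.e. its supremum, only set0 being negligible. *)
Definition lnorm (R : realType) (d : nat) (p : \bar R) (F : lattice d -> \bar R)
    : \bar R :=
  'N[@counting (lattice d) R]_p [F]%E.

(* R[i] is C; its library norm `|z| is the element (normc z)%:C of R[i]. *)
Definition cabs (R : realType) (d : nat) (f : lattice d -> R[i])
    : lattice d -> \bar R :=
  fun x => (Normc.normc (f x))%:E.

Definition in_lp (R : realType) (d : nat) (p : \bar R) (f : lattice d -> R[i])
    : Prop :=
  (lnorm p (cabs f) < +oo)%E.

Definition normsq (d : nat) (u : lattice d) : int :=
  \sum_(i < d) (u : 'rV[int]_d) 0 i ^+ 2.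

Definition bisphere (d l : nat) : set (lattice d * lattice d) :=
  [set w | normsq w.1 + normsq w.2 = l%:Z].
Arguments bisphere : clear implicits.

Lemma normsq_ge0 (d : nat) (u : lattice d) : 0 <= normsq u.
Proof. by apply: sumr_ge0 => i _; exact: sqr_ge0. Qed.

Lemma finite_ball (d l : nat) : finite_set [set u : lattice d | normsq u <= l%:Z].
Proof.
pose g (h : {ffun 'I_d -> 'I_(2 * l).+1}) : lattice d :=
  \row_i ((h i : nat)%:Z - l%:Z).
apply: (@sub_finite_set _ _ (range g)); last exact: finite_image.
move=> u /= ul.
have ui i : - l%:Z <= (u : 'rV[int]_d) 0 i <= l%:Z.
  have : (u : 'rV[int]_d) 0 i ^+ 2 <= l%:Z.
    apply: le_trans ul; rewrite /normsq (bigD1 i)//= lerDl.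
    by apply: sumr_ge0 => j _; exact: sqr_ge0.
  by rewrite expr2; nia.
exists [ffun i : 'I_d => inord (absz ((u : 'rV[int]_d) 0 i + l%:Z))] => //.
apply/rowP => i; rewrite mxE ffunE inordK; have := ui i; lia.
Qed.

(* The finitely supported sums and cardinals over bisphere below default to 0
   on infinite sets, hence this fact. *)
Lemma finite_bisphere (d l : nat) : finite_set (bisphere d l).
Proof.
apply: (@sub_finite_set _ _
  ([set u | normsq u <= l%:Z] `*` [set v | normsq v <= l%:Z])); last first.
  by apply: finite_setX; exact: finite_ball.
move=> [u v]; rewrite /bisphere /= => uvl.
by have := normsq_ge0 u; have := normsq_ge0 v; split => /=; lia.
Qed.

Definition npoints (d l : nat) : nat := #|` fset_set (bisphere d l)|%fset.

Definition bispherical_average (R : realType) (d l : nat)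
    (f g : lattice d -> R[i]) (x : lattice d) : R[i] :=
  (npoints d l)%:R^-1 *
    \sum_(w \in bisphere d l) f (x - w.1) * g (x - w.2).

Definition bispherical_maximal (R : realType) (d : nat)
    (f g : lattice d -> R[i]) (x : lattice d) : \bar R :=
  ereal_sup [set cabs (bispherical_average l f g) x | l in [set l | (0 < l)%N]].

(* Main.v *)
(** Normalize so that f and g have norm 1. Then |f|, |g| <= 1, and the exponent
    condition gives |f(y)| |g(z)| <= |f(y)|^(p/r) + |g(z)|^(q/r), so it is enough
    to bound on l^r, uniformly over the choice of the radius at each point, the
    linear averages N(l)^-1 sum_u F(x - u) r_d(l - u^2), where r_d(t) counts the
    representations of t as a sum of d squares.

    Two arithmetic facts, for l comparable to M^2, turn these averages into averages
    over cubes of side about M, to which the Hardy-Littlewood maximal theorem on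
    Z^d applies. The circle method, run over F_p for a large prime p instead of
    the torus, gives sum_t r_d(t)^3 = O(M^(3d-4)) for d >= 3, and
    r_d(t) = O(M^(d-2)) for d >= 5; so the average of F is at most a constant times
    the cube average of F if d >= 5, and of F^2 to the power 1/2 in general. As
    d/(d-2) >= 2 for d <= 4, every r > d/(d-2) is covered.

    The lower bound N(l) >= c l^(d-1) follows from that for six squares. If m is
    prime to 6, the rotations of a solution of a^2 + b^2 = -1 mod m provide many
    4-dimensional lattices of determinant m^2, each having a vector of norm km with
    k <= 4; k is then removed by explicit descents, and one averages over
    m = n - e^2 - f^2. *)

Require Import Defs.
From mathcomp Require Import all_boot all_order all_algebra finmap.
From mathcomp Require Import complex zify ring lra.
From mathcomp Require Import all_classical all_reals all_analysis.
From mathcomp Require Import ess_sup_inf.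

Set Implicit Arguments.
Unset Strict Implicit.
Unset Printing Implicit Defensive.

Import Order.TTheory GRing.Theory Num.Theory.

Local Open Scope ring_scope.

(** The radius is free at every point, so each estimate must hold at every scale without logarithmic
    loss. This dictates the form of the Weyl sum: a difference of two auxiliary variables makes
    Fejer kernels appear where geometric sums of size 1 / |x| would cost a logarithm. Modulo p, the
    frequencies of level at least i number O(p 2^(-8 i)), while the quantities to be summed grow
    like 2^(b i), with b = 2 d for the maximum of r_d and b = 3 d for its third moment. The top
    level dominates as soon as b > 8, whence d >= 5 and d >= 3. The third moment is what
    Cauchy-Schwarz asks for: the squares of the weights r_d(l - u^2), summed over u, give a sum of
    r_d(t) r_d(l - t)^2. The prime p is only bounded below and cancels from the final estimates. The
    lower bound for N(l) is needed for every l, whereas a single m may admit few rotations, namely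
    those with 1 + t^2 prime to m; hence the average over m. *)

Section ComplexModulus.
Variable R : rcfType.
Implicit Types z : R[i].
Local Notation nm := (@Normc.normc R).

Lemma normc_ge0 z : 0 <= nm z.
Proof. by case: z => a b; rewrite /Normc.normc sqrtr_ge0. Qed.

Lemma normc_sum (I : Type) (s : seq I) (P : pred I) (F : I -> R[i]) :
  nm (\sum_(i <- s | P i) F i) <= \sum_(i <- s | P i) nm (F i).
Proof.
elim/big_rec2: _ => [|i y1 y2 Pi le12]; first by rewrite Normc.normc0.
by apply: le_trans (le_normcD _ _) _; rewrite lerD2l.
Qed.

Lemma normcX z n : nm (z ^+ n) = nm z ^+ n.
Proof. by elim: n => [|n IH]; rewrite ?expr0 ?Normc.normc1// !exprS Normc.normcM IH. Qed.

Lemma normc_nat n : nm n%:R = n%:R.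
Proof. by rewrite normcMn Normc.normc1. Qed.

Lemma normc_conj z : nm (z^*)%C = nm z.
Proof. by case: z => a b; rewrite /Normc.normc /= sqrrN. Qed.

Lemma sqr_normcE z : real_complex R (nm z ^+ 2) = z * (z^*)%C.
Proof.
case: z => a b; rewrite /Normc.normc /= sqr_sqrtr ?addr_ge0 ?sqr_ge0//.
by apply/eqP; rewrite eq_complex /=; apply/andP; split; apply/eqP; ring.
Qed.

Lemma conjc_sum (I : Type) (s : seq I) (P : pred I) (F : I -> R[i]) :
  ((\sum_(i <- s | P i) F i)^*)%C = \sum_(i <- s | P i) ((F i)^*)%C.
Proof. exact: (big_morph _ (rmorphD (@conjc R)) (rmorph0 (@conjc R))). Qed.

Lemma normc_Re z : complex.Re z <= nm z.
Proof.
case: z => a b; rewrite /Normc.normc /=.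
apply: le_trans (ler_norm _) _; rewrite -sqrtr_sqr ler_sqrt ?lerDl ?sqr_ge0//.
by rewrite addr_ge0 ?sqr_ge0.
Qed.

End ComplexModulus.

(** * Exponential sums over the field with p elements *)

Section AdditiveCharacter.
Variables (R : realType) (p : nat).
Hypothesis p_pr : prime p.
Local Notation nm := (@Normc.normc R).

Let cis (x : R) : R[i] := (cos x +i* sin x)%C.
Let cisD x y : cis (x + y) = cis x * cis y.
Proof.
rewrite /cis cosD sinD; apply/eqP; rewrite eq_complex /=.
by apply/andP; split; apply/eqP; ring.
Qed.
Let cisX x n : cis (x *+ n) = cis x ^+ n.
Proof.
by elim: n => [|n IH]; rewrite ?mulr0n /cis ?cos0 ?sin0// mulrS exprS -IH -cisD.
Qed.

Definition rootp : R[i] := cis (pi *+ 2 / p%:R).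
Definition charp (x : 'F_p) : R[i] := rootp ^+ x.

Let p_gt0 : (0 < p)%N. Proof. exact: prime_gt0. Qed.

Lemma rootpXp : rootp ^+ p = 1.
Proof.
rewrite /rootp -cisX -[X in cis X]mulr_natr divfK ?pnatr_eq0 -?lt0n//.
by rewrite /cis cos2pi sin2pi.
Qed.

Lemma charp_nat n : charp n%:R = rootp ^+ n.
Proof.
rewrite /charp val_Fp_nat// [in RHS](divn_eq n p) exprD mulnC exprM rootpXp.
by rewrite expr1n mul1r.
Qed.

Lemma charp0 : charp 0 = 1.
Proof. by rewrite /charp expr0. Qed.

Lemma charpD x y : charp (x + y) = charp x * charp y.
Proof. by rewrite -[x]natr_Zp -[y]natr_Zp -natrD !charp_nat exprD. Qed.

Lemma normc_charp x : nm (charp x) = 1.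
Proof.
rewrite /charp normcX /rootp /cis /Normc.normc cos2Dsin2 sqrtr1.
by rewrite expr1n.
Qed.

Lemma charpN x : charp (- x) = ((charp x)^*)%C.
Proof.
apply: (@mulIf _ (charp x)).
  by apply/eqP => /(congr1 nm); rewrite normc_charp Normc.normc0; lra.
by rewrite -charpD addNr charp0 mulrC -sqr_normcE normc_charp expr1n.
Qed.

Lemma charp_sum (I : Type) (s : seq I) (F : I -> 'F_p) :
  charp (\sum_(i <- s) F i) = \prod_(i <- s) charp (F i).
Proof. by apply: (big_morph charp charpD charp0). Qed.

Lemma charpMn x n : charp (x *+ n) = charp x ^+ n.
Proof. by elim: n => [|n IH]; rewrite ?charp0// mulrS charpD IH exprS. Qed.

(* A multiple of the angle lands in the second quadrant, where the character is
   at distance at least 1 from 1. *)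
Lemma charp_dist (n : nat) : (0 < n)%N -> (2 * n <= p)%N ->
  (2 * n)%:R / p%:R <= nm (1 - charp n%:R).
Proof.
move=> n0 np.
have pR0 : (0 : R) < p%:R by rewrite ltr0n.
(* This k gives p / 4 < k n <= p / 2, an angle between pi / 2 and pi. Conversely 1 - z^k is 1 - z
   times a sum of k unimodular terms, and k <= p / (2 n). *)
pose k := (p %/ (2 * n))%N.
have k0 : (0 < k)%N by rewrite divn_gt0//; lia.
have kn : (2 * (k * n) <= p < 4 * (k * n))%N.
  by have := divn_eq p (2 * n); have := @ltn_pmod p (2 * n); rewrite -/k; nia.
have far : 1 <= nm (1 - charp n%:R ^+ k).
  rewrite -charpMn -mulrnA mulnC charp_nat /rootp -cisX.
  apply: le_trans (normc_Re _) => /=; rewrite lerDl oppr_ge0.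
  set x := _ *+ _.
  have xE : x = pi * ((2 * (k * n))%:R / p%:R).
    by rewrite /x -mulr_natr natrM -mulr_natr; ring.
  have lo : pi / 2 <= x.
    rewrite xE ler_wpM2l ?pi_ge0// ler_pdivlMr// mulrC ler_pdivrMr//.
    by rewrite -natrM ler_nat; lia.
  have hi : x <= pi.
    rewrite xE -[leRHS]mulr1 ler_wpM2l ?pi_ge0// ler_pdivrMr// mul1r ler_nat.
    by lia.
  rewrite -[x](subrK (pi / 2)) cosDpihalf oppr_le0 sin_ge0_pi//.
  by rewrite subr_ge0 lo /=; have := pi_ge0 R; lra.
have near : nm (1 - charp n%:R ^+ k) <= k%:R * nm (1 - charp n%:R).
  rewrite -[X in X - _](expr1n _ k) subrXX Normc.normcM mulrC ler_wpM2r ?normc_ge0//.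
  apply: le_trans (normc_sum _ _ _) _.
  have -> : k%:R = \sum_(i < k) 1 :> R by rewrite sumr_const card_ord.
  apply: ler_sum => i _.
  by rewrite expr1n mul1r normcX normc_charp expr1n.
have kR0 : (0 : R) < k%:R by rewrite ltr0n.
rewrite -(ler_pM2l kR0); apply: le_trans (le_trans far near).
rewrite mulrA -natrM ler_pdivrMr// mul1r ler_nat; lia.
Qed.

(** For x nonzero, [charp_dist] at x or at p - x, whichever is at most p / 2, shows that the
    character is not 1 at x; the shift of j by 1 then forces the sum to vanish. *)
Lemma charp_orthogonality (x : 'F_p) :
  \sum_(j : 'F_p) charp (j * x) = if x == 0 then p%:R else 0.
Proof.
case: eqVneq => [->|x0].
  under eq_bigr do rewrite mulr0 charp0.
  by rewrite sumr_const card_Fp.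
have ne1 : charp x != 1.
  apply/eqP => e1.
  have xp : (x < p)%N by rewrite -[X in (_ < X)%N](Fp_cast p_pr) ltn_ord.
  have xn0 : (0 < x)%N by rewrite lt0n; apply: contra x0 => /eqP x0; apply/eqP/val_inj.
  have contra n : (0 < n)%N -> (2 * n <= p)%N -> charp n%:R = 1 -> False.
    move=> n0 np c1; have := charp_dist n0 np; rewrite c1 subrr Normc.normc0.
    by rewrite leNgt divr_gt0// ltr0n//; lia.
  case: (leqP (2 * x) p) => xp2; first by apply: (contra x) => //; rewrite natr_Zp.
  apply: (contra (p - x)%N); [lia|lia|].
  rewrite natrB ?(ltnW xp)// natr_Zp pchar_Fp_0// sub0r charpN e1.
  by rewrite conjc1.
have : charp x * \sum_j charp (j * x) = \sum_j charp (j * x).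
  rewrite mulr_sumr [RHS](reindex_inj (addrI 1)) /=.
  by apply: eq_bigr => j _; rewrite mulrDl mul1r charpD.
move/eqP; rewrite -subr_eq0 -{2}[\sum_j _]mul1r -mulrBl mulf_eq0 subr_eq0.
by rewrite (negPf ne1) => /eqP.
Qed.

End AdditiveCharacter.

(** Lagrange's identity: twice the defect is the sum of the squares of the 2 x 2 minors. *)
Lemma cauchy_schwarz_sum (R : realDomainType) (I : finType) (x y : I -> R) :
  (\sum_i x i * y i) ^+ 2 <= (\sum_i x i ^+ 2) * \sum_i y i ^+ 2.
Proof.
have : 0 <= \sum_i \sum_j (x i * y j - x j * y i) ^+ 2.
  by apply: sumr_ge0 => i _; apply: sumr_ge0 => j _; exact: sqr_ge0.
rewrite (_ : \sum_i \sum_j _ =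
    2 * ((\sum_i x i ^+ 2) * (\sum_i y i ^+ 2) - (\sum_i x i * y i) ^+ 2)).
  by rewrite pmulr_rge0// subr_ge0.
transitivity (\sum_i (x i ^+ 2 * \sum_j y j ^+ 2 + y i ^+ 2 * \sum_j x j ^+ 2
                      - 2 * (x i * y i * \sum_j x j * y j))).
  apply: eq_bigr => i _; rewrite !mulr_sumr -sumrN -!big_split /=.
  by apply: eq_bigr => j _; ring.
rewrite sumrB big_split /= -mulr_sumr -!mulr_suml; ring.
Qed.

Lemma sqr_sum_le (R : realDomainType) (I : finType) (x : I -> R) :
  (\sum_i x i) ^+ 2 <= #|I|%:R * \sum_i x i ^+ 2.
Proof.
have := cauchy_schwarz_sum x (fun=> 1).
under eq_bigr do rewrite mulr1.
by rewrite expr1n sumr_const mulrC.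
Qed.

(** * Residues of least absolute value modulo p *)

Section SmallResidues.
Variable p : nat.
Hypothesis p_pr : prime p.

(** The lift in the interval (-p/2, p/2]; its absolute value serves as the distance to 0 in 'F_p. *)
Definition sres (x : 'F_p) : int := if (2 * x <= p)%N then x%:Z else x%:Z - p%:Z.

Lemma Fp_lt (x : 'F_p) : (x < p)%N.
Proof. by rewrite -[X in (_ < X)%N](Fp_cast p_pr) ltn_ord. Qed.

Lemma Fp_natr_eq0 n : (n%:R == 0 :> 'F_p) = (p %| n)%N.
Proof. by rewrite -(dvdn_pcharf (pchar_Fp p_pr)). Qed.

Lemma Fp_intr_eq0 (z : int) : (z%:~R == 0 :> 'F_p) = (p %| absz z)%N.
Proof.
case: z => n; first by rewrite -Fp_natr_eq0.
by rewrite NegzE rmorphN oppr_eq0 abszN -Fp_natr_eq0.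
Qed.

Lemma sresK x : (sres x)%:~R = x.
Proof.
rewrite /sres; case: ifP => _; first exact: natr_Zp.
rewrite rmorphB /= -[X in _ - X]/(p%:R) pchar_Fp_0// subr0; exact: natr_Zp.
Qed.

Lemma sres_le x : (2 * absz (sres x) <= p)%N.
Proof. by have := Fp_lt x; rewrite /sres; case: ifP; lia. Qed.

(** Otherwise the difference of the two lifts would be a nonzero multiple of p smaller than 2 |sres
    y| <= p. *)
Lemma sres_min y : (absz (sres y%:~R) <= absz y)%N.
Proof.
rewrite leqNgt; apply/negP => lt.
have : ((sres y%:~R - y)%:~R == 0 :> 'F_p) by rewrite rmorphB /= sresK subrr.
have := sres_le y%:~R; move: (sres _) lt => s lt sp.
rewrite Fp_intr_eq0 => /dvdnP[k]; have := prime_gt0 p_pr.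
case: k => [|k]; nia.
Qed.

Definition near (Y : nat) (x : 'F_p) : bool := (absz (sres x) <= Y)%N.

Lemma near_int Y (y : int) : (absz y <= Y)%N -> near Y y%:~R.
Proof. exact/leq_trans/sres_min. Qed.

Lemma card_near Y (c : 'F_p) : c != 0 ->
  (#|[set j : 'F_p | near Y (c * j)%R]| <= (2 * Y).+1)%N.
Proof.
move=> c0; rewrite -[X in (_ <= X)%N]card_ord.
pose f (j : 'F_p) : 'I_(2 * Y).+1 := inord (absz (sres (c * j) + Y%:Z)).
apply: (@leq_card_in _ _ f).
move=> i j; rewrite !inE /near => ni nj /(congr1 val).
rewrite /f /= => e; apply: (mulfI c0).
rewrite -[LHS]sresK -[RHS]sresK; congr (_%:~R).
move: e ni nj; move: (sres _) (sres _) => s t.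
move=> + sY tY; rewrite !inordK; lia.
Qed.

End SmallResidues.

(** * A smoothed Weyl sum, bounded through Fejer kernels *)

Section WeylSum.
Variables (R : realType) (p N : nat).
Hypotheses (p_pr : prime p) (N_gt0 : (0 < N)%N).
Let A := (4 * N)%N.
Let L := (p %/ A)%N.
Hypothesis ltAp : (A <= p)%N.
Local Notation nm := (@Normc.normc R).
Local Notation e := (@charp R p).

(* Of the frequencies [2 j (b - b')] met in squaring [weyl j], those falling in
   one arc of length about p / A; the shift by [2 * A] keeps differences in nat. *)
Definition revisits (j : 'F_p) : nat :=
  #|[set h : 'I_(4 * A) | near L (2 * j * ((h : nat)%:R - (2 * A)%:R))]|.

(* The difference of two variables smooths the sum: Cauchy-Schwarz in [a] then
   produces Fejer kernels, whose sum over well-spaced arcs converges, so that no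
   logarithm is lost. *)
Definition weyl (j : 'F_p) : R[i] :=
  \sum_(a : 'I_A * 'I_A) \sum_(b < A)
    e (j * ((a.1 : nat)%:R - (a.2 : nat)%:R + ((b : nat)%:R - (2 * N)%:R)) ^+ 2).

Definition fejer (x : 'F_p) : R := nm (\sum_(a < A) e (x * (a : nat)%:R)) ^+ 2.

Let A_gt0 : (0 < A)%N. Proof. by rewrite /A; lia. Qed.
Let L_gt0 : (0 < L)%N. Proof. by rewrite divn_gt0. Qed.
Let pR_gt0 : (0 : R) < p%:R. Proof. by rewrite ltr0n prime_gt0. Qed.
Let lepAL : (p <= 2 * A * L)%N.
Proof. by have := divn_eq p A; have := ltn_pmod p A_gt0; rewrite -/L; nia. Qed.

Lemma fejer_ge0 x : 0 <= fejer x. Proof. exact: sqr_ge0. Qed.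

Lemma fejer_le x : fejer x <= A%:R ^+ 2.
Proof.
rewrite /fejer lerXn2r ?nnegrE ?ler0n ?normc_ge0//.
apply: le_trans (normc_sum _ _ _) _.
under eq_bigr do rewrite normc_charp.
by rewrite sumr_const card_ord.
Qed.

(** The geometric sum has modulus at most 2 / |1 - e(x)|, and [charp_dist] bounds the denominator
    below by 2 |x| / p. *)
Lemma fejer_decay x : fejer x * (absz (sres x))%:R ^+ 2 <= p%:R ^+ 2.
Proof.
have [->|y0] := posnP (absz (sres x)); first by rewrite expr0n mulr0 sqr_ge0.
rewrite /fejer -exprMn lerXn2r ?nnegrE ?mulr_ge0 ?ler0n ?normc_ge0//.
have dist : (2 * absz (sres x))%:R / p%:R <= nm (1 - e x).
  apply: le_trans (charp_dist R p_pr y0 (sres_le p_pr x)) _.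
  rewrite -[in leRHS](sresK p_pr x); case: (sres x) => n //=.
  rewrite NegzE rmorphN /= -[X in e (- X)]/(n.+1%:R) charpN//.
  by rewrite -[leRHS]normc_conj rmorphB rmorph1 /= conjcK.
have geom : nm (\sum_(a < A) e (x * (a : nat)%:R)) * nm (1 - e x) <= 2.
  rewrite -Normc.normcM mulrC.
  under eq_bigr do rewrite mulr_natr charpMn//.
  have -> : (1 - e x) * \sum_(i < A) e x ^+ i = 1 - e x ^+ A.
    rewrite -[1 in RHS](expr1n _ A) subrXX; congr (_ * _).
    by apply: eq_bigr => i _; rewrite expr1n mul1r.
  apply: le_trans (le_normcD _ _) _.
  by rewrite normcN Normc.normc1 normcX normc_charp expr1n.
rewrite -(ler_pM2r (_ : 0 < 2 / p%:R)) ?divr_gt0//.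
rewrite [leRHS]mulrCA divff ?mulr1 ?gt_eqF//.
apply: le_trans geom; rewrite -mulrA ler_wpM2l ?normc_ge0//.
by apply: le_trans dist; rewrite natrM mulrCA mulrA.
Qed.

Let psi (l : nat) : R := if l is 0 then 1 else (l%:R ^+ 2)^-1.

Let psi_ge0 l : 0 <= psi l.
Proof. by case: l => [|l] //=; rewrite invr_ge0 sqr_ge0. Qed.

(** Telescoping of 1 / l^2 <= 1 / (l - 1) - 1 / l from l = 2 on, the first two terms being 1. *)
Let psi_sum n : \sum_(l < n) psi l <= 3.
Proof.
suff H : \sum_(l < n.+2) psi l <= 3 - n.+1%:R^-1.
  apply: (@le_trans _ _ (\sum_(l < n.+2) psi l)).
    by clear H; move: psi psi_ge0 => f f0; rewrite !big_ord_recr /= -addrA lerDl addr_ge0.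
  by apply: le_trans H _; rewrite gerBl invr_ge0.
elim: n => [|n IH]; first by rewrite !big_ord_recr big_ord0 /= expr1n invr1; lra.
rewrite big_ord_recr /=; apply: le_trans (lerD IH (lexx _)) _.
set x : R := n.+1%:R; have -> : n.+2%:R = x + 1 by rewrite /x -natr1.
have x1 : 0 < x by rewrite /x ltr0n.
have -> : 3 - x^-1 + ((x + 1) ^+ 2)^-1 = 3 - (x + 1)^-1 - (x * (x + 1) ^+ 2)^-1.
  by field; rewrite ?gt_eqF//; lra.
by rewrite gerBl invr_ge0 mulr_ge0 ?sqr_ge0 ?ltW.
Qed.

(** Arcs of length L on either side of 0. The sign keeps the two sides apart, so that points of one
    arc differ by less than L. *)
Let arc (x : 'F_p) : bool * nat := (sres x < 0, (absz (sres x) %/ L)%N).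

Let fejer_arc x : fejer x <= 4 * A%:R ^+ 2 * psi (arc x).2.
Proof.
rewrite /arc /=; have := divn_eq (absz (sres x)) L.
case: (_ %/ _)%N => [|l] /= yE.
  by rewrite mulr1; apply: le_trans (fejer_le x) _; rewrite ler_peMl ?sqr_ge0//; lra.
have lR : (0 : R) < l.+1%:R by rewrite ltr0n.
have LR : (0 : R) < L%:R by rewrite ltr0n.
rewrite ler_pdivlMr ?exprn_gt0//.
rewrite -(ler_pM2r (exprn_gt0 2 LR)).
apply: (@le_trans _ _ (p%:R ^+ 2)).
  apply: le_trans (fejer_decay x); rewrite -mulrA ler_wpM2l ?fejer_ge0//.
  rewrite -exprMn lerXn2r ?nnegrE ?mulr_ge0 ?ler0n//.
  by rewrite -natrM ler_nat yE leq_addr.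
rewrite (_ : 4 = 2 ^+ 2 :> R); last by ring.
by rewrite -!exprMn -!natrM lerXn2r ?nnegrE ?ler_nat.
Qed.

Let arc_bound x : ((arc x).2 < A.+1)%N.
Proof.
rewrite /arc /= ltnS -(leq_pmul2r L_gt0).
apply: leq_trans (leq_divM _ _) _.
by have := sres_le p_pr x; have := lepAL; lia.
Qed.

Let arc_near x y : arc x = arc y -> near L (x - y).
Proof.
move=> /= [sg lv].
rewrite -(sresK p_pr x) -(sresK p_pr y) -rmorphB /=; apply: near_int => //.
move: sg lv; move: (sres x) (sres y) => {}x {}y sg lv.
have := divn_eq (absz x) L; have := divn_eq (absz y) L; rewrite lv.
have := ltn_pmod (absz x) L_gt0; have := ltn_pmod (absz y) L_gt0.
by move: sg; case: ltP; case: ltP; nia.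
Qed.

(** Subtracting the frequency of one fixed member [b0] moves all frequencies of the arc next to 0,
    where [revisits] counts them under the index [b0 + 2 * A - b']. *)
Let arc_card j (b : 'I_A) c :
  (#|[set b' : 'I_A | arc (2 * j * ((b : nat)%:R - (b' : nat)%:R))%R == c]|
     <= revisits j)%N.
Proof.
set S := [set _ | _]; have [->|[b0 b0S]] := set_0Vmem S; first by rewrite cards0.
have hb (b' : 'I_A) : (b0 + 2 * A - b' < 4 * A)%N by have := ltn_ord b0; lia.
pose f (b' : 'I_A) := Ordinal (hb b').
rewrite -(card_in_imset (f := f)) => [|x y _ _ /(congr1 val)]; last first.
  by move=> /= xy; apply/val_inj => /=; have := ltn_ord x; have := ltn_ord y; lia.
apply/subset_leq_card/fintype.subsetP => h /imsetP[b' b'S ->].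
rewrite inE /= natrB; last by have := ltn_ord b'; lia.
rewrite natrD addrAC addrK.
have -> : 2 * j * ((b0 : nat)%:R - (b' : nat)%:R) =
   2 * j * ((b : nat)%:R - (b' : nat)%:R) - 2 * j * ((b : nat)%:R - (b0 : nat)%:R) by ring.
by apply: arc_near; move: b'S b0S; rewrite !inE => /eqP -> /eqP ->.
Qed.

(** Each arc receives at most [revisits j] of the b', and the kernel on it is at most 4 A^2 [psi].
    Here 24 = 4 * 2 * 3, for the two signs and [psi_sum]. *)
Let fejer_row j (b : 'I_A) :
  \sum_(b' < A) fejer (2 * j * ((b : nat)%:R - (b' : nat)%:R)) <=
  24 * A%:R ^+ 2 * (revisits j)%:R.
Proof.
pose c (b' : 'I_A) : bool * 'I_A.+1 :=
  let a := arc (2 * j * ((b : nat)%:R - (b' : nat)%:R)) in (a.1, inord a.2).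
apply: (@le_trans _ _ (\sum_(b' < A) 4 * A%:R ^+ 2 * psi (c b').2)).
  apply: ler_sum => b' _; rewrite /c /= inordK ?arc_bound//; exact: fejer_arc.
rewrite (partition_big c predT) //=.
apply: (@le_trans _ _ (\sum_(k : bool * 'I_A.+1)
   4 * A%:R ^+ 2 * psi k.2 * (revisits j)%:R)).
  apply: ler_sum => k _.
  rewrite (eq_bigr (fun=> 4 * A%:R ^+ 2 * psi k.2)); last by move=> b' /andP[_ /eqP <-].
  rewrite sumr_const -[_ *+ _]mulr_natr ler_wpM2l ?mulr_ge0 ?sqr_ge0 ?psi_ge0//.
  rewrite ler_nat; apply: leq_trans (arc_card j b (k.1, val k.2)).
  rewrite -cardsE; apply/subset_leq_card/fintype.subsetP => b'; rewrite !inE.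
  rewrite unfold_in => /andP[/eqP <- /eqP <-].
  by rewrite /c /= inordK ?arc_bound// -surjective_pairing.
rewrite -mulr_suml ler_wpM2r// -mulr_sumr -(pair_bigA _ (fun _ k => psi (val k))) /=.
rewrite big_bool /=.
have := psi_sum A.+1; set u := \sum_(_ < _) _ => u3.
have A2 : 0 <= A%:R ^+ 2 :> R by exact: sqr_ge0.
by nra.
Qed.

(** Once the square is opened, the sum over the pair [a] of e(2 j (a1 - a2) (b - b')) is exactly a
    Fejer kernel; being nonnegative, it survives the triangle inequality that removes the unimodular
    coefficients. *)
Let bilinear j (y : 'I_A -> R[i]) : (forall b, nm (y b) = 1) ->
  \sum_(a : 'I_A * 'I_A)
    nm (\sum_(b < A) y b * e (2 * j * ((a.1 : nat)%:R - (a.2 : nat)%:R) * (b : nat)%:R)) ^+ 2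
  <= \sum_(b < A) \sum_(b' < A) fejer (2 * j * ((b : nat)%:R - (b' : nat)%:R)).
Proof.
move=> y1.
set S := (X in X <= _).
have S0 : 0 <= S by apply: sumr_ge0 => a _; exact: sqr_ge0.
have -> : S = nm (real_complex R S).
  by rewrite /Normc.normc /= expr0n addr0 sqrtr_sqr ger0_norm.
have -> : real_complex R S = \sum_(b < A) \sum_(b' < A) y b * ((y b')^*)%C *
   real_complex R (fejer (2 * j * ((b : nat)%:R - (b' : nat)%:R))).
  rewrite /S rmorph_sum /=.
  under eq_bigr => a _.
    rewrite sqr_normcE conjc_sum mulr_suml.
    under eq_bigr => b _ do rewrite mulr_sumr.
    over.
  rewrite exchange_big /=; apply: eq_bigr => b _.
  rewrite exchange_big /=; apply: eq_bigr => b' _.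
  rewrite /fejer sqr_normcE conjc_sum mulr_suml.
  under [in RHS]eq_bigr => a _ do rewrite mulr_sumr.
  rewrite pair_bigA mulr_sumr /=; apply: eq_bigr => -[a1 a2] _ /=.
  rewrite rmorphM /= -!charpN// mulrACA -!charpD//; congr (_ * e _).
  by ring.
apply: le_trans (normc_sum _ _ _) _; apply: ler_sum => b _.
apply: le_trans (normc_sum _ _ _) _; apply: ler_sum => b' _.
rewrite !Normc.normcM normc_conj !y1 !mul1r.
by rewrite /Normc.normc /= expr0n addr0 sqrtr_sqr ger0_norm ?fejer_ge0.
Qed.

(** Expanding the square splits off a unimodular factor depending on a1 - a2 only; Cauchy-Schwarz
    over the A^2 pairs then leads to [bilinear]. Against the trivial bound A^6, the gain is
    [revisits j] / A. *)
Lemma weyl_bound j : nm (weyl j) ^+ 2 <= 24 * A%:R ^+ 5 * (revisits j)%:R.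
Proof.
pose y (b : 'I_A) := e (j * ((b : nat)%:R - (2 * N)%:R) ^+ 2).
pose u (a : 'I_A * 'I_A) := nm (\sum_(b < A) y b * e (2 * j * ((a.1 : nat)%:R - (a.2 : nat)%:R) * (b : nat)%:R)).
have le1 : nm (weyl j) <= \sum_(a : 'I_A * 'I_A) u a.
  apply: le_trans (normc_sum _ _ _) _; apply: ler_sum => a _.
  rewrite le_eqVlt /u; apply/orP; left; apply/eqP.
  set x := (a.1 : nat)%:R - (a.2 : nat)%:R.
  have -> : \sum_(b < A) e (j * (x + ((b : nat)%:R - (2 * N)%:R)) ^+ 2) =
    e (j * x ^+ 2 - 2 * j * x * (2 * N)%:R) * \sum_(b < A) y b * e (2 * j * x * (b : nat)%:R).
    rewrite mulr_sumr; apply: eq_bigr => b _.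
    by rewrite /y -!charpD//; congr (e _); ring.
  by rewrite Normc.normcM normc_charp mul1r.
apply: le_trans (_ : (\sum_a u a) ^+ 2 <= _).
  rewrite lerXn2r ?nnegrE ?normc_ge0//; apply: sumr_ge0 => a _; exact: normc_ge0.
apply: le_trans (sqr_sum_le _) _.
rewrite card_prod card_ord.
have -> : 24 * A%:R ^+ 5 * (revisits j)%:R =
  (A * A)%:R * (A%:R * (24 * A%:R ^+ 2 * (revisits j)%:R)) :> R.
  by rewrite natrM; ring.
rewrite ler_wpM2l//.
apply: le_trans (bilinear j (y := y) _) _; first by move=> b; exact: normc_charp.
apply: le_trans (ler_sum _ (fun b _ => fejer_row j b)) _.
by rewrite sumr_const card_ord -[leLHS]mulr_natl.
Qed.

End WeylSum.

Lemma ltn_same_quotient n a b : (0 < n)%N -> (a %/ n = b %/ n)%N -> (a < b + n)%N.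
Proof.
move=> n0 ab; rewrite (divn_eq a n) ab {2}(divn_eq b n) -addnA ltn_add2l.
by rewrite (leq_trans (ltn_pmod a n0))// leq_addl.
Qed.

Lemma same_quotient_dist n (a b : nat) : (0 < n)%N -> (a %/ n = b %/ n)%N ->
  (absz (a%:Z - b%:Z) <= n.-1)%N.
Proof.
move=> n0 ab; have := ltn_same_quotient n0 ab.
have := ltn_same_quotient n0 (esym ab); clear ab; lia.
Qed.

Lemma absz_sub_le (x y : int) m n :
  (absz x <= m)%N -> (absz y <= n)%N -> (absz (x - y) <= m + n)%N.
Proof. lia. Qed.

(** * Distribution of the frequencies according to [revisits] *)

Section Distribution.
Variables (p N : nat).
Hypotheses (p_pr : prime p) (N_gt0 : (0 < N)%N).
Let A := (4 * N)%N.
Let L := (p %/ A)%N.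
Hypothesis leAp : (A ^ 2 <= p)%N.

Let A_gt0 : (0 < A)%N. Proof. by rewrite /A; lia. Qed.
Let leAL : (A <= L)%N. Proof. by rewrite leq_divRL// -expnSr; exact: leAp. Qed.
Let leALp : (A * L <= p)%N. Proof. by rewrite mulnC leq_divM. Qed.

Let lift j (h : 'I_(4 * A)) : int := sres (2 * j * ((h : nat)%:R - (2 * A)%:R) : 'F_p).

Let lift_diff j h h' :
  (lift j h' - lift j h)%:~R = 2 * j * ((h' : nat)%:Z - (h : nat)%:Z)%:~R :> 'F_p.
Proof. by rewrite rmorphB /= /lift !sresK// rmorphB /=; ring. Qed.

(* Two such difference vectors [(h2 - h1, lift h2 - lift h1)] have a determinant
   divisible by p and smaller than p, hence zero. *)
Let collinear j (h1 h2 h3 h4 : 'I_(4 * A)) :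
  (absz (lift j h1) <= L)%N -> (absz (lift j h2) <= L)%N ->
  (absz (lift j h3) <= L)%N -> (absz (lift j h4) <= L)%N ->
  (h1 %/ N = h2 %/ N)%N -> (h3 %/ N = h4 %/ N)%N ->
  ((h2 : nat)%:Z - (h1 : nat)%:Z) * (lift j h4 - lift j h3) =
  ((h4 : nat)%:Z - (h3 : nat)%:Z) * (lift j h2 - lift j h1).
Proof.
move=> l1 l2 l3 l4 b12 b34; apply/eqP; rewrite -subr_eq0.
set z : int := _ - _.
have : (z%:~R == 0 :> 'F_p).
  by rewrite /z rmorphB !rmorphM /= !lift_diff; apply/eqP; ring.
rewrite Fp_intr_eq0// => /dvdnP[k].
have d34 := absz_sub_le l4 l3; have d12 := absz_sub_le l2 l1.
have ltz : (absz z < p)%N.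
  apply: (@leq_ltn_trans (N.-1 * (L + L) + N.-1 * (L + L))).
    apply: absz_sub_le; rewrite abszM leq_mul ?d34 ?d12//.
      exact: (same_quotient_dist N_gt0 (esym b12)).
    exact: (same_quotient_dist N_gt0 (esym b34)).
  by apply: leq_trans leALp; have := leAL; rewrite /A; move: (L) => l; clear -N_gt0; nia.
case: k => [|k] zE; first by rewrite -absz_eq0 zE.
by move: ltz; rewrite zE mulSn ltnNge leq_addr.
Qed.

(** Take for q the least gap of E and let W be its width, so that K q <= W < N. By [collinear], the
    vector of the least gap is q / W times that of the width, whose second coordinate is at most 2
    L. *)
Let short_vector j (E : {set 'I_(4 * A)}) K c : (0 < K)%N -> (K < #|E|)%N ->
  (forall h, h \in E -> (absz (lift j h) <= L)%N /\ (h %/ N = c)%N) ->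
  exists q : nat, [/\ (0 < q)%N, (q * K <= N)%N &
                      (absz (sres (2 * q%:R * j : 'F_p)%R) * K <= 2 * L)%N].
Proof.
move=> K0 KE HE.
have [a [b [aE bE ab]]] : exists a b, [/\ a \in E, b \in E & (a < b)%N].
  have : (1 < #|E|)%N by apply: leq_ltn_trans KE.
  move=> /card_gt1P[a [b [aE bE]]]; rewrite -val_eqE neq_ltn => /orP[] ab.
    by exists a, b.
  by exists b, a.
pose P := [pred x : 'I_(4 * A) * 'I_(4 * A) | [&& x.1 \in E, x.2 \in E & (x.1 < x.2)%N]].
have Pab : P (a, b) by rewrite /= aE bE.
case: (@arg_minnP _ (a, b) P (fun x => x.2 - x.1)%N Pab) => -[h1 h2] /= /and3P[h1E h2E h12] qmin.
case: (@arg_minnP _ a (mem E) (fun x => val x) aE) => hm hmE mmin.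
case: (@arg_maxnP _ a (mem E) (fun x => val x) aE) => hM hME Mmax.
have [q qE] : exists q, q = (h2 - h1)%N by eexists.
have [W WE] : exists W, W = (hM - hm)%N by eexists.
rewrite /= -qE in qmin; have q0 : (0 < q)%N by rewrite qE subn_gt0.
have KqW : (K * q <= W)%N.
  rewrite -leq_divRL// -ltnS; apply: leq_trans KE _.
  rewrite -[X in (_ <= X)%N]card_ord.
  (* Members of E are at least q apart, so these quotients separate them and E has at most W / q + 1
     elements. *)
  pose f (h : 'I_(4 * A)) : 'I_(W %/ q).+1 := inord ((h - hm) %/ q).
  apply: (@leq_card_in _ _ f) => x y xE yE /(congr1 (@nat_of_ord _)).
  have fE h : h \in E -> (f h : nat) = ((h - hm) %/ q)%N.
    by move=> hE; rewrite /f inordK// ltnS leq_div2r// WE leq_sub2r//; exact: Mmax.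
  rewrite (fE x xE) (fE y yE) => fxy.
  apply: ord_inj; apply/eqP; rewrite eqn_leq.
  have := mmin _ xE; have := mmin _ yE; move=> /= my mx.
  have xy := @ltn_same_quotient q (x - hm) (y - hm) q0 fxy.
  have yx := @ltn_same_quotient q (y - hm) (x - hm) q0 (esym fxy).
  apply/andP; split; rewrite leqNgt; apply/negP => lt.
    have := qmin (y, x); rewrite /= xE yE lt => /(_ isT) /=.
    by clear -mx my yx xy lt; lia.
  have := qmin (x, y); rewrite /= xE yE lt => /(_ isT) /=.
  by clear -mx my yx xy lt; lia.
have [l1 b1] := HE _ h1E; have [l2 b2] := HE _ h2E.
have [lm bm] := HE _ hmE; have [lM bM] := HE _ hME.
have WN : (W < N)%N.
  by rewrite WE; have := ltn_same_quotient N_gt0 (etrans bM (esym bm)); have := mmin _ hME; clear -N_gt0; lia.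
exists q; split => //; first by rewrite mulnC (leq_trans KqW)// ltnW.
have -> : 2 * q%:R * j = (lift j h2 - lift j h1)%:~R :> 'F_p.
  by rewrite lift_diff subzn ?(ltnW h12)// -qE mulrAC.
apply: (@leq_trans (absz (lift j h2 - lift j h1) * K)).
  by rewrite leq_mul2r sres_min// orbT.
have W0 : (0 < W)%N by apply: leq_trans KqW; rewrite muln_gt0 K0.
have := collinear l1 l2 lm lM (etrans b1 (esym b2)) (etrans bm (esym bM)).
have -> : (h2 : nat)%:Z - (h1 : nat)%:Z = q%:Z by rewrite subzn ?(ltnW h12)// qE.
have -> : (hM : nat)%:Z - (hm : nat)%:Z = W%:Z by rewrite WE -subzn//; exact: mmin.
move=> /(congr1 absz); rewrite !abszM /=.
set y := absz (lift j h2 - _); set Y := absz _ => qYWy.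
have YL : (Y <= 2 * L)%N by rewrite mul2n -addnn; exact: absz_sub_le.
rewrite -(leq_pmul2r W0); apply: (@leq_trans (W * Y)); last by rewrite mulnC leq_mul2r YL orbT.
have -> : (y * K * W = K * q * Y)%N by rewrite -mulnA mulnCA [(y * W)%N]mulnC -qYWy mulnA.
by rewrite leq_mul2r KqW orbT.
Qed.

(** The 4 A = 16 N indices form 16 blocks of length N, and one block contains more than K of those
    counted. The conclusion places j / p near a rational of denominator 2 q. *)
Lemma revisits_level j K : (16 * K < revisits N j)%N -> (0 < K)%N ->
  exists q : nat, [/\ (0 < q)%N, (q * K <= N)%N &
                      (absz (sres (2 * q%:R * j : 'F_p)%R) * K <= 2 * L)%N].
Proof.
move=> rev K0.
pose S := [set h : 'I_(4 * A) | near L (2 * j * ((h : nat)%:R - (2 * A)%:R) : 'F_p)%R].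
pose blk (h : 'I_(4 * A)) : 'I_16 := inord (h %/ N).
have blkE h : (blk h : nat) = (h %/ N)%N.
  rewrite /blk inordK// ltn_divLR//; have := ltn_ord h; rewrite /A; lia.
have : exists c : 'I_16, (K < #|[set h in S | blk h == c]|)%N.
  apply/existsP; apply: contraLR rev; rewrite negb_exists -leqNgt => /forallP H.
  rewrite -[X in (X <= _)%N]/(#|S|) -sum1_card (partition_big blk predT)//=.
  apply: (@leq_trans (\sum_(c < 16) K)); last by rewrite sum_nat_const card_ord.
  apply: leq_sum => c _; have := H c; rewrite -leqNgt; apply: leq_trans.
  by rewrite -sum1_card; apply/eq_leq/eq_bigl => h; rewrite !inE.
move=> [c KE]; apply: (short_vector K0 KE (c := c)) => h.
by rewrite !inE => /andP[nh /eqP <-].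
Qed.

(** Union bound over the q <= N / K of [revisits_level]. As 2 q is invertible modulo p, each q
    accounts for at most 4 L / K + 1 values of j, and N (4 L + K) <= 5 N L <= 2 p. *)
Lemma card_revisits K : (0 < K)%N ->
  (#|[set j : 'F_p | 16 * K < revisits N j]| * K ^ 2 <= 2 * p)%N.
Proof.
move=> K0; pose Q := (N %/ K)%N.
pose B (q : 'I_Q.+1) := [set j : 'F_p | (0 < q)%N && near (2 * L %/ K) (2 * q%:R * j)%R].
have cardB q : (#|B q| <= if (0 < q) then (2 * (2 * L %/ K)).+1 else 0)%N.
  have [q0|] := ltnP; last first.
    rewrite leqn0 => /eqP q0; rewrite leqn0 cards_eq0; apply/eqP/setP => j.
    by rewrite !inE q0.
  have c0 : 2 * (q : nat)%:R != 0 :> 'F_p.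
    rewrite -natrM Fp_natr_eq0// gtnNdvd ?muln_gt0//.
    have : (q <= N)%N by apply: leq_trans (leq_div N K); rewrite -ltnS.
    by move: leAp; rewrite /A; nia.
  apply: leq_trans (card_near p_pr _ c0).
  by apply/subset_leq_card/fintype.subsetP => j; rewrite !inE q0.
have sub : [set j : 'F_p | (16 * K < revisits N j)%N] \subset \bigcup_q B q.
  apply/fintype.subsetP => j; rewrite inE => rev.
  have [q [q0 qK yK]] := revisits_level rev K0.
  have qQ : (q < Q.+1)%N by rewrite ltnS leq_divRL.
  by apply/bigcupP; exists (Ordinal qQ) => //; rewrite inE /= q0 /near leq_divRL.
have le1 : (#|[set j : 'F_p | 16 * K < revisits N j]| <= Q * (2 * (2 * L %/ K)).+1)%N.
  apply: leq_trans (subset_leq_card sub) _.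
  apply: leq_trans (_ : _ <= \sum_(q < Q.+1) #|B q|)%N _.
    elim/big_rec2: _ => [|q n U _ IH]; first by rewrite cards0.
    by apply: leq_trans (leq_card_setU _ _) _; rewrite leq_add2l.
  apply: leq_trans (leq_sum _ (fun q _ => cardB q)) _.
  rewrite big_ord_recl /= add0n; apply/eq_leq.
  by rewrite (eq_bigr (fun=> (2 * (2 * L %/ K)).+1))// sum_nat_const card_ord.
apply: leq_trans (leq_mul le1 (leqnn _)) _.
have := leq_divM N K; have := leq_divM (2 * L) K; rewrite -/Q.
have := leALp; have := leAL; rewrite /A.
case: (posnP Q) => [->|]; first by rewrite mul0n; lia.
move: (2 * L %/ K)%N => D Q0 AL Lp DK QK.
have KN : (K <= N)%N by nia.
apply: (@leq_trans (N * (5 * L))); last by nia.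
have -> : (Q * (2 * D).+1 * K ^ 2 = (Q * K) * (2 * (D * K) + K))%N by nia.
by apply: leq_mul => //; nia.
Qed.

(* A level measures how close [j / p] is to a rational of small denominator; it
   replaces the major arcs of the circle method. *)
Definition level (j : 'F_p) : nat := trunc_log 16 (revisits N j).

Lemma revisits_gt0 (j : 'F_p) : (0 < revisits N j)%N.
Proof.
have lt : (2 * A < 4 * A)%N by lia.
apply/card_gt0P; exists (Ordinal lt); rewrite inE /= subrr mulr0.
by have := @near_int _ p_pr 0 0; exact.
Qed.

Lemma lt_revisits_level (j : 'F_p) : (revisits N j < 16 ^ (level j).+1)%N.
Proof. exact: trunc_log_ltn. Qed.

Lemma card_level i : (#|[set j : 'F_p | i <= level j]| * 256 ^ i <= 2048 * p)%N.
Proof.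
have card_le (S : {set 'F_p}) : (#|S| <= p)%N.
  by apply: leq_trans (max_card _) _; rewrite card_Fp.
case: i => [|[|i]]; try by
  apply: leq_trans (leq_mul (card_le _) (leqnn _)) _; rewrite ?expn0 ?expn1 mulnC leq_mul2r orbT.
(* For level i + 2 this K makes 16 K half of 16^(i + 2), and 256^(i + 2) = 1024 K^2. Levels 0 and 1
   were trivial because 256 <= 2048. *)
have K0 : (0 < 8 * 16 ^ i)%N by rewrite muln_gt0 expn_gt0.
have := card_revisits K0.
set S := [set _ | _]; set T := [set j : 'F_p | _] => ST.
have TS : (#|T| <= #|S|)%N.
  apply/subset_leq_card/fintype.subsetP => j; rewrite !inE => il.
  apply: leq_trans (_ : 16 ^ i.+2 <= _)%N.
    by rewrite !expnS; clear -K0; lia.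
  apply: leq_trans (leq_pexp2l _ il) _ => //; apply: trunc_logP => //.
  exact: revisits_gt0.
have -> : (256 ^ i.+2 = 1024 * (8 * 16 ^ i) ^ 2)%N.
  have e : ((16 ^ i) ^ 2 = 256 ^ i)%N by rewrite -expnM mulnC expnM.
  by rewrite expnMn e !expnS; clear; lia.
by nia.
Qed.

(** By [card_level] level i has weight O(p 2^((b - 8) i)). From b = 9 on the sum is governed by the
    top level, at most k + 1 because [revisits] never exceeds 4 A = 16^(k + 1); no factor counting
    the levels is lost. *)
Lemma level_sum k b : N = (16 ^ k)%N -> (9 <= b)%N ->
  (\sum_(j : 'F_p) 2 ^ (level j * b) <= 4 * 2048 * p * 2 ^ k * 2 ^ (k.+1 * (b - 9)))%N.
Proof.
move=> Nk b9.
have lev j : (level j <= k.+1)%N.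
  have : (revisits N j <= 16 ^ k.+1)%N.
    apply: leq_trans (max_card _) _; rewrite card_ord /A Nk expnS; lia.
  by move=> /(leq_trunc_log 16); rewrite trunc_expnK.
apply: (@leq_trans (\sum_(j : 'F_p) 512 ^ level j * 2 ^ (k.+1 * (b - 9)))).
  apply: leq_sum => j _; have {1}-> : b = (9 + (b - 9))%N by lia.
  rewrite mulnDr expnD leq_mul ?leq_pexp2l ?leq_mul ?lev//.
  by rewrite mulnC expnM.
rewrite -big_distrl /= leq_mul2r; apply/orP; right.
apply: (@leq_trans (\sum_(j : 'F_p) \sum_(i < k.+2) (i <= level j)%N * 512 ^ i)).
  apply: leq_sum => j _.
  have lt : (level j < k.+2)%N by rewrite ltnS.
  by rewrite (bigD1 (Ordinal lt)) //= leqnn mul1n leq_addr.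
rewrite exchange_big /=.
apply: (@leq_trans (\sum_(i < k.+2) 2048 * p * 2 ^ i)).
  apply: leq_sum => i _; rewrite -big_distrl /=.
  have -> : (512 ^ i = 256 ^ i * 2 ^ i)%N by rewrite -expnMn.
  rewrite mulnA leq_mul2r; apply/orP; right; apply: leq_trans (card_level i).
  rewrite leq_mul2r; apply/orP; right; apply/eq_leq.
  by rewrite -sum1dep_card [RHS]big_mkcond.
rewrite -big_distrr /= (_ : (4 * 2048 * p * 2 ^ k = 2048 * p * 2 ^ k.+2)%N); last first.
  by rewrite !expnS; move: (2 ^ k)%N => u; clear; nia.
rewrite leq_mul2l; apply/orP; right.
elim: k.+2 => [|n IH]; first by rewrite big_ord0.
by rewrite big_ord_recr /= expnS; clear -IH; lia.
Qed.

End Distribution.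

(** * Moments of the number of representations as a sum of squares *)

Lemma addn_subn_inj (a b n m l : nat) :
  (l <= n)%N -> (a + n + m - l = b + n + m - l)%N -> a = b.
Proof. lia. Qed.

(** The coordinates run over [-N, N], so this is r_d(t) once t <= N^2. *)
Definition box_count (N d : nat) (t : int) : nat :=
  #|[set o : {ffun 'I_d -> 'I_(2 * N).+1} |
     \sum_i ((o i : nat)%:Z - N%:Z) ^+ 2 == t]|.

Section Moments.
Variables (R : realType) (p k d : nat).
Hypothesis p_pr : prime p.
Let N := (16 ^ k)%N.
Let A := (4 * N)%N.
Hypothesis leAp : (A ^ 2 <= p)%N.
Local Notation nm := (@Normc.normc R).
Local Notation e := (@charp R p).
Local Notation T := ('I_A * 'I_A * 'I_A)%type.

Let N_gt0 : (0 < N)%N. Proof. by rewrite expn_gt0. Qed.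
Let ltAp : (A <= p)%N. Proof. by apply: leq_trans leAp; rewrite expnS leq_pmulr// expn1 /A; lia. Qed.

Let pt (c : T) : 'F_p :=
  (c.1.1 : nat)%:R - (c.1.2 : nat)%:R + ((c.2 : nat)%:R - (2 * N)%:R).

(* Each point of the box is the value of [pt] at no fewer than [N ^ 2] triples in
   each coordinate, so that [rho] dominates [N ^ (2 * d) * box_count N d], while
   its Fourier transform is the power [weyl j ^+ d]. *)
Let rho (t : 'F_p) : nat := #|[set u : {ffun 'I_d -> T} | \sum_i pt (u i) ^+ 2 == t]|.

Let theta (j : 'F_p) : R[i] := weyl R N j ^+ d.

Let thetaE j : theta j = \sum_(u : {ffun 'I_d -> T}) e (j * \sum_i pt (u i) ^+ 2).
Proof.
rewrite /theta -[d in LHS]card_ord -prodr_const.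
have -> : weyl R N j = \sum_(c : T) e (j * pt c ^+ 2).
  by rewrite /weyl pair_bigA.
rewrite bigA_distr_bigA /=; apply: eq_bigr => u _.
by rewrite mulr_sumr charp_sum.
Qed.

Let rhoE t : p%:R * (rho t)%:R = \sum_(j : 'F_p) theta j * e (- (j * t)).
Proof.
transitivity (\sum_(u : {ffun 'I_d -> T}) \sum_(j : 'F_p) e (j * (\sum_i pt (u i) ^+ 2 - t))).
  rewrite (eq_bigr (fun u : {ffun 'I_d -> T} => if \sum_i pt (u i) ^+ 2 == t then p%:R else 0)).
    by rewrite -big_mkcond /= sumr_const mulr_natr; congr (_ *+ _); apply: eq_card => u; rewrite inE.
  by move=> u _; rewrite charp_orthogonality// subr_eq0.
rewrite exchange_big /=; apply: eq_bigr => j _.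
rewrite thetaE mulr_suml; apply: eq_bigr => u _.
by rewrite -charpD// mulrBr.
Qed.

(** The square root of the constants in [weyl_bound]: 24 <= 5^2, and 16 A^5 = (2^7 * 2^(10 k))^2
    because A = 2^(4 k + 2). *)
Let B : nat := (5 * (2 ^ 7 * 2 ^ (10 * k)))%N.

Let weyl_le (j : 'F_p) : nm (weyl R N j) <= (B * 4 ^ level N j)%:R.
Proof.
rewrite -(@ler_pXn2r _ 2) ?nnegrE ?normc_ge0//.
apply: le_trans (weyl_bound R p_pr N_gt0 ltAp j) _.
rewrite -natrX -!natrM -natrX ler_nat.
apply: leq_trans (leq_mul (leqnn _) (ltnW (lt_revisits_level _ j))) _.
have E : (A ^ 5 * 16 ^ (level N j).+1 = (2 ^ 7 * 2 ^ (10 * k) * 4 ^ level N j) ^ 2)%N.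
  rewrite /A /N -[4%N]/(2 ^ 2)%N -[16%N]/(2 ^ 4)%N -!expnM -!expnD -!expnM -?expnD.
  by congr (_ ^ _)%N; lia.
rewrite -mulnA E /B -!mulnA [in leqRHS]expnMn leq_mul2r.
by apply/orP; right.
Qed.

Let theta_le (j : 'F_p) : nm (theta j) <= (B ^ d * (2 ^ (level N j * d)) ^ 2)%:R.
Proof.
rewrite /theta normcX; apply: le_trans (_ : (B * 4 ^ level N j)%:R ^+ d <= _).
  by rewrite lerXn2r ?nnegrE ?normc_ge0 ?ler0n ?weyl_le.
rewrite -natrX ler_nat expnMn -expnM -[4%N]/(2 ^ 2)%N -!expnM leq_mul2l.
by apply/orP; right; rewrite leq_exp2l//; lia.
Qed.

(** Triangle inequality in the inversion formula [rhoE], which calls for [level_sum] at the exponent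
    2 d. *)
Let rho_le t : (9 <= 2 * d)%N ->
  (rho t <= B ^ d * (4 * 2048 * 2 ^ k * 2 ^ (k.+1 * (2 * d - 9))))%N.
Proof.
move=> d9; rewrite -(leq_pmul2l (prime_gt0 p_pr)) -(ler_nat R).
rewrite -normc_nat natrM rhoE; apply: le_trans (normc_sum _ _ _) _.
apply: (@le_trans _ _ (\sum_(j : 'F_p) (B ^ d * (2 ^ (level N j * d)) ^ 2)%:R)).
  apply: ler_sum => j _; rewrite Normc.normcM normc_charp mulr1; exact: theta_le.
rewrite -natr_sum ler_nat -big_distrr /= mulnCA leq_mul2l; apply/orP; right.
apply: (@leq_trans (\sum_(j : 'F_p) 2 ^ (level N j * (2 * d)))).
  by apply: leq_sum => j _; rewrite -expnM leq_exp2l//; lia.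
apply: leq_trans (level_sum p_pr N_gt0 leAp (erefl N) d9) _.
by apply/eq_leq; rewrite !mulnA; congr (_ * _ * _)%N; lia.
Qed.

(** The inequality 3 (abc)^2 <= (ab)^3 + (bc)^3 + (ac)^3 decouples the product: any two of i, j, - i
    - j vary independently, so each of the three sums is the square on the right. *)
Let trilinear (x : 'F_p -> nat) :
  (\sum_i \sum_j (x i * x j * x (- i - j)%R) ^ 2 <= (\sum_j x j ^ 3) ^ 2)%N.
Proof.
have amgm (a b c : nat) : (3 * (a * b * c) ^ 2 <= (a * b) ^ 3 + (b * c) ^ 3 + (a * c) ^ 3)%N.
  have H (u v w : nat) : (3 * (u * v * w) <= u ^ 3 + v ^ 3 + w ^ 3)%N.
    have : 0 <= ((u%:Z + v%:Z + w%:Z) * ((u%:Z - v%:Z) ^+ 2 + (v%:Z - w%:Z) ^+ 2 + (u%:Z - w%:Z) ^+ 2)).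
      by rewrite mulr_ge0 ?addr_ge0 ?sqr_ge0.
    have -> : (u%:Z + v%:Z + w%:Z) * ((u%:Z - v%:Z) ^+ 2 + (v%:Z - w%:Z) ^+ 2 + (u%:Z - w%:Z) ^+ 2)
       = 2 * ((u%:Z ^+ 3 + v%:Z ^+ 3 + w%:Z ^+ 3) - 3 * (u%:Z * v%:Z * w%:Z)) by ring.
    by rewrite !exprS !expr0 !expnS !expn0; lia.
  have := H (a * b)%N (b * c)%N (a * c)%N.
  by rewrite (_ : (a * b * (b * c) * (a * c) = (a * b * c) ^ 2)%N)//; rewrite expnS expn1; ring.
rewrite -(leq_pmul2l (isT : (0 < 3)%N)) big_distrr /=.
apply: leq_trans (_ : \sum_i \sum_j ((x i * x j) ^ 3 + (x j * x (- i - j)%R) ^ 3 +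
     (x i * x (- i - j)%R) ^ 3) <= _)%N.
  apply: leq_sum => i _; rewrite big_distrr /=; apply: leq_sum => j _; exact: amgm.
have S2 : (\sum_i \sum_j (x i * x j) ^ 3 = (\sum_j x j ^ 3) ^ 2)%N.
  rewrite expnS expn1 big_distrl /=; apply: eq_bigr => i _.
  by rewrite big_distrr /=; apply: eq_bigr => j _; rewrite expnMn.
under eq_bigr => i _ do rewrite 2!big_split /=.
rewrite !big_split /= S2.
have -> : (\sum_i \sum_j (x i * x (- i - j)%R) ^ 3 = (\sum_j x j ^ 3) ^ 2)%N.
  rewrite -S2; apply: eq_bigr => i _.
  rewrite [RHS](reindex_inj (inj_comp (addrI (- i)) oppr_inj)) /=.
  by apply: eq_bigr.
have -> : (\sum_i \sum_j (x j * x (- i - j)%R) ^ 3 = (\sum_j x j ^ 3) ^ 2)%N.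
  rewrite exchange_big /= -S2; apply: eq_bigr => j _.
  rewrite [RHS](reindex_inj (inj_comp (addIr (- j)) oppr_inj)) /=.
  by apply: eq_bigr.
by rewrite !mulSn mul0n addn0 addnA.
Qed.

Let cube_sum (x : 'F_p -> R[i]) : (\sum_j x j) ^+ 3 = \sum_i \sum_j \sum_l x i * x j * x l.
Proof.
rewrite exprS expr2 mulr_suml; apply: eq_bigr => i _.
rewrite mulr_suml mulr_sumr; apply: eq_bigr => j _.
by rewrite mulrA mulr_sumr.
Qed.

(** Orthogonality leaves the frequencies with i + j + l = 0. There [trilinear], applied to the
    square roots of the bounds for [theta], reduces the double sum to [level_sum] at the exponent 3
    d, admissible from d = 3. *)
Let rho_cube : (3 <= d)%N ->
  (\sum_t rho t ^ 3 <= B ^ (3 * d) * (4 * 2048 * 2 ^ k * 2 ^ (k.+1 * (3 * d - 9))) ^ 2)%N.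
Proof.
move=> d3.
pose x (j : 'F_p) := (2 ^ (level N j * d))%N.
have p0 := prime_gt0 p_pr.
have E : p%:R ^+ 3 * (\sum_t rho t ^ 3)%:R =
   p%:R * \sum_i \sum_j theta i * theta j * theta (- i - j).
  transitivity (\sum_(t : 'F_p) \sum_i \sum_j \sum_l
     theta i * theta j * theta l * e (t * - (i + j + l))).
    rewrite natr_sum mulr_sumr; apply: eq_bigr => t _.
    rewrite natrX -exprMn rhoE cube_sum; apply: eq_bigr => i _; apply: eq_bigr => j _.
    apply: eq_bigr => l _.
    have -> : t * - (i + j + l) = - (i * t) + - (j * t) + - (l * t) by ring.
    by rewrite !charpD//; ring.
  rewrite exchange_big mulr_sumr; apply: eq_bigr => i _.
  rewrite exchange_big mulr_sumr; apply: eq_bigr => j _.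
  rewrite exchange_big (bigD1 (- i - j)) //= [X in _ + X]big1 ?addr0 => [|l lij].
    have -> : - (i + j + (- i - j)) = 0 by rewrite -opprD subrr oppr0.
    by rewrite -mulr_sumr charp_orthogonality ?eqxx 1?mulrC.
  rewrite -mulr_sumr charp_orthogonality ?oppr_eq0 ?addr_eq0 //.
  have -> : (i + j == - l) = false; last by rewrite mulr0.
  apply: contraNF lij => /eqP ij.
  by apply/eqP; rewrite -[l]opprK -ij opprD.
have lex : (p ^ 3 * \sum_t rho t ^ 3 <= p * (B ^ (3 * d) * (\sum_j x j ^ 3) ^ 2))%N.
  rewrite -(ler_nat R) -normc_nat natrM natrX E Normc.normcM normc_nat natrM.
  rewrite ler_wpM2l//; apply: le_trans (normc_sum _ _ _) _.
  apply: le_trans (_ : (B ^ (3 * d) * \sum_i \sum_j (x i * x j * x (- i - j)%R) ^ 2)%:R <= _); last first.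
    by rewrite ler_nat leq_mul2l trilinear orbT.
  rewrite big_distrr natr_sum /=; apply: ler_sum => i _.
  apply: le_trans (normc_sum _ _ _) _.
  rewrite big_distrr natr_sum /=; apply: ler_sum => j _.
  rewrite !Normc.normcM.
  have -> : (B ^ (3 * d) * (x i * x j * x (- i - j)%R) ^ 2 =
     B ^ d * x i ^ 2 * (B ^ d * x j ^ 2) * (B ^ d * x (- i - j)%R ^ 2))%N.
    by rewrite [(3 * d)%N]mulnC expnM; move: (B ^ d)%N => b; rewrite !expnMn !expnS !expn0; ring.
  by rewrite !natrM !ler_pM ?mulr_ge0 ?normc_ge0 -?natrM ?theta_le.
have S : (\sum_j x j ^ 3 <= 4 * 2048 * p * 2 ^ k * 2 ^ (k.+1 * (3 * d - 9)))%N.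
  have d9 : (9 <= 3 * d)%N by lia.
  apply: leq_trans (level_sum p_pr N_gt0 leAp (erefl N) d9).
  by apply: leq_sum => j _; rewrite /x -expnM leq_exp2l//; lia.
have S2 : ((\sum_j x j ^ 3) ^ 2 <= p ^ 2 * (4 * 2048 * 2 ^ k * 2 ^ (k.+1 * (3 * d - 9))) ^ 2)%N.
  rewrite -expnMn leq_exp2r//; apply: leq_trans S _; apply/eq_leq; ring.
rewrite -(@leq_pmul2l (p ^ 3)%N) ?expn_gt0 ?p0//.
apply: leq_trans lex _; rewrite [(p ^ 3)%N]expnS -mulnA leq_mul2l; apply/orP; right.
by rewrite mulnCA leq_mul2l S2 orbT.
Qed.

Let box_rho (t : int) : (N ^ (2 * d) * box_count N d t <= rho t%:~R)%N.
Proof.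
(* The third variable compensates for the free choice of the first two. It ranges over [1, 4 N - 1],
   which is why A = 4 N. *)
have lo (o : 'I_(2 * N).+1) (c : 'I_N * 'I_N) : (o + N + c.2 - c.1 < A)%N.
  by have := ltn_ord o; have := ltn_ord c.2; have := ltn_ord c.1; rewrite /A; lia.
have c1A (c : 'I_N) : (c < A)%N by apply: ltn_trans (ltn_ord c) _; rewrite /A; lia.
pose f (z : {ffun 'I_d -> 'I_(2 * N).+1} * {ffun 'I_d -> 'I_N * 'I_N}) : {ffun 'I_d -> T} :=
  [ffun i => (Ordinal (c1A (z.2 i).1), Ordinal (c1A (z.2 i).2), Ordinal (lo (z.1 i) (z.2 i)))].
have <- : #|finset.setX [set o : {ffun 'I_d -> 'I_(2 * N).+1} |
     \sum_i ((o i : nat)%:Z - N%:Z) ^+ 2 == t] [set: {ffun 'I_d -> 'I_N * 'I_N}]| =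
     (N ^ (2 * d) * box_count N d t)%N.
  by rewrite finset.cardsX cardsT card_ffun card_prod !card_ord mulnC expnM expnS expn1.
rewrite -(card_in_imset (f := f)).
  apply/subset_leq_card/fintype.subsetP => u /imsetP[[ o c]].
  rewrite !inE andbT /= => /eqP ot ->; rewrite -ot rmorph_sum /=; apply/eqP.
  apply: eq_bigr => i _; rewrite rmorphXn /=; congr (_ ^+ 2).
  rewrite /pt !ffunE /= rmorphB /= natrB; last by rewrite addnAC (leq_trans (ltnW (ltn_ord _)))// leq_addl.
  rewrite natrM 2!natrD -[X in _ = X - _]/((o i : nat)%:R) -[X in _ = _ - X]/(N%:R).
  by ring.
move=> [ o c] [ o' c'] _ _ /ffunP H; congr (_, _); apply/ffunP => i.
  have := H i; rewrite !ffunE => -[h1 h2 h3]; apply: ord_inj.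
  by move: h3; rewrite h1 h2; apply: addn_subn_inj; exact: ltnW.
have := H i; rewrite !ffunE => -[h1 h2 h3].
by rewrite [c i]surjective_pairing [c' i]surjective_pairing; congr (_, _); apply: ord_inj.
Qed.

Lemma box_count_pow_le t : (5 <= d)%N ->
  (N ^ (2 * d) * box_count N d t
     <= B ^ d * (4 * 2048 * 2 ^ k * 2 ^ (k.+1 * (2 * d - 9))))%N.
Proof. by move=> d5; apply: leq_trans (box_rho t) (rho_le _ _); lia. Qed.

Lemma box_count_cube_sum_mod n : (3 <= d)%N -> (n <= p)%N ->
  (\sum_(t < n) (N ^ (2 * d) * box_count N d t%:Z) ^ 3
     <= B ^ (3 * d) * (4 * 2048 * 2 ^ k * 2 ^ (k.+1 * (3 * d - 9))) ^ 2)%N.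
Proof.
move=> d3 np; apply: leq_trans (rho_cube d3).
apply: (@leq_trans (\sum_(t < n) rho (t : nat)%:R ^ 3)).
  by apply: leq_sum => t _; rewrite leq_exp2r//; exact: box_rho.
pose f (t : 'I_n) : 'F_p := (t : nat)%:R.
have f_inj : injective f.
  move=> t t' /(congr1 val); rewrite /f /= !val_Fp_nat// !modn_small ?(leq_trans (ltn_ord _))//.
  exact: ord_inj.
apply: (@leq_trans (\sum_(x in f @: [set: _]) rho x ^ 3)).
  rewrite big_imset /=; last by move=> x y _ _; exact: f_inj.
  by apply/eq_leq/eq_bigl => t; rewrite inE.
by rewrite [leqRHS](bigID (mem (f @: [set: _]))) leq_addr.
Qed.

End Moments.

Lemma exp16 k : (16 ^ k = 2 ^ (4 * k))%N.
Proof. by rewrite -[16%N]/(2 ^ 4)%N -expnM. Qed.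

(** Any prime above (4 * 16^k)^2 and n will do, since it has disappeared from
    [box_count_cube_sum_mod]; what remains is bookkeeping of powers of 2. *)
Lemma box_count_cube_sum (R : realType) (d : nat) : (3 <= d)%N ->
  exists C : nat, forall k n : nat,
  (\sum_(t < n) box_count (16 ^ k) d t%:Z ^ 3 * (16 ^ k) ^ 4
     <= C * (16 ^ k) ^ (3 * d))%N.
Proof.
move=> d3; exists ((5 * 2 ^ 7) ^ (3 * d) * (4 * 2048 * 2 ^ (3 * d - 9)) ^ 2)%N => k n.
have [p pgt p_pr] := prime_above (maxn ((4 * 16 ^ k) ^ 2) n).
have [pA pn] : ((4 * 16 ^ k) ^ 2 <= p)%N /\ (n <= p)%N.
  by move: pgt; rewrite gtn_max => /andP[/ltnW -> /ltnW ->].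
have := box_count_cube_sum_mod R p_pr pA d3 pn.
under eq_bigr do rewrite expnMn.
rewrite -big_distrr -big_distrl /= => H.
rewrite -(@leq_pmul2l (((16 ^ k) ^ (2 * d)) ^ 3)%N) ?expn_gt0//.
rewrite mulnA; apply: leq_trans (leq_mul H (leqnn _)) _; apply/eq_leq.
have e1 : (((16 ^ k) ^ (2 * d)) ^ 3 * (16 ^ k) ^ (3 * d) =
    (2 ^ (10 * k)) ^ (3 * d) * (2 ^ k * 2 ^ (k * (3 * d - 9))) ^ 2 * (16 ^ k) ^ 4)%N.
  rewrite exp16 -!expnM -!expnD -!expnM -!expnD; congr (_ ^ _)%N.
  rewrite -(subnKC d3); move: (d - 3)%N => m.
  have -> : (3 * (3 + m) - 9 = 3 * m)%N by clear; lia.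
  by ring.
have e2 m : (2 ^ (k.+1 * m) = 2 ^ m * 2 ^ (k * m))%N by rewrite mulSn expnD.
have e3 b m : ((5 * (2 ^ 7 * b)) ^ m = (5 * 2 ^ 7) ^ m * b ^ m)%N by rewrite mulnA expnMn.
rewrite [RHS]mulnCA e1 e2 e3.
move: ((5 * 2 ^ 7) ^ (3 * d))%N ((2 ^ (10 * k)) ^ (3 * d))%N (2 ^ k)%N => a b c.
move: (2 ^ (3 * d - 9))%N (2 ^ (k * (3 * d - 9)))%N (4 * 2048)%N ((16 ^ k) ^ 4)%N.
move=> e f g h; rewrite !expnMn. by ring.
Qed.

Lemma box_count_le (R : realType) (d : nat) : (5 <= d)%N ->
  exists C : nat, forall (k : nat) (t : int),
  (box_count (16 ^ k) d t * (16 ^ k) ^ 2 <= C * (16 ^ k) ^ d)%N.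
Proof.
move=> d5; exists ((5 * 2 ^ 7) ^ d * (4 * 2048 * 2 ^ (2 * d - 9)))%N => k t.
have [p pA p_pr] := prime_above ((4 * 16 ^ k) ^ 2).
have H := box_count_pow_le R p_pr (ltnW pA) t d5.
rewrite -(@leq_pmul2l ((16 ^ k) ^ (2 * d))%N) ?expn_gt0//.
rewrite mulnA; apply: leq_trans (leq_mul H (leqnn _)) _; apply/eq_leq.
have e1 : ((16 ^ k) ^ (2 * d) * (16 ^ k) ^ d =
    (2 ^ (10 * k)) ^ d * (2 ^ k * 2 ^ (k * (2 * d - 9))) * (16 ^ k) ^ 2)%N.
  rewrite exp16 -!expnM -!expnD; congr (_ ^ _)%N.
  rewrite -(subnKC d5); move: (d - 5)%N => m.
  have -> : (2 * (5 + m) - 9 = 2 * m + 1)%N by clear; lia.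
  by ring.
have e2 m : (2 ^ (k.+1 * m) = 2 ^ m * 2 ^ (k * m))%N by rewrite mulSn expnD.
have e3 b m : ((5 * (2 ^ 7 * b)) ^ m = (5 * 2 ^ 7) ^ m * b ^ m)%N by rewrite mulnA expnMn.
rewrite [RHS]mulnCA e1 e2 e3.
move: ((5 * 2 ^ 7) ^ d)%N ((2 ^ (10 * k)) ^ d)%N (2 ^ k)%N => a b c.
move: (2 ^ (2 * d - 9))%N (2 ^ (k * (2 * d - 9)))%N (4 * 2048)%N ((16 ^ k) ^ 2)%N.
by move=> e f g h; ring.
Qed.

(** * Lower bound for the number of representations *)

(** Pigeonhole: the (p + 1) / 2 squares and the (p + 1) / 2 values -1 - y^2 cannot be disjoint in
    'F_p. *)
Lemma minus1_sum_squares_prime (p : nat) : prime p -> odd p ->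
  exists a b : int, (p%:Z %| a ^+ 2 + b ^+ 2 + 1)%Z.
Proof.
move=> p_pr p_odd.
have inj_sq (x y : 'I_(p./2).+1) : (x : nat)%:R ^+ 2 = (y : nat)%:R ^+ 2 :> 'F_p -> x = y.
  have lt (u : 'I_(p./2).+1) : (2 * u < p)%N.
    by have := ltn_ord u; have := odd_double_half p; rewrite p_odd; lia.
  wlog xy : x y / (x <= y)%N.
    by move=> H e; case: (leqP x y) => [|/ltnW] xy; [|symmetry]; apply: H.
  move/eqP; rewrite eq_sym -subr_eq0 subr_sqr -natrB// -natrD mulf_eq0.
  rewrite -!(dvdn_pcharf (pchar_Fp p_pr)) => /orP[] /dvdnP[k kE]; apply: ord_inj.
    by case: k kE => [|k]; have := lt x; have := lt y; nia.
  by case: k kE => [|k]; have := lt x; have := lt y; nia.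
pose f (x : 'I_(p./2).+1) : 'F_p := (x : nat)%:R ^+ 2.
pose g (x : 'I_(p./2).+1) : 'F_p := -1 - (x : nat)%:R ^+ 2.
have f_inj : injective f by move=> x y; exact: inj_sq.
have g_inj : injective g by move=> x y /addrI /oppr_inj; exact: inj_sq.
have [x [y xy]] : exists x y, f x = g y.
  apply: contrapT => H.
  have dis : [disjoint f @: [set: _] & g @: [set: _]].
    apply/pred0P => u /=; apply/negP => /andP[/imsetP[x _ ->] /imsetP[y _ xy]].
    by apply: H; exists x, y.
  have := max_card (mem (f @: [set: _] :|: g @: [set: _])).
  rewrite cardsU disjoint_setI0// cards0 subn0 !card_imset// !cardsT !card_ord.
  by rewrite Fp_cast//; have := odd_double_half p; rewrite p_odd; lia.
exists (x : nat)%:Z, (y : nat)%:Z.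
rewrite dvdzE; have -> : `|((x : nat)%:Z ^+ 2 + (y : nat)%:Z ^+ 2 + 1)%R|%N = (x ^ 2 + y ^ 2 + 1)%N.
  by rewrite !exprS !expr0 !expnS !expn0; lia.
rewrite (dvdn_pcharf (pchar_Fp p_pr)) !natrD !natrX -/(f x) xy /g.
by apply/eqP; ring.
Qed.

(** Hensel's step: p cannot divide both a and b, so say 2 a is invertible modulo p and a is
    corrected by a multiple of m. The quadratic error m^2 is divisible by p m because p divides
    m. *)
Lemma minus1_sum_squares_lift (p m : nat) (a b : int) : prime p -> odd p -> (p %| m)%N ->
  (m%:Z %| a ^+ 2 + b ^+ 2 + 1)%Z ->
  exists a' b' : int, ((p * m)%N%:Z %| a' ^+ 2 + b' ^+ 2 + 1)%Z.
Proof.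
move=> p_pr p_odd pm mab.
wlog pa : a b mab / ~~ (p%:Z %| a)%Z.
  case: (boolP (p%:Z %| a)%Z) => [pa|pa] H; last exact: (H a b).
  apply: (H b a); first by rewrite (addrC (b ^+ 2)).
  apply/negP => pb.
  have : (p%:Z %| a ^+ 2 + b ^+ 2 + 1)%Z by apply: dvdz_trans mab; rewrite dvdzE.
  rewrite rpredDl ?rpredD ?expr2 ?dvdz_mull// dvdz1 absz_nat => /eqP p1.
  by move: p_pr; rewrite p1.
move: mab => /dvdzP[k kE].
have : coprimez p%:Z (2 * a).
  rewrite coprimezE absz_nat abszM prime_coprime// Euclid_dvdM// negb_or.
  rewrite -[X in _ && X]/(~~ (p %| absz a)%N) [X in _ && X]pa andbT.
  apply/negP => p2; have := dvdn_leq (isT : (0 < 2)%N) p2.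
  by case: p p_pr p_odd p2 {pm kE pa} => [|[|[|p]]].
move=> /coprimezP[[u v] /= uv].
have /dvdnP[l lE] := pm.
exists (a - m%:Z * (k * v)), b.
have -> : (a - m%:Z * (k * v)) ^+ 2 + b ^+ 2 + 1 =
   (a ^+ 2 + b ^+ 2 + 1) - m%:Z * k * (v * (2 * a)) + (m%:Z * (k * v)) ^+ 2 by ring.
have -> : v * (2 * a) = 1 - u * p%:Z by apply/eqP; rewrite eq_sym subr_eq addrC uv.
apply/dvdzP; exists (k * u + l%:Z * (k * v) ^+ 2).
by rewrite kE lE !PoszM; ring.
Qed.

(** Induction through the least prime factor p: Hensel's step if p divides m / p, the Chinese
    remainder theorem otherwise. *)
Lemma minus1_sum_squares (m : nat) : odd m ->
  exists a b : int, (m%:Z %| a ^+ 2 + b ^+ 2 + 1)%Z.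
Proof.
have [n] := ubnP m; elim: n m => // n IH m mn m_odd.
have [m1|m1] := leqP m 1.
  by exists 0, 0; rewrite (_ : m = 1%N) ?dvd1z//; case: m m1 m_odd {mn} => [|[]].
have p_pr := pdiv_prime m1; have /dvdnP[q mE] := pdiv_dvd m.
set p := pdiv m in p_pr mE.
have [q_odd p_odd] : odd q /\ odd p by move: m_odd; rewrite mE oddM => /andP.
have p1 := prime_gt1 p_pr.
have qm : (q < n)%N.
  by apply: (@leq_trans m) => //; rewrite mE ltn_Pmulr//; case: q q_odd {mE}.
have [a [b ab]] := IH q qm q_odd.
have [pq|pq] := boolP (p %| q)%N.
  by rewrite mE mulnC; exact: minus1_sum_squares_lift pq ab.
have [a' [b' ab']] := minus1_sum_squares_prime p_pr p_odd.
have : coprimez q%:Z p%:Z by rewrite coprimezE /= coprime_sym prime_coprime.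
move=> /[dup] cop /coprimezP[[u v] /= uv].
exists (a * (v * p%:Z) + a' * (u * q%:Z)), (b * (v * p%:Z) + b' * (u * q%:Z)).
rewrite mE PoszM Gauss_dvdz//; apply/andP; split.
  have -> : v * p%:Z = 1 - u * q%:Z by apply/eqP; rewrite eq_sym subr_eq addrC uv.
  rewrite (_ : _ + 1 = (a ^+ 2 + b ^+ 2 + 1) + q%:Z * (u * ((a' - a) * (2 * a + u * q%:Z * (a' - a)) + (b' - b) * (2 * b + u * q%:Z * (b' - b))))).
    by rewrite rpredD ?dvdz_mulr.
  by ring.
have -> : u * q%:Z = 1 - v * p%:Z by apply/eqP; rewrite eq_sym subr_eq uv.
rewrite (_ : _ + 1 = (a' ^+ 2 + b' ^+ 2 + 1) + p%:Z * (v * ((a - a') * (2 * a' + v * p%:Z * (a - a')) + (b - b') * (2 * b' + v * p%:Z * (b - b'))))).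
  by rewrite rpredD ?dvdz_mulr.
by ring.
Qed.

Ltac dvdz_closure :=
  repeat first [assumption | apply: rpredB | apply: rpredD | apply: dvdz_mull].

Lemma nat_sqrt_exists (n : nat) : exists h, (h ^ 2 <= n < h.+1 ^ 2)%N.
Proof.
elim: n => [|n [h /andP[h1 h2]]]; first by exists 0%N.
have [lt|ge] := ltnP n.+1 (h.+1 ^ 2); [exists h|exists h.+1]; apply/andP; split => //.
  exact: leqW.
by move: h2 ge; rewrite !expnS !expn0; lia.
Qed.

(** * Four-dimensional lattices of vectors with norm divisible by m *)

Definition qnorm (v : int * int * int * int) : int :=
  v.1.1.1 ^+ 2 + v.1.1.2 ^+ 2 + v.1.2 ^+ 2 + v.2 ^+ 2.

(* Its vectors [(x, y, z, w)] satisfy [z + i w = (a + i b) (x - i y)] modulo m, so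
   their norm is divisible by m once [m %| a ^+ 2 + b ^+ 2 + 1]. *)
Definition qlattice (m : nat) (a b : int) (v : int * int * int * int) : bool :=
  (m%:Z %| v.1.2 - (a * v.1.1.1 + b * v.1.1.2))%Z &&
  (m%:Z %| v.2 - (b * v.1.1.1 - a * v.1.1.2))%Z.

Lemma qnorm_mod (m : nat) (a b : int) v :
  (m%:Z %| a ^+ 2 + b ^+ 2 + 1)%Z -> qlattice m a b v -> (m%:Z %| qnorm v)%Z.
Proof.
case: v => [[[x y] z] w] ab /andP[/= hz hw]; rewrite /qnorm /=.
rewrite (_ : _ + _ = (x ^+ 2 + y ^+ 2) * (a ^+ 2 + b ^+ 2 + 1)
  + (z - (a * x + b * y)) * (z + (a * x + b * y))
  + (w - (b * x - a * y)) * (w + (b * x - a * y))); last by ring.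
by rewrite !rpredD//; [exact: dvdz_mull|exact: dvdz_mulr|exact: dvdz_mulr].
Qed.

(** Pigeonhole: with h the integer square root of m, the (h + 1)^4 > m^2 points of a cube are sorted
    into m^2 classes. Two in one class differ by entries at most h, so by a norm at most 4 h^2 <= 4
    m. *)
Lemma qlattice_short (m : nat) (a b : int) : (0 < m)%N ->
  exists v, [/\ qlattice m a b v, 0 < qnorm v & qnorm v <= 4 * m%:Z].
Proof.
move=> m0; have [h /andP[h1 h2]] := nat_sqrt_exists m.
pose T := ('I_h.+1 * 'I_h.+1 * 'I_h.+1 * 'I_h.+1)%type.
have mZ : m%:Z != 0 by rewrite -lt0n in m0 *; lia.
have res_lt (e : int) : (absz (e %% m%:Z)%Z < m)%N.
  by have := modz_ge0 e mZ; have := @ltz_pmod e m%:Z; lia.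
pose res (e : int) : 'I_m := Ordinal (res_lt e).
have resP e e' : res e = res e' -> (m%:Z %| e - e')%Z.
  move=> /(congr1 (@nat_of_ord _)) /= ee.
  rewrite -eqz_mod_dvd; apply/eqP.
  by have := modz_ge0 e mZ; have := modz_ge0 e' mZ; lia.
pose F (u : T) : 'I_m * 'I_m :=
  (res ((u.1.2 : nat)%:Z - (a * (u.1.1.1 : nat)%:Z + b * (u.1.1.2 : nat)%:Z)),
   res ((u.2 : nat)%:Z - (b * (u.1.1.1 : nat)%:Z - a * (u.1.1.2 : nat)%:Z))).
have : ~~ injectiveb F.
  apply/injectiveP => /leq_card; rewrite !card_prod !card_ord.
  apply/negP; rewrite -ltnNge; move: h2; rewrite expnS expn1; move: (h.+1) => H.
  by clear; nia.
move=> /injectivePn[[[[x y] z] w] [[[[x' y'] z'] w'] ne FE]].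
have /= e1 := resP _ _ (congr1 fst FE); have /= e2 := resP _ _ (congr1 snd FE).
pose D (i j : 'I_h.+1) := (i : nat)%:Z - (j : nat)%:Z.
exists (D x x', D y y', D z z', D w w').
have D0 i j : D i j = 0 -> i = j by move=> e; apply: ord_inj; rewrite /D in e; lia.
have Dle i j : D i j ^+ 2 <= m%:Z.
  have : (absz (D i j) <= h)%N by have := ltn_ord i; have := ltn_ord j; rewrite /D; lia.
  by rewrite -[D i j ^+ 2]gez0_abs ?sqr_ge0// abszX lez_nat => le; apply: leq_trans h1; rewrite leq_exp2r.
split.
- apply/andP; split => /=.
    rewrite (_ : _ - _ = (z%:Z - (a * x%:Z + b * y%:Z)) - (z'%:Z - (a * x'%:Z + b * y'%:Z)))//.
    by rewrite /D; ring.
  rewrite (_ : _ - _ = (w%:Z - (b * x%:Z - a * y%:Z)) - (w'%:Z - (b * x'%:Z - a * y'%:Z)))//.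
  by rewrite /D; ring.
- have q0 : 0 <= qnorm (D x x', D y y', D z z', D w w') by rewrite /qnorm !addr_ge0 ?sqr_ge0.
  rewrite lt_def q0 andbT; apply: contraNneq ne; rewrite /qnorm /=.
  move=> /eqP; rewrite !paddr_eq0 ?addr_ge0 ?sqr_ge0// !sqrf_eq0.
  by move=> /andP[/andP[/andP[/eqP/D0-> /eqP/D0->] /eqP/D0->] /eqP/D0->].
- rewrite /qnorm /=; have := Dle x x'; have := Dle y y'; have := Dle z z'; have := Dle w w'.
  lia.
Qed.

Lemma dvdz_odd_double (m : nat) (x : int) : odd m ->
  (m%:Z %| 2 * x)%Z = (m%:Z %| x)%Z.
Proof. by move=> m_odd; rewrite Gauss_dvdzr// coprimezE /= coprimen2. Qed.

(* The gcd g of v and m divides k: dividing v by g leaves a vector of the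
   lattice modulo m / g, so m / g divides its norm k m / g^2. *)
Lemma qlattice_primitive (m k : nat) (a b x y z w : int) :
  coprime m 6 -> (0 < k <= 4)%N -> (m%:Z %| a ^+ 2 + b ^+ 2 + 1)%Z ->
  qlattice m a b (x, y, z, w) -> qnorm (x, y, z, w) = (k * m)%N%:Z ->
  forall S : int, (m%:Z %| S * x)%Z -> (m%:Z %| S * y)%Z -> (m%:Z %| S * z)%Z ->
  (m%:Z %| S * w)%Z -> (m%:Z %| S)%Z.
Proof.
move=> m6 /andP[k0 k4] ab vL vk S Sx Sy Sz Sw.
have m0 : (0 < m)%N by case: m m6 {ab vL vk Sx Sy Sz Sw}.
pose g := gcdn (gcdn (absz x) (absz y)) (gcdn (gcdn (absz z) (absz w)) m).
have [gx gy gz gw gm] : [/\ (g %| absz x)%N, (g %| absz y)%N, (g %| absz z)%N, (g %| absz w)%N & (g %| m)%N].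
  have : (g %| g)%N by [].
  by rewrite {2}/g !dvdn_gcd => /andP[/andP[-> ->] /andP[/andP[-> ->] ->]].
have g1 : g = 1%N; last first.
  have : (m %| absz S * g)%N.
    rewrite /g !muln_gcdr !dvdn_gcd -!abszM dvdn_mull// andbT.
    by apply/andP; split; apply/andP; split; [exact: Sx|exact: Sy|exact: Sz|exact: Sw].
  by rewrite g1 muln1.
have g0 : (0 < g)%N by apply: dvdn_gt0 gm.
have gZ : g%:Z != 0 by lia.
have lift u : (g %| absz u)%N -> exists u', u = g%:Z * u'.
  by move=> gu; have /dvdzP[u' ->] : (g%:Z %| u)%Z by []; exists u'; rewrite mulrC.
have [x' xE] := lift _ gx; have [y' yE] := lift _ gy.
have [z' zE] := lift _ gz; have [w' wE] := lift _ gw.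
have /dvdnP[m' mE] := gm.
have m'0 : (0 < m')%N by move: m0; rewrite mE muln_gt0 => /andP[].
have vL' : qlattice m' a b (x', y', z', w').
  move: vL; rewrite /qlattice /= mE xE yE zE wE mulnC PoszM.
  rewrite (_ : g%:Z * z' - _ = g%:Z * (z' - (a * x' + b * y'))); last by ring.
  rewrite (_ : g%:Z * w' - _ = g%:Z * (w' - (b * x' - a * y'))); last by ring.
  by rewrite !dvdz_mul2l ?gZ.
have ab' : (m'%:Z %| a ^+ 2 + b ^+ 2 + 1)%Z by apply: dvdz_trans ab; rewrite mE PoszM dvdz_mulr.
have /dvdzP[j jE] := qnorm_mod ab' vL'.
have : g%:Z * j = k%:Z.
  apply: (@mulIf _ (g%:Z * m'%:Z)); first by rewrite mulf_neq0 ?gZ// -lt0n.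
  have -> : g%:Z * j * (g%:Z * m'%:Z) = g%:Z ^+ 2 * (j * m'%:Z) by ring.
  rewrite -jE; move: vk; rewrite /qnorm /= xE yE zE wE mE PoszM PoszM => vk.
  by rewrite [in RHS](mulrC g%:Z) -vk; ring.
move=> /(congr1 absz); rewrite abszM /= => gj.
have gk : (g <= 4)%N by apply: leq_trans k4; apply: dvdn_leq => //; rewrite -gj dvdn_mulr.
have g6 : coprime g 6 by apply: coprime_dvdl m6.
by case: (g) gk g0 g6 => [|[|[|[|[|]]]]].
Qed.

(** This makes the vectors found in different lattices different. Put A + iB = (a + ib) - (a' + ib')
    and S - iT = (A + iB)(a - ib): S and T annihilate v modulo m, hence vanish by
    [qlattice_primitive]. Multiplication by a + ib, where a^2 + b^2 = -1, recovers A and B. *)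
Lemma qlattice_unique (m k : nat) (a b a' b' : int) v :
  coprime m 6 -> (0 < k <= 4)%N ->
  (m%:Z %| a ^+ 2 + b ^+ 2 + 1)%Z -> (m%:Z %| a' ^+ 2 + b' ^+ 2 + 1)%Z ->
  qlattice m a b v -> qlattice m a' b' v -> qnorm v = (k * m)%N%:Z ->
  (m%:Z %| a - a')%Z /\ (m%:Z %| b - b')%Z.
Proof.
case: v => [[[x y] z] w] m6 hk ab ab' vL vL' vk.
have key := qlattice_primitive m6 hk ab vL vk.
have m_odd : odd m.
  by move: m6; rewrite (_ : 6 = 2 * 3)%N// coprimeMr => /andP[]; rewrite coprimen2.
move: vL vL' => /andP[/= h1 h2] /andP[/= h1' h2'].
set A := a - a'; set B := b - b'.
have P1 : (m%:Z %| A * x + B * y)%Z.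
  rewrite (_ : _ + _ = (z - (a' * x + b' * y)) - (z - (a * x + b * y))); last by rewrite /A /B; ring.
  exact: rpredB.
have P2 : (m%:Z %| B * x - A * y)%Z.
  rewrite (_ : _ - _ = (w - (b' * x - a' * y)) - (w - (b * x - a * y))); last by rewrite /A /B; ring.
  exact: rpredB.
have opp (c e : int) : (m%:Z %| c ^+ 2 + e ^+ 2 + 1)%Z ->
   (m%:Z %| z - (c * x + e * y))%Z -> (m%:Z %| w - (e * x - c * y))%Z ->
   (m%:Z %| x + (c * z + e * w))%Z /\ (m%:Z %| y + (e * z - c * w))%Z.
  move=> ce k1 k2; split.
    rewrite (_ : x + (c * z + e * w) = x * (c ^+ 2 + e ^+ 2 + 1) + c * (z - (c * x + e * y)) + e * (w - (e * x - c * y))); last by ring.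
    by rewrite !rpredD ?dvdz_mull.
  rewrite (_ : y + (e * z - c * w) = y * (c ^+ 2 + e ^+ 2 + 1) + e * (z - (c * x + e * y)) - c * (w - (e * x - c * y))); last by ring.
  by rewrite rpredB ?rpredD ?dvdz_mull.
have [x1 y1] := opp _ _ ab h1 h2; have [x1' y1'] := opp _ _ ab' h1' h2'.
have P3 : (m%:Z %| A * z + B * w)%Z.
  rewrite (_ : _ + _ = (x + (a * z + b * w)) - (x + (a' * z + b' * w))); last by rewrite /A /B; ring.
  exact: rpredB.
have P4 : (m%:Z %| B * z - A * w)%Z.
  rewrite (_ : _ - _ = (y + (b * z - a * w)) - (y + (b' * z - a' * w))); last by rewrite /A /B; ring.
  exact: rpredB.
pose S := A * a + B * b; pose T := A * b - B * a.
have [e eE] : exists e, e = a ^+ 2 + b ^+ 2 + 1 by eexists.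
have [h hE] : exists h, h = z - (a * x + b * y) by eexists.
have [l lE] : exists l, l = w - (b * x - a * y) by eexists.
have [me mh ml] : [/\ (m%:Z %| e)%Z, (m%:Z %| h)%Z & (m%:Z %| l)%Z] by rewrite eE hE lE.
have Q1 : (m%:Z %| S * x + T * y)%Z.
  rewrite (_ : _ + _ = (A * z + B * w) - A * h - B * l); last by rewrite hE lE /S /T; ring.
  by dvdz_closure.
have Q2 : (m%:Z %| S * y - T * x)%Z.
  rewrite (_ : _ - _ = (B * z - A * w) - B * h + A * l); last by rewrite hE lE /S /T; ring.
  by dvdz_closure.
have Sz : (m%:Z %| S * z)%Z.
  rewrite -dvdz_odd_double//.
  rewrite (_ : 2 * _ = a * (S * x + T * y) + b * (S * y - T * x) + 2 * S * h
     + e * (A * x + B * y) - (A * x + B * y)); last by rewrite eE hE /S /T; ring.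
  by dvdz_closure.
have Sw : (m%:Z %| S * w)%Z.
  rewrite -dvdz_odd_double//.
  rewrite (_ : 2 * _ = b * (S * x + T * y) - a * (S * y - T * x) + 2 * S * l
     + e * (B * x - A * y) - (B * x - A * y)); last by rewrite eE lE /S /T; ring.
  by dvdz_closure.
have Tz : (m%:Z %| T * z)%Z.
  rewrite (_ : T * z = b * (S * x + T * y) - a * (S * y - T * x) + T * h + S * l - S * w).
    by dvdz_closure.
  by rewrite hE lE /S /T; ring.
have Tw : (m%:Z %| T * w)%Z.
  rewrite (_ : T * w = S * z - (a * (S * x + T * y) + b * (S * y - T * x) + S * h) + T * l).
    by dvdz_closure.
  by rewrite hE lE /S /T; ring.
have xy (U : int) : (m%:Z %| U * z)%Z -> (m%:Z %| U * w)%Z ->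
    (m%:Z %| U * x)%Z /\ (m%:Z %| U * y)%Z.
  move=> Uz Uw; split.
    rewrite (_ : U * x = U * (x + (a * z + b * w)) - a * (U * z) - b * (U * w)); last by ring.
    by dvdz_closure.
  rewrite (_ : U * y = U * (y + (b * z - a * w)) - b * (U * z) + a * (U * w)); last by ring.
  by dvdz_closure.
have [Sx Sy] := xy S Sz Sw; have [Tx Ty] := xy T Tz Tw.
have mS := key S Sx Sy Sz Sw; have mT := key T Tx Ty Tz Tw.
split.
  rewrite (_ : A = A * e - (a * S + b * T)); last by rewrite eE /S /T; ring.
  by dvdz_closure.
rewrite (_ : B = B * e - (b * S - a * T)); last by rewrite eE /S /T; ring.
by dvdz_closure.
Qed.

(** * Rotations of a solution of a^2 + b^2 = -1 modulo m *)

Section Rotations.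
Variables (m : nat) (a0 b0 : int).
Hypotheses (m_odd : odd m) (mab : (m%:Z %| a0 ^+ 2 + b0 ^+ 2 + 1)%Z).

(* [(rot_cos, rot_sin)] is the rational point of parameter t on the unit circle,
   [i] being an inverse of [1 + t ^+ 2] modulo m. *)
Definition rot_cos (t i : int) : int := (1 - t ^+ 2) * i.
Definition rot_sin (t i : int) : int := 2 * t * i.

Lemma rotate_mod t i : (m%:Z %| i * (1 + t ^+ 2) - 1)%Z ->
  (m%:Z %| (rot_cos t i * a0 - rot_sin t i * b0) ^+ 2
         + (rot_sin t i * a0 + rot_cos t i * b0) ^+ 2 + 1)%Z.
Proof.
move=> mi.
rewrite (_ : _ + 1 = (i * (1 + t ^+ 2)) ^+ 2 * (a0 ^+ 2 + b0 ^+ 2 + 1)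
   - (i * (1 + t ^+ 2) + 1) * (i * (1 + t ^+ 2) - 1)); last first.
  by rewrite /rot_cos /rot_sin; ring.
by dvdz_closure.
Qed.

(** Since a0^2 + b0^2 = -1 is invertible, the rotated pair determines c and s; then 2 i = c + i (1 +
    t^2) determines i, s = 2 t i determines t i, and t = (1 + t^2) t i. *)
Lemma rotate_inj t i t' i' :
  (m%:Z %| i * (1 + t ^+ 2) - 1)%Z -> (m%:Z %| i' * (1 + t' ^+ 2) - 1)%Z ->
  (m%:Z %| (rot_cos t i * a0 - rot_sin t i * b0)
         - (rot_cos t' i' * a0 - rot_sin t' i' * b0))%Z ->
  (m%:Z %| (rot_sin t i * a0 + rot_cos t i * b0)
         - (rot_sin t' i' * a0 + rot_cos t' i' * b0))%Z ->
  (m%:Z %| t - t')%Z.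
Proof.
set c := rot_cos t i; set s := rot_sin t i; set c' := rot_cos t' i'; set s' := rot_sin t' i'.
move=> mi mi' ma mb.
have mc : (m%:Z %| c - c')%Z.
  rewrite (_ : c - c' = (c - c') * (a0 ^+ 2 + b0 ^+ 2 + 1)
    - a0 * ((c * a0 - s * b0) - (c' * a0 - s' * b0))
    - b0 * ((s * a0 + c * b0) - (s' * a0 + c' * b0))); last by ring.
  by dvdz_closure.
have ms : (m%:Z %| s - s')%Z.
  rewrite (_ : s - s' = (s - s') * (a0 ^+ 2 + b0 ^+ 2 + 1)
    - a0 * ((s * a0 + c * b0) - (s' * a0 + c' * b0))
    + b0 * ((c * a0 - s * b0) - (c' * a0 - s' * b0))); last by ring.
  by dvdz_closure.
have mii : (m%:Z %| i - i')%Z.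
  rewrite -dvdz_odd_double// (_ : 2 * _ = (c - c') + (i * (1 + t ^+ 2) - 1) - (i' * (1 + t' ^+ 2) - 1)).
    by dvdz_closure.
  by rewrite /c /c' /rot_cos; ring.
have mti : (m%:Z %| t * i - t' * i')%Z.
  by rewrite -dvdz_odd_double// mulrBr !mulrA.
rewrite (_ : t - t' = (1 + t ^+ 2) * (t * i - t' * i') - ((1 + t ^+ 2) * t') * (i - i')
   - (t - t') * (i * (1 + t ^+ 2) - 1)); last by ring.
by dvdz_closure.
Qed.

End Rotations.

Definition rotation_params (m : nat) : seq nat := [seq t <- iota 0 m | coprime (t ^ 2 + 1) m].

Lemma rep4_family (m : nat) : coprime m 6 ->
  exists s : seq (int * int * int * int), [/\ uniq s,
    size s = size (rotation_params m) &
    forall v, v \in s -> exists2 k : nat, (0 < k <= 4)%N & qnorm v = (k * m)%N%:Z].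
Proof.
move=> m6.
have m0 : (0 < m)%N by case: m m6.
have m_odd : odd m.
  by move: m6; rewrite (_ : 6 = 2 * 3)%N// coprimeMr => /andP[]; rewrite coprimen2.
have [a0 [b0 ab]] := minus1_sum_squares m_odd.
pose P (t : nat) (v : int * int * int * int) := coprime (t ^ 2 + 1) m -> exists i k,
  [/\ (m%:Z %| i * (1 + t%:Z ^+ 2) - 1)%Z, (0 < k <= 4)%N, qnorm v = (k * m)%N%:Z &
   qlattice m (rot_cos t%:Z i * a0 - rot_sin t%:Z i * b0) (rot_sin t%:Z i * a0 + rot_cos t%:Z i * b0) v].
have [f fP] : exists f, forall t, P t (f t).
  suff H t : exists v, P t v by have [f fP] := boolp.choice H; exists f.
  rewrite /P; case: (boolP (coprime _ _)) => [cop|_]; last by exists 0.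
  have : coprimez (1 + t%:Z ^+ 2) m%:Z.
    rewrite coprimezE absz_nat (_ : `|(1 + t%:Z ^+ 2)%R|%N = (t ^ 2 + 1)%N)//.
    by rewrite exprS expr1 !expnS expn0; lia.
  move=> /coprimezP[[i j] /= ij].
  have mi : (m%:Z %| i * (1 + t%:Z ^+ 2) - 1)%Z.
    have -> : i * (1 + t%:Z ^+ 2) = 1 - j * m%:Z by apply/eqP; rewrite eq_sym subr_eq ij.
    by rewrite addrAC subrr add0r -mulNr dvdz_mull.
  have [v [vL v0 v4]] := qlattice_short (rot_cos t%:Z i * a0 - rot_sin t%:Z i * b0) (rot_sin t%:Z i * a0 + rot_cos t%:Z i * b0) m0.
  exists v => _.
  have /dvdzP[k kE] := qnorm_mod (rotate_mod ab mi) vL.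
  have k0 : 0 < k by move: v0; rewrite kE pmulr_lgt0// ltz_nat.
  have k4 : k <= 4 by move: v4; rewrite kE ler_pM2r// ltz_nat.
  exists i, (absz k); split=> //; first by lia.
  by rewrite PoszM gez0_abs// ltW.
exists [seq f t | t <- rotation_params m]; split.
- rewrite map_inj_in_uniq ?filter_uniq ?iota_uniq// => t t'.
  rewrite !mem_filter !mem_iota !add0n /= => /andP[ct tm] /andP[ct' tm'] ff.
  have [i [k [mi k4 vk vL]]] := fP t ct; have [i' [k' [mi' _ _ vL']]] := fP t' ct'.
  rewrite -ff in vL'.
  have [ma mb] := qlattice_unique m6 k4 (rotate_mod ab mi) (rotate_mod ab mi') vL vL' vk.
  have := rotate_inj m_odd ab mi mi' ma mb.
  rewrite dvdzE absz_nat => md; clear -md tm tm'.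
  by case: (posnP (absz (t%:Z - t'%:Z))) => [|/dvdn_leq /(_ md)]; lia.
- by rewrite size_map.
- move=> v /mapP[t]; rewrite mem_filter => /andP[ct _] ->.
  by have [i [k [_ k4 vk _]]] := fP t ct; exists k.
Qed.

(** Serves each descent: among partial injections whose domains cover s, the one with the largest
    domain loses at most a factor |I|. *)
Lemma pigeonhole_map (T U : eqType) (I : finType) (D : I -> pred T) (f : I -> T -> U)
    (s : seq T) : uniq s -> (0 < #|I|)%N ->
  (forall v, v \in s -> exists i, D i v) ->
  (forall i v w, D i v -> D i w -> f i v = f i w -> v = w) ->
  exists i, uniq [seq f i v | v <- s & D i v] /\
    (size s <= #|I| * size [seq f i v | v <- s & D i v])%N.
Proof.
move=> Us I0 cov inj.
have /card_gt0P[i0 _] := I0.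
pose i := [arg max_(i > i0) count (D i) s].
have imax j : (count (D j) s <= count (D i) s)%N.
  by rewrite /i; case: arg_maxnP => // i1 _; apply.
exists i; split.
  rewrite map_inj_in_uniq ?filter_uniq// => v w.
  by rewrite !mem_filter => /andP[Dv _] /andP[Dw _]; exact: inj.
rewrite size_map size_filter.
apply: (@leq_trans (\sum_(j : I) count (D j) s)).
  elim: s Us cov {imax i} => [|v s IH] /= => [_ _|/andP[_ Us] cov]; first by [].
  rewrite big_split /= -add1n leq_add//.
    by have [j Dj] := cov v (mem_head _ _); rewrite (bigD1 j)//= Dj.
  by apply: IH => // w ws; apply: cov; rewrite in_cons ws orbT.
by apply: leq_trans (leq_sum _ (fun j _ => imax j)) _; rewrite sum_nat_const.
Qed.

(** * Removal of the factors 2, 3 and 4 from a norm *)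

Section Descent.
Local Notation quad := (int * int * int * int)%type.

(* If v has norm 2M (resp. 3M), some rearrangement of its entries falls in the
   domain of [half] (resp. [third]), which maps it to a vector of norm M. *)
Let pairing (i : 'I_3) (v : quad) : quad :=
  let: (x, y, z, w) := v in
  match val i with 0%N => (x, y, z, w) | 1%N => (x, z, y, w) | _ => (x, w, y, z) end.

Let half_dom (v : quad) : bool :=
  ((2 %| v.1.1.1 - v.1.1.2) && (2 %| v.1.2 - v.2))%Z.

Let half (v : quad) : quad :=
  (((v.1.1.1 + v.1.1.2) %/ 2)%Z, ((v.1.1.1 - v.1.1.2) %/ 2)%Z,
   ((v.1.2 + v.2) %/ 2)%Z, ((v.1.2 - v.2) %/ 2)%Z).

Lemma qnorm_halve (M : int) (s : seq quad) : uniq s ->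
  (forall v, v \in s -> qnorm v = 2 * M) ->
  exists s', [/\ uniq s', (size s <= 3 * size s')%N & forall v, v \in s' -> qnorm v = M].
Proof.
move=> Us sM.
have cov v : v \in s -> exists i, half_dom (pairing i v).
  move=> /sM; case: v => [[[x y] z] w]; rewrite /qnorm /= => e.
  (* A square has the parity of its root, so an even number of entries is odd, and one of the three
     pairings matches entries of equal parity. *)
  have : (2 %| x + y + z + w)%Z.
    have e' : x ^+ 2 + y ^+ 2 + z ^+ 2 + w ^+ 2 = x + y + z + w + (x * (x - 1) + y * (y - 1) + z * (z - 1) + w * (w - 1)) by ring.
    have par (u : int) : (2 %| u * (u - 1))%Z.
      have [k [|]] : exists k, u = 2 * k \/ u = 2 * k + 1 by exists (u %/ 2)%Z; lia.
        by move=> ->; rewrite -mulrA dvdz_mulr.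
      by move=> ->; rewrite addrK mulrCA dvdz_mulr.
    rewrite (_ : x + y + z + w = 2 * M - (x * (x - 1) + y * (y - 1) + z * (z - 1) + w * (w - 1))).
      by apply: rpredB; [exact: dvdz_mulr|rewrite !rpredD ?par].
    by rewrite -e e'; ring.
  move=> e2.
  have : [|| (2 %| x - y)%Z, (2 %| x - z)%Z | (2 %| x - w)%Z] by lia.
  case/or3P => e3; [exists 0|exists 1|exists (inord 2)];
    rewrite /half_dom /pairing /= ?inordK//=; lia.
have inj i v w : half_dom (pairing i v) -> half_dom (pairing i w) ->
    half (pairing i v) = half (pairing i w) -> v = w.
  have pinj : pairing i v = pairing i w -> v = w.
    case: v => [[[x y] z] w0]; case: w => [[[x' y'] z'] w'].
    by rewrite /pairing; case: i => -[|[|i]] ? /= [-> -> -> ->].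
  move=> dv dw hvw; apply: pinj; move: dv dw hvw.
  move: (pairing i v) (pairing i w) => [[[x y] z] w0] [[[x' y'] z'] w'].
  rewrite /half_dom /half /= => /andP[a1 a2] /andP[a3 a4] [b1 b2 b3 b4].
  have -> : x = x' by lia. have -> : y = y' by lia.
  have -> : z = z' by lia. by have -> : w0 = w' by lia.
have [|i [Ui le]] := @pigeonhole_map _ _ _ (fun i v => half_dom (pairing i v)) (fun i v => half (pairing i v)) s Us _ cov inj.
  by rewrite card_ord.
rewrite card_ord in le.
exists [seq half (pairing i v) | v <- s & half_dom (pairing i v)]; split => // v /mapP[u].
rewrite mem_filter => /andP[du /sM us] ->.
have {us} : qnorm (pairing i u) = 2 * M.
  rewrite -us; case: u {du us} => [[[x y] z] w].
  by rewrite /pairing /qnorm; case: i {Ui le} => -[|[|i]] ? /=; ring.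
move: du; move: (pairing i u) => [[[x y] z] w].
rewrite /half_dom /half /qnorm /= => /andP[].
move=> /dvdzP[k kE] /dvdzP[l lE].
have -> : x = y + k * 2 by lia. have -> : z = w + l * 2 by lia.
have -> : ((y + k * 2 + y) %/ 2)%Z = y + k by lia.
have -> : ((y + k * 2 - y) %/ 2)%Z = k by lia.
have -> : ((w + l * 2 + w) %/ 2)%Z = w + l by lia.
have -> : ((w + l * 2 - w) %/ 2)%Z = l by lia.
move=> e; apply: (@mulfI _ 2) => //; rewrite -e; ring.
Qed.

Let turn (i : 'I_4 * (bool * bool)) (v : quad) : quad :=
  let: (x, y, z, w) := v in
  let: (a, b, c, d) :=
    match val i.1 with
    | 0%N => (x, y, z, w) | 1%N => (x, y, w, z) | 2 => (x, z, w, y) | _ => (y, z, w, x)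
    end in
  (a, if i.2.1 then b else - b, if i.2.2 then c else - c, d).

Let third_dom (v : quad) : bool :=
  [&& (3 %| v.1.1.1 - v.1.1.2)%Z, (3 %| v.1.1.2 - v.1.2)%Z & (3 %| v.2)%Z].

Let third (v : quad) : quad :=
  (((v.1.1.1 + v.1.1.2 + v.1.2) %/ 3)%Z, ((v.2 + v.1.1.1 - v.1.1.2) %/ 3)%Z,
   ((v.2 + v.1.1.2 - v.1.2) %/ 3)%Z, ((v.2 + v.1.2 - v.1.1.1) %/ 3)%Z).

Let res3 (x : int) : exists r : int, (r = 0 \/ r = 1 \/ r = -1) /\ (3 %| x - r)%Z.
Proof.
have : (x %% 3)%Z = 0 \/ (x %% 3)%Z = 1 \/ (x %% 3)%Z = 2 by lia.
by case=> [|[]] e; [exists 0|exists 1|exists (-1)]; split; lia.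
Qed.

(** Squares are 0 or 1 modulo 3, so zero or three entries are prime to 3: one entry is divisible by
    3 and the others agree up to sign. Here 16 = 4 * 2^2 counts the place of that entry and the
    signs of two others. *)
Lemma qnorm_third (M : int) (s : seq quad) : uniq s ->
  (forall v, v \in s -> qnorm v = 3 * M) ->
  exists s', [/\ uniq s', (size s <= 16 * size s')%N & forall v, v \in s' -> qnorm v = M].
Proof.
move=> Us sM.
have cov v : v \in s -> exists i, third_dom (turn i v).
  move=> /sM; case: v => [[[x y] z] w]; rewrite /qnorm /= => e.
  have [a [ha xa]] := res3 x; have [b [hb yb]] := res3 y.
  have [c [hc zc]] := res3 z; have [d [hd wd]] := res3 w.
  have e3 : (3 %| a ^+ 2 + b ^+ 2 + c ^+ 2 + d ^+ 2)%Z.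
    rewrite (_ : _ + _ = 3 * M - ((x + a) * (x - a) + (y + b) * (y - b) + (z + c) * (z - c) + (w + d) * (w - d))).
      by rewrite rpredB ?dvdz_mulr// !rpredD ?dvdz_mull.
    by rewrite -e; ring.
  have usq (r : int) : (r = 0 \/ r = 1 \/ r = -1) -> r <> 0 -> r ^+ 2 = 1.
    by case=> [|[]] -> // _; rewrite ?sqrrN expr1n.
  have core (x1 x2 x3 x4 a1 a2 a3 : int) :
     (a1 = 0 \/ a1 = 1 \/ a1 = -1) -> (a2 = 0 \/ a2 = 1 \/ a2 = -1) ->
     (a3 = 0 \/ a3 = 1 \/ a3 = -1) ->
     (3 %| x1 - a1)%Z -> (3 %| x2 - a2)%Z -> (3 %| x3 - a3)%Z -> (3 %| x4)%Z ->
     (3 %| a1 ^+ 2 + a2 ^+ 2 + a3 ^+ 2)%Z ->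
     third_dom (x1, (if a2 == a1 then x2 else - x2), (if a3 == a1 then x3 else - x3), x4).
    move=> h1 h2 h3 y1 y2 y3 y4 sq.
    have sgn (u r : int) : (r = 0 \/ r = 1 \/ r = -1) -> (r = 0 <-> a1 = 0) -> (3 %| u - r)%Z ->
        (3 %| (if r == a1 then u else - u) - a1)%Z.
      case: eqVneq => [->//|/eqP ne] hr ra ur.
      rewrite (_ : - u - a1 = - (u - r)); first by rewrite rpredN.
      by clear -h1 hr ra ne; lia.
    have sq01 (r : int) : (r = 0 \/ r = 1 \/ r = -1) -> (r = 0 /\ r ^+ 2 = 0) \/ (r <> 0 /\ r ^+ 2 = 1).
      move=> hr; case: (eqVneq r 0) => [->|/eqP r0]; first by left; rewrite expr0n.
      by right; split; [exact: r0|exact: (usq _ hr r0)].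
    have [e2 e3'] : (a2 = 0 <-> a1 = 0) /\ (a3 = 0 <-> a1 = 0).
      move: sq; case: (sq01 _ h1) => -[z1 ->]; case: (sq01 _ h2) => -[z2 ->];
        by case: (sq01 _ h3) => -[z3 ->]; clear -z1 z2 z3 => // _; split; split.
    have := sgn x2 a2 h2 e2 y2; have := sgn x3 a3 h3 e3' y3.
    rewrite /third_dom /= y4 andbT; set u := if _ then x2 else _; set v := if _ then x3 else _ => vu uv.
    rewrite (_ : x1 - u = (x1 - a1) - (u - a1)); last by ring.
    rewrite (_ : u - v = (u - a1) - (v - a1)); last by ring.
    by apply/andP; split; apply: rpredB.
  have drop (u r : int) : r = 0 -> (3 %| u - r)%Z -> (3 %| u)%Z by move=> ->; rewrite subr0.
  have [a0|/eqP a0] := eqVneq a 0.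
    exists (Ordinal (isT : 3 < 4)%N, (c == b, d == b)).
    apply: (core y z w x b c d hb hc hd yb zc wd (drop _ _ a0 xa)).
    by move: e3; rewrite a0 expr0n add0r.
  have [b0|/eqP b0] := eqVneq b 0.
    exists (Ordinal (isT : 2 < 4)%N, (c == a, d == a)).
    apply: (core x z w y a c d ha hc hd xa zc wd (drop _ _ b0 yb)).
    by move: e3; rewrite b0 expr0n addr0.
  have [c0|/eqP c0] := eqVneq c 0.
    exists (Ordinal (isT : 1 < 4)%N, (b == a, d == a)).
    apply: (core x y w z a b d ha hb hd xa yb wd (drop _ _ c0 zc)).
    by move: e3; rewrite c0 expr0n addr0.
  have [d0|/eqP d0] := eqVneq d 0.
    exists (Ordinal (isT : 0 < 4)%N, (b == a, c == a)).
    apply: (core x y z w a b c ha hb hc xa yb zc (drop _ _ d0 wd)).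
    by move: e3; rewrite d0 expr0n addr0.
  by move: e3; rewrite !usq.
have inj i v w : third_dom (turn i v) -> third_dom (turn i w) ->
    third (turn i v) = third (turn i w) -> v = w.
  have pinj : turn i v = turn i w -> v = w.
    case: v => [[[x y] z] w0]; case: w => [[[x' y'] z'] w'].
    rewrite /turn; case: i => -[] [|[|[|i]]] ? [[] []] /= [-> ]; do ?[move=> /oppr_inj ->| move=> ->] => //.
  move=> dv dw hvw; apply: pinj; move: dv dw hvw.
  move: (turn i v) (turn i w) => [[[x y] z] w0] [[[x' y'] z'] w'].
  rewrite /third_dom /third /= => /and3P[a1 a2 a3] /and3P[a4 a5 a6] [b1 b2 b3 b4].
  have -> : w0 = w' by lia. have -> : x = x' by lia. have -> : y = y' by lia.
  by have -> : z = z' by lia.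
have [|i [Ui le]] := @pigeonhole_map _ _ _ (fun i v => third_dom (turn i v)) (fun i v => third (turn i v)) s Us _ cov inj.
  by rewrite card_prod card_ord card_prod card_bool.
rewrite card_prod card_ord card_prod card_bool in le.
exists [seq third (turn i v) | v <- s & third_dom (turn i v)]; split => // v /mapP[u].
rewrite mem_filter => /andP[du /sM us] ->.
have {us} : qnorm (turn i u) = 3 * M.
  rewrite -us; case: u {du us} => [[[x y] z] w].
  by rewrite /turn /qnorm; case: i {Ui le} => -[] [|[|[|i]]] ? [[] []] /=; ring.
move: du; move: (turn i u) => [[[x y] z] w].
rewrite /third_dom /third /qnorm /= => /and3P[/dvdzP[k kE] /dvdzP[l lE] /dvdzP[j jE]].
have -> : y = z + l * 3 by lia. have -> : x = z + l * 3 + k * 3 by lia. rewrite jE.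
have -> : ((z + l * 3 + k * 3 + (z + l * 3) + z) %/ 3)%Z = z + 2 * l + k by lia.
have -> : ((j * 3 + (z + l * 3 + k * 3) - (z + l * 3)) %/ 3)%Z = j + k by lia.
have -> : ((j * 3 + (z + l * 3) - z) %/ 3)%Z = j + l by lia.
have -> : ((j * 3 + z - (z + l * 3 + k * 3)) %/ 3)%Z = j - l - k by lia.
move=> e; apply: (@mulfI _ 3) => //; rewrite -e; ring.
Qed.

(** 64 = 4 * 16: a factor 4 to fix the multiple k m, then a factor 1, 3, 16 or 3 * 3 to remove k =
    1, 2, 3 or 4. *)
Lemma rep4_lower (m : nat) : coprime m 6 ->
  exists s : seq quad, [/\ uniq s, (size (rotation_params m) <= 64 * size s)%N &
    forall v, v \in s -> qnorm v = m%:Z].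
Proof.
move=> m6; have [s0 [U0 <- s0m]] := rep4_family m6.
have cov v : v \in s0 -> exists i : 'I_4, qnorm v == (i.+1 * m)%N%:Z.
  move=> /s0m[k /andP[k0 k4] e]; have lt : (k.-1 < 4)%N by lia.
  by exists (Ordinal lt); rewrite e /= prednK.
have [|i [U1 le1]] := @pigeonhole_map _ _ _ (fun (i : 'I_4) v => qnorm v == (i.+1 * m)%N%:Z) (fun _ v => v) s0 U0 _ cov (fun _ _ _ _ _ e => e).
  by rewrite card_ord.
move: U1 le1; rewrite map_id card_ord; set s1 := [seq v <- s0 | _] => U1 le1.
have s1E v : v \in s1 -> qnorm v = (i.+1 * m)%N%:Z by rewrite mem_filter => /andP[/eqP].
have fin c (s2 : seq quad) : (size s1 <= c * size s2)%N -> (c <= 16)%N ->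
    (size s0 <= 64 * size s2)%N.
  move=> h c16; apply: leq_trans le1 _; rewrite (_ : 64 = 4 * 16)%N// -mulnA leq_mul2l.
  by apply: leq_trans h _; rewrite leq_mul2r c16 orbT.
case: i @s1 U1 le1 s1E fin => -[|[|[|[|//]]]] lt s1 U1 le1 s1E fin; rewrite /= in s1E.
- by exists s1; split=> [//||v /s1E ->]; [apply: (fin 1%N); rewrite ?mul1n|rewrite mul1n].
- have [|s2 [U2 le2 E2]] := @qnorm_halve m%:Z s1 U1; first by move=> v /s1E ->; rewrite PoszM.
  by exists s2; split => //; exact: fin le2 _.
- have [|s2 [U2 le2 E2]] := @qnorm_third m%:Z s1 U1; first by move=> v /s1E ->; rewrite PoszM.
  by exists s2; split => //; exact: fin le2 _.
- have [|s2 [U2 le2 E2]] := @qnorm_halve (2 * m%:Z) s1 U1.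
    by move=> v /s1E ->; rewrite PoszM; ring.
  have [|s3 [U3 le3 E3]] := @qnorm_halve m%:Z s2 U2; first by [].
  exists s3; split => //; apply: (fin 9%N) => //.
  by apply: leq_trans le2 _; rewrite (_ : 9 = 3 * 3)%N// -mulnA leq_mul2l.
Qed.

End Descent.

(** * Counting the admissible rotation parameters *)

Lemma count_two_roots (p K c : nat) (Q : pred nat) : (0 < p)%N -> (K <= p * c)%N ->
  (forall x y : nat, Q x -> Q y -> x = y %[mod p] \/ (p %| x + y)%N) ->
  (count Q (iota 0 K) <= 2 * c)%N.
Proof.
move=> p0 Kc roots; rewrite -size_filter.
have [/hasP[r _ Qr]|noQ] := boolP (has Q (iota 0 K)); last first.
  by rewrite size_filter; move: noQ; rewrite has_count -leqNgt leqn0 => /eqP ->.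
(* [f t] records the block of length p containing t and whether t is congruent to the solution r. If
   not, t is congruent to - r, so [f] is injective on the solutions. *)
pose f (t : nat) : option 'I_c * bool := (insub (t %/ p)%N, t == r %[mod p]).
pose s := [seq f t | t <- iota 0 K & Q t].
have lt t : t \in [seq t <- iota 0 K | Q t] -> Q t /\ (t %/ p < c)%N.
  by rewrite mem_filter mem_iota /= add0n => /andP[Qt tK]; rewrite ltn_divLR// mulnC (leq_trans tK).
have Us : uniq s.
  rewrite map_inj_in_uniq ?filter_uniq ?iota_uniq// => t u /lt[Qt tc] /lt[Qu uc].
  rewrite /f !insubT => -[] tu e.
  rewrite (divn_eq t p) (divn_eq u p) tu; congr (_ + _)%N.
  have [/eqP tr|tr] := boolP (t == r %[mod p]).
    by move: e; rewrite tr eqxx => /esym/eqP ->.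
  have ur : u != r %[mod p] by rewrite -e.
  have [/eqP|pt] := roots _ _ Qt Qr; first by rewrite (negPf tr).
  have [/eqP|pu] := roots _ _ Qu Qr; first by rewrite (negPf ur).
  by apply/eqP; rewrite -(eqn_modDr r) (eqP pt) (eqP pu).
have sS : {subset s <= [seq (Some i.1, i.2) | i : 'I_c * bool]}.
  move=> _ /mapP[t /lt[Qt tc] ->]; apply/fintype.imageP.
  by exists (Ordinal tc, t == r %[mod p]) => //; rewrite /f insubT.
have := uniq_leq_size Us sS.
by rewrite size_map size_image card_prod card_ord card_bool mulnC.
Qed.

Lemma count_has_le (T U : Type) (P : U -> pred T) (l : seq U) (s : seq T) :
  (count (fun t => has (P ^~ t) l) s <= \sum_(i <- l) count (P i) s)%N.
Proof.
elim: l => [|i l IH]; first by rewrite big_nil (eq_count (a2 := pred0))// count_pred0.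
rewrite big_cons; apply: leq_trans (leq_add (leqnn _) IH).
by rewrite -count_predUI leq_addr.
Qed.

Lemma prime_dvd_square_diff (p : nat) (x y : nat) : prime p ->
  (p%:Z %| x%:Z ^+ 2 - y%:Z ^+ 2)%Z -> x = y %[mod p] \/ (p %| x + y)%N.
Proof.
move=> p_pr; rewrite subr_sqr dvdzE abszM Euclid_dvdM// => /orP[h|h]; [left|by right].
have : (x%:Z == y%:Z %[mod p%:Z])%Z by rewrite eqz_mod_dvd dvdzE.
by rewrite !modz_nat => /eqP[].
Qed.

(** Union bound over the primes dividing m, each excluding at most two classes of t. The left side
    may be negative for a particular m, hence the average in [rotation_params_average]. *)
Lemma rotation_params_size (m : nat) : (0 < m)%N ->
  m%:R * (1 - \sum_(p <- primes m) 2 / p%:R) <= (size (rotation_params m))%:R :> rat.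
Proof.
move=> m0; rewrite mulrBr mulr1 lerBlDr mulr_sumr.
apply: (@le_trans _ _ ((size (rotation_params m) +
    \sum_(p <- primes m) count (fun t => p %| t ^ 2 + 1) (iota 0 m))%N%:R)).
  rewrite ler_nat /rotation_params size_filter -{1}(size_iota 0 m).
  rewrite -(count_predC (fun t => coprime (t ^ 2 + 1) m) (iota 0 m)) leq_add2l.
  apply: leq_trans (count_has_le _ _ _); apply: sub_count => t /=.
  rewrite coprime_has_primes// ?addn1// negbK => /hasP[p pm pt]; apply/hasP; exists p => //.
  by move: pt; rewrite /= mem_primes => /and3P[].
rewrite natrD lerD2l natr_sum big_seq [leRHS]big_seq; apply: ler_sum => p.
rewrite mem_primes => /and3P[p_pr _ /dvdnP[c mE]].
have p0 := prime_gt0 p_pr.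
have -> : m%:R * (2 / p%:R) = (2 * c)%:R :> rat.
  by rewrite mE !natrM; field; rewrite pnatr_eq0 -lt0n.
rewrite ler_nat; apply: (@count_two_roots p) => //; first by rewrite mE mulnC.
move=> x y px py; apply: prime_dvd_square_diff => //.
rewrite (_ : _ - _ = (x ^ 2 + 1)%N%:Z - (y ^ 2 + 1)%N%:Z).
  by apply: rpredB.
by rewrite !PoszD !exprS !expr0 !expnS !expn0; lia.
Qed.

Definition odd_ge5 (p : nat) : bool := odd p && (5 <= p)%N.

(** Telescoping of (2 h + 1)^(-2) <= 1 / (4 h) - 1 / (4 (h + 1)) from h = 2, over all odd numbers
    rather than primes. *)
Lemma odd_inv_square_sum (H : nat) :
  \sum_(0 <= p < 2 * H | odd_ge5 p) (p%:R ^+ 2)^-1 <= 8^-1 :> rat.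
Proof.
suff S h : \sum_(0 <= p < 2 * h.+2 | odd_ge5 p) (p%:R ^+ 2)^-1 <= 8^-1 - (4 * h.+2%:R)^-1 :> rat.
  apply: (@le_trans _ _ (\sum_(0 <= p < 2 * H.+2 | odd_ge5 p) (p%:R ^+ 2)^-1)).
    rewrite (@big_cat_nat _ _ _ (2 * H) 0 (2 * H.+2)) ?leq0n ?leq_mul2l ?leqW//= lerDl.
    by apply: sumr_ge0 => p _; rewrite invr_ge0 sqr_ge0.
  by apply: le_trans (S H) _; rewrite gerBl invr_ge0 mulr_ge0 ?ler0n.
elim: h => [|h IH].
  by rewrite big_mkcond /index_iota /= !big_cons big_nil !add0r subr_ge0 lef_pV2.
rewrite (_ : 2 * h.+3 = (2 * h.+2).+2)%N; last by lia.
rewrite [leLHS]big_mkcond big_nat_recr // big_nat_recr //= -big_mkcond /=.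
have -> : odd_ge5 (2 * h.+2) = false by rewrite /odd_ge5 mul2n odd_double.
rewrite addr0.
have -> : odd_ge5 (2 * h.+2).+1 by rewrite /odd_ge5 oddS mul2n odd_double andTb; lia.
apply: le_trans (lerD IH (lexx _)) _.
set x : rat := h.+2%:R.
have -> : (2 * h.+2).+1%:R = 2 * x + 1 :> rat by rewrite -natr1 natrM.
have -> : h.+3%:R = x + 1 :> rat by rewrite -natr1.
have x0 : 0 < x by rewrite ltr0n.
have -> : 8^-1 - (4 * x)^-1 + ((2 * x + 1) ^+ 2)^-1 =
  8^-1 - (4 * (x + 1))^-1 - (4 * x * (x + 1) * (2 * x + 1) ^+ 2)^-1 :> rat.
  by field; rewrite ?gt_eqF//; lra.
by rewrite gerBl invr_ge0 !mulr_ge0// ?sqr_ge0//; lra.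
Qed.

(** Each block from 2 M to 4 M contains M odd numbers, with reciprocals at most 1 / (2 M), and so
    contributes at most 1 / 2. *)
Lemma odd_inv_sum (k : nat) :
  \sum_(0 <= p < 2 * 2 ^ k | odd_ge5 p) p%:R^-1 <= k%:R / 2 :> rat.
Proof.
elim: k => [|k IH]; first by rewrite big_mkcond /index_iota /= !big_cons big_nil.
rewrite (@big_cat_nat _ _ _ (2 * 2 ^ k)) //=; last by rewrite leq_mul2l expnS leq_pmull.
rewrite -natr1 mulrDl lerD//.
rewrite big_mkcond /=.
have -> : (2 * 2 ^ k.+1 = 2 * 2 ^ k + 2 * 2 ^ k)%N by rewrite expnS; lia.
have : (0 < 2 ^ k)%N by rewrite expn_gt0.
move: (2 ^ k)%N => M M0.
suff S l : \sum_(2 * M <= p < 2 * M + 2 * l) (if odd_ge5 p then p%:R^-1 else 0) <= l%:R / (2 * M)%:R :> rat.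
  apply: le_trans (S M) _; rewrite natrM le_eqVlt; apply/orP; left; apply/eqP.
  by field; rewrite pnatr_eq0 -lt0n.
elim: l => [|l IHl]; first by rewrite muln0 addn0 big_geq// mul0r.
rewrite (_ : 2 * M + 2 * l.+1 = (2 * M + 2 * l).+2)%N; last by lia.
rewrite !big_nat_recr ?leq_addr//=; last by rewrite leqW// leq_addr.
have -> : odd_ge5 (2 * M + 2 * l) = false by rewrite /odd_ge5 -mulnDr mul2n odd_double.
rewrite addr0 -[l.+1%:R]natr1 mulrDl mul1r lerD//.
case: ifP => _; last by rewrite invr_ge0.
by rewrite lef_pV2 ?posrE ?ltr0n ?ler_nat//; lia.
Qed.

Lemma coprime6_prime_gt (m p : nat) : coprime m 6 -> p \in primes m -> odd p && (5 <= p)%N.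
Proof.
move=> m6; rewrite mem_primes => /and3P[p_pr m0 pm].
have p6 : coprime p 6 by apply: coprime_dvdl m6.
have := prime_gt1 p_pr; move: p6; rewrite (_ : 6 = 2 * 3)%N// coprimeMr coprimen2.
move=> /andP[p_odd p3] p1; rewrite p_odd /=; move: p_odd p3.
by case: p {p_pr pm} p1 => [|[|[|[|[|p]]]]].
Qed.

(** A prime p >= 5 divides m(e) for at most 2 (K / p + 1) values of e. The excluded shares therefore
    add up to at most 4 K / 8 + 4 k / 2 <= 3 K / 4, and the remaining quarter meets m(e) >= n /
    2. *)
Lemma rotation_params_average (n c K k : nat) :
  let m e := (n - (c ^ 2 + (6 * e) ^ 2))%N in
  (forall e, (e < K)%N -> (n <= 2 * m e)%N /\ coprime (m e) 6) ->
  (0 < n < 2 * 2 ^ k)%N -> (8 * k <= K)%N ->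
  n%:R * K%:R / 8 <= (\sum_(e < K) size (rotation_params (m e)))%N%:R :> rat.
Proof.
move=> m mE /andP[n0 nk] kK.
pose q e : rat := \sum_(p <- primes (m e)) 2 / p%:R.
have qE (e : 'I_K) : q e = \sum_(0 <= p < 2 * 2 ^ k | odd p && (5 <= p)%N)
    (if p \in primes (m e) then 2 / p%:R else 0).
  have [nm m6] := mE e (ltn_ord e).
  rewrite -big_mkcondr -big_filter /q; apply: perm_big; apply: uniq_perm.
  - exact: primes_uniq.
  - by rewrite filter_uniq// iota_uniq.
  - move=> p; rewrite mem_filter mem_index_iota /=.
    case: (boolP (p \in primes (m e))) => pm; last by rewrite andbF.
    rewrite (coprime6_prime_gt m6 pm) /=; move: pm; rewrite mem_primes => /and3P[_ m0 /dvdn_leq].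
    by move=> /(_ m0) pm; symmetry; apply: leq_ltn_trans pm _; apply: leq_ltn_trans nk; exact: leq_subr.
have Sq : \sum_(e < K) q e <= 3 / 4 * K%:R.
  under eq_bigr do rewrite qE.
  rewrite exchange_big /=.
  apply: (@le_trans _ _ (\sum_(0 <= p < 2 * 2 ^ k | odd p && (5 <= p)%N)
     (4 * K%:R * (p%:R ^+ 2)^-1 + 4 * p%:R^-1))).
    apply: ler_sum => p /andP[p_odd p5].
    rewrite -big_mkcond /= sumr_const -[leLHS]mulr_natr.
    have p0 : (0 < p)%N by lia.
    have pR : (0 : rat) < p%:R by rewrite ltr0n.
    have le : (#|[pred e : 'I_K | p \in primes (m e)]| <= 2 * (K %/ p).+1)%N.
      apply: (@leq_trans (count (fun e => p \in primes (m e)) (iota 0 K))).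
        rewrite -sum1_card -sum1_count.
        have -> : iota 0 K = index_iota 0 K by rewrite /index_iota subn0.
        by rewrite big_mkord.
      apply: (@count_two_roots p) => //; first by rewrite ltnW// mulnC ltn_ceil.
      have mZ x : p \in primes (m x) -> (m x)%:Z = n%:Z - c%:Z ^+ 2 - 36 * x%:Z ^+ 2.
        rewrite mem_primes => /and3P[_]; rewrite subn_gt0 => lt _.
        by rewrite -subzn ?(ltnW lt)// !expnS !expn0 !expr2; clear; lia.
      move=> x y px py.
      have /and3P[p_pr _ pmx] : [&& prime p, (0 < m x)%N & (p %| m x)%N] by rewrite -mem_primes.
      have /and3P[_ _ pmy] : [&& prime p, (0 < m y)%N & (p %| m y)%N] by rewrite -mem_primes.
      apply: prime_dvd_square_diff => //.
      have : (p%:Z %| 36 * (x%:Z ^+ 2 - y%:Z ^+ 2))%Z.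
        rewrite (_ : 36 * _ = (m y)%:Z - (m x)%:Z); last by rewrite !mZ//; ring.
        by apply: rpredB.
      have cop : coprime p (2 ^ 2 * 3 ^ 2).
        rewrite prime_coprime// Euclid_dvdM// !Euclid_dvdX// !andbT !dvdn_prime2// negb_or.
        by apply/andP; split; apply: contraTneq p5 => ->.
      by rewrite Gauss_dvdzr.
    apply: le_trans (_ : 2 / p%:R * (2 * (K %/ p).+1)%:R <= _).
      by rewrite ler_wpM2l ?divr_ge0 ?ler_nat.
    have Kp : (K %/ p)%:R <= K%:R / p%:R :> rat.
      by rewrite ler_pdivlMr// -natrM ler_nat leq_divM.
    rewrite natrM -[(K %/ p).+1%:R]natr1 [X in _ <= X](_ : _ = 2 / p%:R * (2 * (K%:R / p%:R + 1))).
      by rewrite ler_wpM2l ?divr_ge0// ler_wpM2l// lerD2r.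
    by field; rewrite gt_eqF.
  rewrite big_split /= -!mulr_sumr.
  have S1 := odd_inv_square_sum (2 ^ k); have S2 := odd_inv_sum k.
  have kR : 8 * k%:R <= K%:R :> rat by rewrite -natrM ler_nat.
  have K0 : 0 <= K%:R :> rat by [].
  move: S1 S2; set u := \sum_(_ <= _ < _ | _) _; set v := \sum_(_ <= _ < _ | _) _ => S1 S2.
  have : 4 * K%:R * u <= 4 * K%:R * 8^-1 by rewrite ler_wpM2l ?mulr_ge0.
  by lra.
apply: (@le_trans _ _ (\sum_(e < K) n%:R / 2 * (1 - q e))).
  rewrite -mulr_sumr sumrB sumr_const card_ord.
  have n0R : 0 <= n%:R :> rat by [].
  rewrite -[X in X - _]mulr_natl mulr1.
  by have : n%:R * \sum_(e < K) q e <= n%:R * (3 / 4 * K%:R); [rewrite ler_wpM2l|lra].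
rewrite natr_sum; apply: ler_sum => e _.
have [nm m6] := mE e (ltn_ord e).
have m0 : (0 < m e)%N by lia.
have [q1|q1] := leP 0 (1 - q e); last first.
  by apply: le_trans (ler0n _ _); rewrite mulr_ge0_le0 ?divr_ge0// ltW.
apply: le_trans (rotation_params_size m0); rewrite ler_wpM2r//.
by rewrite ler_pdivrMr// -natrM ler_nat mulnC.
Qed.

(** * From four squares to six and more *)

Lemma sum_inj_le (I J : finType) (h : I -> J) (F : J -> nat) : injective h ->
  (\sum_i F (h i) <= \sum_j F j)%N.
Proof.
move=> h_inj; apply: (@leq_trans (\sum_(x in h @: [set: _]) F x)).
  rewrite big_imset /=; last by move=> x y _ _; exact: h_inj.
  by apply/eq_leq/eq_bigl => t; rewrite inE.
by rewrite [leqRHS](bigID (mem (h @: [set: _]))) leq_addr.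
Qed.

Lemma box_count_recl (N d : nat) (t : int) :
  (\sum_(a < (2 * N).+1) box_count N d (t - ((a : nat)%:Z - N%:Z) ^+ 2)
     <= box_count N d.+1 t)%N.
Proof.
pose P (a : 'I_(2 * N).+1) (o : {ffun 'I_d -> 'I_(2 * N).+1}) :=
  \sum_i ((o i : nat)%:Z - N%:Z) ^+ 2 == t - ((a : nat)%:Z - N%:Z) ^+ 2.
pose g (z : 'I_(2 * N).+1 * {ffun 'I_d -> 'I_(2 * N).+1}) : {ffun 'I_d.+1 -> 'I_(2 * N).+1} :=
  [ffun i => if unlift ord0 i is Some j then z.2 j else z.1].
have -> : \sum_(a < (2 * N).+1) box_count N d (t - ((a : nat)%:Z - N%:Z) ^+ 2) =
    #|[set z | P z.1 z.2]|.
  rewrite -sum1_card (eq_bigl (fun z => P z.1 z.2)); last by move=> z; rewrite inE.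
  rewrite -(pair_big_dep predT P (fun _ _ => 1%N)) /=; apply: eq_bigr => a _.
  by rewrite /box_count -sum1_card; apply: eq_bigl => o; rewrite inE.
rewrite -(card_in_imset (f := g)).
  apply/subset_leq_card/fintype.subsetP => u /imsetP[[a o ]].
  rewrite inE /P /= => /eqP e ->; rewrite inE big_ord_recl !ffunE unlift_none /=.
  under eq_bigr do rewrite ffunE liftK /=.
  by rewrite e addrC subrK.
move=> [a o] [a' o'] _ _ /ffunP H; congr (_, _).
  by have := H ord0; rewrite !ffunE unlift_none.
by apply/ffunP => i; have := H (lift ord0 i); rewrite !ffunE liftK.
Qed.

Lemma box_count_restrict (N d K : nat) (t : int) (u : nat -> nat) : injective u ->
  (forall f, (f < K)%N -> (u f <= N)%N) ->
  (\sum_(f < K) box_count N d (t - (u f)%:Z ^+ 2) <= box_count N d.+1 t)%N.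
Proof.
move=> u_inj uN; apply: leq_trans (box_count_recl _ _ _).
have lt (f : 'I_K) : (u f + N < (2 * N).+1)%N by have := uN f (ltn_ord f); lia.
pose h (f : 'I_K) := Ordinal (lt f).
have h_inj : injective h.
  by move=> f f' /(congr1 (@nat_of_ord _)) /= /addIn /u_inj /ord_inj.
apply: leq_trans (sum_inj_le (fun a : 'I_(2 * N).+1 => box_count N d (t - ((a : nat)%:Z - N%:Z) ^+ 2)) h_inj).
by apply: leq_sum => f _; rewrite /h /= PoszD addrK.
Qed.

Lemma box_count4_ge (N : nat) (t : nat) (s : seq (int * int * int * int)) : (t <= N)%N ->
  uniq s -> (forall v, v \in s -> qnorm v = t%:Z) -> (size s <= box_count N 4 t%:Z)%N.
Proof.
move=> tN Us sE.
pose co (v : int * int * int * int) (i : nat) := nth 0 [:: v.1.1.1; v.1.1.2; v.1.2; v.2] i.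
pose g v : {ffun 'I_4 -> 'I_(2 * N).+1} := [ffun i : 'I_4 => inord (absz (co v i + N%:Z))].
have gE v (i : 'I_4) : v \in s -> (g v i : nat)%:Z - N%:Z = co v i.
  move=> /sE e; rewrite ffunE.
  have : co v i ^+ 2 <= N%:Z.
    apply: le_trans (_ : t%:Z <= _); last by rewrite lez_nat.
    have key (a b c d : int) : 0 <= a -> 0 <= b -> 0 <= c -> 0 <= d ->
        [/\ a <= a + b + c + d, b <= a + b + c + d, c <= a + b + c + d & d <= a + b + c + d].
      by clear; move=> a0 b0 c0 d0; split; lia.
    have [k1 k2 k3 k4] := key _ _ _ _ (sqr_ge0 v.1.1.1) (sqr_ge0 v.1.1.2) (sqr_ge0 v.1.2) (sqr_ge0 v.2).
    by rewrite -e /qnorm /co; case: i => -[|[|[|[|//]]]] ? /=.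
  move: (co v i) => x xN.
  have : (absz x <= N)%N by rewrite expr2 in xN; clear -xN; nia.
  by move=> xN'; rewrite inordK; lia.
have Ug : uniq [seq g v | v <- s].
  rewrite map_inj_in_uniq// => v w vs ws /ffunP H.
  have e (i : 'I_4) : co v i = co w i by rewrite -!gE// H.
  have := e (inord 0); have := e (inord 1); have := e (inord 2); have := e (inord 3).
  rewrite !inordK// /co /=.
  by case: v {vs H e} => [[[? ?] ?] ?]; case: w {ws} => [[[? ?] ?] ?] /= -> -> -> ->.
rewrite -(size_map g) -(card_uniqP Ug); apply/subset_leq_card/fintype.subsetP => o /mapP[v vs ->].
rewrite inE; under eq_bigr do rewrite gE//.
by rewrite !big_ord_recl big_ord0 addr0 -(sE v vs) /qnorm /co /= !addrA.
Qed.

(** Lagrange's theorem, which settles the small n in [six_squares_lower]. For n prime to 6 the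
    parameter t = 0 is admissible, so [rep4_lower] gives a nonempty list; factors 2 and 3 are
    restored by inverting the descents. *)
Lemma four_squares (n : nat) : exists v, qnorm v = n%:Z.
Proof.
have [l] := ubnP n; elim: l n => // l IH n nl.
have [->|n0] := posnP n; first by exists 0; rewrite /qnorm /= !expr0n.
have [n2|n2] := boolP (2 %| n)%N.
  have /dvdnP[q qE] := n2; have [|[[[x y] z] w] vE] := IH q; first by lia.
  exists (x + y, x - y, z + w, z - w).
  by rewrite qE PoszM -vE /qnorm /=; ring.
have [n3|n3] := boolP (3 %| n)%N.
  have /dvdnP[q qE] := n3; have [|[[[x y] z] w] vE] := IH q; first by lia.
  exists (x + y + z, w + x - y, w + y - z, w + z - x).
  by rewrite qE PoszM -vE /qnorm /=; ring.
have n6 : coprime n 6 by rewrite coprime_sym (_ : 6 = 2 * 3)%N// coprimeMl !prime_coprime// n2 n3.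
have [s [_ le sE]] := rep4_lower n6.
case: s le sE => [|v s] le sE; last by exists v; apply: sE; rewrite mem_head.
move: le; rewrite muln0 leqNgt size_filter -has_count => /negP[]; apply/hasP; exists 0%N.
  by rewrite mem_iota.
by rewrite /= exp0n// add0n coprime1n.
Qed.

(* The four-square bound applies to n minus two squares [c + 6 f] and [6 e]
   chosen to make the remainder prime to 6. *)
Lemma residue_choice (n : nat) : exists2 c : nat, (c < 6)%N &
  forall f e : nat, ((c + 6 * f) ^ 2 + (6 * e) ^ 2 <= n)%N ->
    coprime (n - ((c + 6 * f) ^ 2 + (6 * e) ^ 2)) 6.
Proof.
suff [c c6 cP] : exists2 c : nat, (c < 6)%N &
    (forall X : nat, (c ^ 2 + 6 * X <= n -> (n - (c ^ 2 + 6 * X)) %% 6 = 1 \/ (n - (c ^ 2 + 6 * X)) %% 6 = 5)%N).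
  exists c => // f e; have -> : ((c + 6 * f) ^ 2 + (6 * e) ^ 2 = c ^ 2 + 6 * (2 * c * f + 6 * f ^ 2 + 6 * e ^ 2))%N.
    by rewrite !expnS !expn0; clear; lia.
  by move=> /cP; rewrite -coprime_modl => -[] ->.
have : (n %% 6 < 6)%N by rewrite ltn_pmod.
case E : (n %% 6)%N => [|[|[|[|[|[|//]]]]]] _.
- by exists 1%N => // X; move: E; clear; lia.
- by exists 0%N => // X; move: E; clear; lia.
- by exists 1%N => // X; move: E; clear; lia.
- by exists 2%N => // X; move: E; rewrite -[(2 ^ 2)%N]/4%N; clear; lia.
- by exists 3%N => // X; move: E; rewrite -[(3 ^ 2)%N]/9%N; clear; lia.
- by exists 0%N => // X; move: E; clear; lia.
Qed.

Lemma six_squares_lower_large (N n : nat) (k := trunc_log 2 n) : (25 <= k)%N -> (n <= N)%N ->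
  (n ^ 2 <= 576 * (8 * 64) * box_count N 6 n%:Z)%N.
Proof.
move=> k25 nN.
have n0 : (0 < n)%N by case: n @k k25 {nN} => //; rewrite trunc_log0.
have nk1 : (2 ^ k <= n)%N by apply: trunc_logP.
have nk2 : (n < 2 * 2 ^ k)%N by rewrite -expnS; apply: trunc_log_ltn.
have [h /andP[h1 h2]] := nat_sqrt_exists n.
(* This secures 8 k <= K, K being about the square root of n divided by 12. As 96 <= 2^7, it
   suffices that k^2 <= 2^(k - 14), which holds for k >= 25. *)
have kn : ((96 * k) ^ 2 <= n)%N.
  apply: leq_trans nk1; rewrite -(subnKC k25); move: (k - 25)%N => j.
  have : ((25 + j) ^ 2 <= 2 ^ (11 + j))%N.
    elim: j => // j IH; rewrite addnS [(11 + _)%N]addnS [(2 ^ _)%N]expnS.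
    by apply: leq_trans (leq_mul (leqnn 2) IH); rewrite !expnS !expn0; clear; nia.
  move=> H; apply: (@leq_trans (2 ^ 14 * (25 + j) ^ 2)).
    rewrite expnMn leq_mul2r; apply/orP; right.
    by rewrite (_ : 14 = 7 * 2)%N// expnM leq_exp2r.
  by apply: leq_trans (leq_mul (leqnn _) H) _; rewrite -expnD.
have kh : (96 * k <= h)%N by rewrite -ltnS -(ltn_exp2r _ _ (isT : (0 < 2)%N)); apply: leq_ltn_trans kn h2.
(* For e, f < K both subtracted squares are at most (6 K)^2 <= n / 4, leaving m >= n / 2. The K^2
   pairs number at least n / 576, because h + 1 <= 24 K. *)
pose K := (h %/ 12)%N.
have K8 : (8 * k <= K)%N by rewrite leq_divRL//; clear -kh; lia.
have Kh : (12 * K <= h)%N by rewrite mulnC leq_divM.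
have hK : (h < 12 * K.+1)%N by rewrite mulnC -ltn_divLR.
have K0 : (0 < K)%N by clear -K8 k25; lia.
have nK : (n <= 576 * K ^ 2)%N.
  apply: leq_trans (ltnW h2) _; rewrite (_ : 576 = 24 ^ 2)%N// -expnMn leq_exp2r//.
  by clear -hK K0; lia.
have Kn : (144 * K ^ 2 <= n)%N by apply: leq_trans h1; rewrite (_ : 144 = 12 ^ 2)%N// -expnMn leq_exp2r.
have [c c6 cP] := residue_choice n.
have small f e : (f < K)%N -> (e < K)%N -> (2 * ((c + 6 * f) ^ 2 + (6 * e) ^ 2) <= n)%N.
  move=> fK eK; apply: leq_trans Kn; rewrite mulnDr.
  have h3 : ((c + 6 * f) ^ 2 <= (6 * K) ^ 2)%N by rewrite leq_exp2r//; clear -fK c6; lia.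
  have h4 : ((6 * e) ^ 2 <= (6 * K) ^ 2)%N by rewrite leq_exp2r//; clear -eK; lia.
  by rewrite expnMn in h3 h4; move: h3 h4; rewrite ?expnMn -[(6 ^ 2)%N]/36%N; clear; lia.
pose m f e := (n - ((c + 6 * f) ^ 2 + (6 * e) ^ 2))%N.
have row f : (f < K)%N -> (n * K <= 8 * \sum_(e < K) size (rotation_params (m f e)))%N.
  move=> fK.
  have hyp e : (e < K)%N -> (n <= 2 * m f e)%N /\ coprime (m f e) 6.
    move=> eK; have sm := small f e fK eK; split; first by rewrite /m; clear -sm; lia.
    by apply: cP; clear -sm; lia.
  have := @rotation_params_average n (c + 6 * f) K k hyp; rewrite n0 nk2 => /(_ isT K8) H.
  rewrite -(ler_nat rat) [in leRHS]natrM natrM; move: H; rewrite -/(m f).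
  by move: (n%:R * K%:R) (\sum_(_ < _) _)%:R => u v; lra.
have uN (u : nat) : (u ^ 2 <= n)%N -> (u <= N)%N.
  by move=> un; apply: leq_trans nN; apply: leq_trans un; case: u => // u; rewrite leq_pmulr.
have box5 : (\sum_(f < K) box_count N 5 (n%:Z - (c + 6 * f)%N%:Z ^+ 2) <= box_count N 6 n%:Z)%N.
  apply: (@box_count_restrict N 5 K n%:Z (fun f => (c + 6 * f)%N)).
    by move=> f f' /addnI /eqP; rewrite eqn_pmul2l// => /eqP.
  by move=> f fK; apply: uN; have := small f f fK fK; clear; lia.
have box4 f : (f < K)%N -> (\sum_(e < K) size (rotation_params (m f e)) <=
     64 * box_count N 5 (n%:Z - (c + 6 * f)%N%:Z ^+ 2))%N.
  move=> fK.
  have := @box_count_restrict N 4 K (n%:Z - (c + 6 * f)%N%:Z ^+ 2) (fun e => (6 * e)%N).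
  move=> H; apply: (@leq_trans (64 * \sum_(e < K) box_count N 4 (n%:Z - (c + 6 * f)%N%:Z ^+ 2 - (6 * e)%N%:Z ^+ 2))); last first.
    rewrite leq_mul2l; apply/orP; right; apply: H.
      by move=> e e' /eqP; rewrite eqn_pmul2l// => /eqP.
    by move=> e eK; apply: uN; have := small e e eK eK; clear; lia.
  rewrite big_distrr /=; apply: leq_sum => e _.
  have sm := small f e fK (ltn_ord e).
  have le : ((c + 6 * f) ^ 2 + (6 * e) ^ 2 <= n)%N by clear -sm; lia.
  have [s [Us les sE]] := rep4_lower (cP f e le).
  apply: leq_trans les _; rewrite leq_mul2l /=.
  have -> : n%:Z - (c + 6 * f)%N%:Z ^+ 2 - (6 * e)%N%:Z ^+ 2 = (m f e)%:Z.
    by rewrite /m -subzn// PoszD !expnS !expn0 !expr2 !muln1 !PoszM; ring.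
  by apply: box_count4_ge => //; apply: leq_trans nN; exact: leq_subr.
apply: (@leq_trans (576 * K ^ 2 * n)); first by rewrite expnS expn1 leq_mul2r nK orbT.
rewrite -!mulnA leq_mul2l /=.
have : (\sum_(f < K) (n * K) <= \sum_(f < K) 8 * (64 * box_count N 5 (n%:Z - (c + 6 * f)%N%:Z ^+ 2)))%N.
  by apply: leq_sum => f _; apply: leq_trans (row f (ltn_ord f)) _; rewrite leq_mul2l box4.
rewrite sum_nat_const card_ord -!big_distrr /= => H.
apply: (@leq_trans (K * (n * K))); first by clear; nia.
by apply: leq_trans H _; rewrite !leq_mul2l /=.
Qed.

(** 2^50 = (2^25)^2 absorbs every n <= 2^25, for which one representation is enough; beyond, the
    constant 576 * 512 is below 2^19. *)
Lemma six_squares_lower (N n : nat) : (0 < n <= N)%N ->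
  (n ^ 2 <= 2 ^ 50 * box_count N 6 n%:Z)%N.
Proof.
move=> /andP[n0 nN].
have [k25|k25] := leqP 25 (trunc_log 2 n).
  apply: leq_trans (six_squares_lower_large k25 nN) _; rewrite leq_mul2r; apply/orP; right.
  have pow (a : nat) : (a <= 50)%N -> (2 ^ a <= 2 ^ 50)%N by move=> a50; rewrite leq_exp2l.
  by apply: leq_trans (pow (10 + 9) isT); rewrite expnD; apply: leq_mul.
have n2 : (n <= 2 ^ 25)%N.
  by apply: leq_trans (ltnW (trunc_log_ltn n (isT : 1 < 2)%N)) _; rewrite leq_exp2l.
have box1 : (1 <= box_count N 6 n%:Z)%N.
  have [v vE] := four_squares n.
  have b4 : (1 <= box_count N 4 n%:Z)%N.
    by apply: (@box_count4_ge N n [:: v]) => // u; rewrite inE => /eqP ->.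
  have step d : (box_count N d n%:Z <= box_count N d.+1 n%:Z)%N.
    have := @box_count_restrict N d 1 n%:Z id (fun _ _ => id).
    rewrite big_ord1 /= expr0n subr0; apply => f f1.
    by move: f1; rewrite ltnS leqn0 => /eqP ->.
  by apply: leq_trans (step 5); apply: leq_trans (step 4).
apply: leq_trans (_ : (2 ^ 25) ^ 2 <= _)%N; first by rewrite leq_exp2r.
by rewrite -expnM leq_pmulr.
Qed.

(** Two further squares, each at most n / 4, can be chosen in at least n / 4 ways, and at least n /
    2 remains to be represented. *)
Lemma even_squares_lower (j : nat) : exists C : nat, forall N n : nat, (0 < n <= N)%N ->
  (n ^ j.+2 <= C * box_count N (j.*2 + 6) n%:Z)%N.
Proof.
elim: j => [|j [C IH]]; first by exists (2 ^ 50)%N => N n; exact: six_squares_lower.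
exists (4 * (2 ^ j.+2 * C))%N => N n /andP[n0 nN].
have [h /andP[h1 h2]] := nat_sqrt_exists n.
pose K := (h./2).+1.
have K2 f : (f < K)%N -> (4 * f ^ 2 <= n)%N.
  rewrite ltnS => fK; apply: leq_trans h1; rewrite (_ : 4 = 2 ^ 2)%N// -expnMn leq_exp2r//.
  by have := odd_double_half h; lia.
have nK : (n <= 4 * K ^ 2)%N.
  apply: leq_trans (ltnW h2) _; rewrite (_ : 4 = 2 ^ 2)%N// -expnMn leq_exp2r//.
  by rewrite /K; have := odd_double_half h; case: (odd h); lia.
have fN f : (f < K)%N -> (f <= N)%N.
  move=> /K2 fn; apply: leq_trans nN; apply: leq_trans fn.
  by case: f => // f; rewrite expnS expn1; clear; nia.
have -> : (j.+1.*2 + 6 = (j.*2 + 6).+2)%N by rewrite doubleS.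
set d := (j.*2 + 6)%N in IH *.
have le2 : (\sum_(f < K) \sum_(e < K) box_count N d (n%:Z - f%:Z ^+ 2 - e%:Z ^+ 2) <= box_count N d.+2 n%:Z)%N.
  apply: leq_trans (@box_count_restrict N d.+1 K n%:Z id _ fN); last by [].
  by apply: leq_sum => f _; apply: (@box_count_restrict N d K _ id _ fN).
have term f e : (f < K)%N -> (e < K)%N ->
   (n ^ j.+2 <= 2 ^ j.+2 * C * box_count N d (n%:Z - f%:Z ^+ 2 - e%:Z ^+ 2))%N.
  move=> fK eK; have hf := K2 f fK; have he := K2 e eK.
  have nm : (n <= 2 * (n - (f ^ 2 + e ^ 2)))%N by clear -hf he; lia.
  have -> : n%:Z - f%:Z ^+ 2 - e%:Z ^+ 2 = (n - (f ^ 2 + e ^ 2))%N%:Z.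
    by rewrite -subzn ?PoszD ?expnS ?expn0 ?muln1 ?expr2 ?PoszM; [ring|clear -hf he; lia].
  apply: (@leq_trans ((2 * (n - (f ^ 2 + e ^ 2))) ^ j.+2)); first by rewrite leq_exp2r.
  rewrite expnMn -mulnA leq_mul2l; apply/orP; right; apply: IH.
  by rewrite (leq_trans (leq_subr _ _) nN) andbT; clear -nm n0; lia.
move: (2 ^ j.+2 * C)%N term => X term.
rewrite expnS; apply: leq_trans (leq_mul nK (leqnn _)) _.
rewrite -!mulnA leq_mul2l; apply/orP; right; apply: (@leq_trans (\sum_(f < K) \sum_(e < K) n ^ j.+2)).
  by rewrite !sum_nat_const !card_ord mulnA mulnn.
apply: (@leq_trans (\sum_(f < K) \sum_(e < K) X * box_count N d (n%:Z - f%:Z ^+ 2 - e%:Z ^+ 2))).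
  by apply: leq_sum => f _; apply: leq_sum => e _; exact: term.
under eq_bigr do rewrite -big_distrr /=.
by rewrite -big_distrr leq_mul2l le2 orbT.
Qed.

(** * Linear maximal operators on the lattice *)

Section HardyLittlewood.
Variables (R : realType) (d : nat).
Local Notation V := (lattice d).
Implicit Types (x y : V) (X Y : seq V) (H : V -> R).

Definition coord x (i : 'I_d) : int := (x : 'rV[int]_d) 0 i.

Definition inbox (n : nat) x y : bool := [forall i, (absz (coord y i - coord x i) <= n)%N].

Lemma size_inbox n x X : uniq X -> {in X, forall y, inbox n x y} ->
  (size X <= (2 * n).+1 ^ d)%N.
Proof.
move=> UX Xn.
pose f y : {ffun 'I_d -> 'I_(2 * n).+1} :=
  [ffun i => inord (absz (coord y i - coord x i + n%:Z))].
have Uf : uniq [seq f y | y <- X].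
  rewrite map_inj_in_uniq// => y z yX zX /ffunP fyz; apply/rowP => i.
  have := fyz i; rewrite !ffunE => /(congr1 (@nat_of_ord _)).
  have /forallP/(_ i) := Xn y yX; have /forallP/(_ i) := Xn z zX.
  rewrite -/(coord y i) -/(coord z i); move: (coord y i) (coord z i) (coord x i) => a b c.
  by move=> h1 h2; rewrite !inordK; lia.
rewrite -(size_map f) -(card_uniqP Uf); apply: leq_trans (max_card _) _.
by rewrite card_ffun !card_ord.
Qed.

Lemma inbox_split n m x y z : inbox n x z -> inbox m y z -> (m <= n)%N -> inbox (2 * n) x y.
Proof.
move=> /forallP h1 /forallP h2 mn; apply/forallP => i.
by have := h1 i; have := h2 i; lia.
Qed.

(* Greedy Vitali selection: remove a point of maximal radius together with all
   the points whose boxes may meet its own. *)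
Lemma weak_type X Y (rho : V -> nat) H (t : R) : uniq X -> 0 <= t ->
  (forall y, 0 <= H y) ->
  {in X, forall x, t * ((2 * rho x).+1 ^ d)%:R <= \sum_(y <- Y | inbox (rho x) x y) H y} ->
  t * (size X)%:R <= 2 ^+ d * \sum_(y <- Y) H y.
Proof.
have [n] := ubnP (size X); elim: n X H => // n IH X H Xn UX t0 H0 XH.
have sumH0 (P : pred V) (G : V -> R) : (forall y, 0 <= G y) -> 0 <= \sum_(y <- Y | P y) G y.
  by move=> G0; apply: sumr_ge0.
case: (posnP (size X)) => [/eqP|Xs].
  rewrite size_eq0 => /eqP ->; rewrite mulr0 mulr_ge0 ?exprn_ge0//; exact: sumH0.
have [x0 x0X rmax] : exists2 x0, x0 \in X & {in X, forall x, (rho x <= rho x0)%N}.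
  clear -Xs; elim: X Xs => // a X IH _.
  case: (posnP (size X)) => [/eqP|/IH[b bX bmax]].
    rewrite size_eq0 => /eqP ->; exists a; first by rewrite mem_head.
    by move=> x; rewrite inE => /eqP ->.
  case: (leqP (rho a) (rho b)) => ab.
    by exists b; rewrite ?inE ?bX ?orbT// => x; rewrite inE => /orP[/eqP ->//|]; exact: bmax.
  exists a; first by rewrite mem_head.
  move=> x; rewrite inE => /orP[/eqP ->//|/bmax xb]; exact: leq_trans xb (ltnW ab).
set r := rho x0 in rmax.
pose X1 := [seq x <- X | inbox (2 * r) x0 x].
pose X2 := [seq x <- X | ~~ inbox (2 * r) x0 x].
have sX : size X = (size X1 + size X2)%N by rewrite !size_filter count_predC.
have X1s : (size X1 <= (2 * (2 * r)).+1 ^ d)%N.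
  apply: (size_inbox (x := x0)); first by rewrite filter_uniq.
  by move=> x; rewrite mem_filter => /andP[].
have x0X1 : (0 < size X1)%N.
  rewrite size_filter -has_count; apply/hasP; exists x0 => //.
  by apply/forallP => i; rewrite subrr.
(* Erasing H on the selected box leaves the hypothesis intact for the points kept: their boxes do
   not meet it. *)
pose H2 y := if inbox r x0 y then 0 else H y.
(* The removed points lie in a box of radius 2 r, and (4 r + 1)^d <= 2^d (2 r + 1)^d. *)
have le1 : t * (size X1)%:R <= 2 ^+ d * \sum_(y <- Y | inbox r x0 y) H y.
  apply: le_trans (ler_wpM2l (exprn_ge0 _ _) (XH x0 x0X)) => //.
  rewrite mulrCA ler_wpM2l// -natrX -natrM ler_nat; apply: leq_trans X1s _.
  rewrite -expnMn; case: (posnP d) => [->|d0]; first by rewrite !expn0.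
  by rewrite leq_exp2r//; lia.
have le2 : t * (size X2)%:R <= 2 ^+ d * \sum_(y <- Y) H2 y.
  apply: IH => //.
  - by rewrite sX in Xn; lia.
  - by rewrite filter_uniq.
  - by move=> y; rewrite /H2; case: ifP.
  - move=> x; rewrite mem_filter => /andP[far xX].
    rewrite (eq_bigr H); first exact: XH.
    move=> y xy; rewrite /H2; case: ifP => // x0y.
    by move: far; rewrite (inbox_split x0y xy (rmax x xX)).
rewrite sX natrD mulrDr; apply: le_trans (lerD le1 le2) _.
rewrite -mulrDr ler_wpM2l ?exprn_ge0// [leRHS](bigID (inbox r x0)) /= lerD2l.
rewrite [leLHS](bigID (inbox r x0)) /= big1 ?add0r; last by move=> y xy; rewrite /H2 xy.
by rewrite (eq_bigr H)// => y xy; rewrite /H2 (negPf xy).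
Qed.

Definition box_mean n Y H x : R :=
  (((2 * n).+1 ^ d)%:R)^-1 * \sum_(y <- Y | inbox n x y) H y.

(** The least i retained by P bounds the sum by t^i / (1 - t). *)
Lemma geometric_prefix (t B : R) (I : nat) (P : pred nat) : 0 < t < 1 -> 0 <= B ->
  (forall i, P i -> t ^+ i <= B) -> \sum_(i < I | P i) t ^+ i <= B / (1 - t).
Proof.
move=> /andP[t0 t1]; have t1' : 0 < 1 - t by rewrite subr_gt0.
elim: I P B => [|I IH] P B B0 PB; first by rewrite big_ord0 divr_ge0// ltW.
have all_le n : \sum_(i < n) t ^+ i <= (1 - t)^-1.
  rewrite -[leRHS]mul1r ler_pdivlMr//.
  have := subrXX 1 t n; rewrite expr1n mulrC.
  under eq_bigr do rewrite expr1n mul1r.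
  by move=> <-; rewrite gerBl exprn_ge0// ltW.
have [P0|nP0] := boolP (P 0%N).
  apply: (@le_trans _ _ (1 - t)^-1).
    apply: le_trans (all_le I.+1); rewrite [leRHS](bigID (fun i : 'I_I.+1 => P i)) /= lerDl.
    by apply: sumr_ge0 => i _; rewrite exprn_ge0// ltW.
  by rewrite ler_pdivlMr// mulVf ?gt_eqF// -(expr0 t); exact: PB.
rewrite big_mkcond big_ord_recl /= (negPf nP0) add0r -big_mkcond /=.
rewrite (eq_bigr (fun i : 'I_I => t * t ^+ i)); last by move=> i _; rewrite -exprS.
rewrite -mulr_sumr -ler_pdivlMl//.
have -> : t^-1 * (B / (1 - t)) = (B / t) / (1 - t) by field; rewrite !gt_eqF.
apply: (IH (fun i => P i.+1)); first by rewrite divr_ge0// ltW.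
by move=> i Pi; rewrite ler_pdivlMr// -exprSr; exact: PB.
Qed.

End HardyLittlewood.

Lemma exprn_powR (R : realType) (x p : R) n : 0 <= x -> (x ^+ n) `^ p = (x `^ p) ^+ n.
Proof.
by move=> x0; rewrite -(powR_mulrn n x0) -(powR_mulrn n (powR_ge0 x p)) powRAC.
Qed.

Lemma sum_const_seq (R : pzRingType) (T : Type) (s : seq T) (P : pred T) (c : R) :
  \sum_(x <- s | P x) c = c * (size [seq x <- s | P x])%:R.
Proof. by rewrite big_const_seq iter_addr_0 size_filter mulr_natr. Qed.

Section StrongType.
Variables (R : realType) (d : nat) (q : R).
Hypothesis q1 : 1 < q.
Local Notation V := (lattice d).
Implicit Types (x y : V) (X Y : seq V) (H : V -> R).

Let a : R := 2^-1.
Let t : R := a `^ (q - 1).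
Let a0 : 0 < a. Proof. by rewrite invr_gt0. Qed.
Let t01 : 0 < t < 1.
Proof.
have <- : 1 `^ (q - 1) = 1 :> R by rewrite powR1.
rewrite powR_gt0//= /t.
by rewrite gt0_ltr_powR ?nnegrE ?subr_gt0 ?ltW// invf_lt1// ltr1n.
Qed.

Lemma box_mean_ge0 n Y H x : (forall y, 0 <= H y) -> 0 <= box_mean n Y H x.
Proof. by move=> H0; rewrite mulr_ge0 ?invr_ge0// sumr_ge0. Qed.

Let count_box n Y x : uniq Y -> (\sum_(y <- Y | inbox n x y) 1 : R) <= ((2 * n).+1 ^ d)%:R.
Proof.
move=> UY; rewrite sum_const_seq mul1r ler_nat.
by apply: (size_inbox (x := x)); rewrite ?filter_uniq// => y; rewrite mem_filter => /andP[].
Qed.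

Lemma box_mean_le1 n Y H x : uniq Y -> (forall y, H y <= 1) -> box_mean n Y H x <= 1.
Proof.
move=> UY H1; rewrite /box_mean mulrC ler_pdivrMr// mul1r.
by apply: le_trans (count_box n x UY); apply: ler_sum.
Qed.

(** Marcinkiewicz truncation: values of H up to a^(i + 2) contribute at most half of a mean
    exceeding a^(i + 1), so [weak_type] applies to the larger values alone. *)
Let level_card X Y (rho : V -> nat) H i : uniq X -> uniq Y -> (forall y, 0 <= H y) ->
  a ^+ i * (size [seq x <- X | a ^+ i.+1 < box_mean (rho x) Y H x])%:R
    <= 4 * 2 ^+ d * \sum_(y <- Y | a ^+ i.+2 < H y) H y.
Proof.
move=> UX UY H0.
pose Hi y := if a ^+ i.+2 < H y then H y else 0.
have ai k : 0 <= a ^+ k by rewrite exprn_ge0// ltW.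
have -> : \sum_(y <- Y | a ^+ i.+2 < H y) H y = \sum_(y <- Y) Hi y by rewrite big_mkcond.
have -> : a ^+ i = 4 * a ^+ i.+2 by rewrite !exprS /a; field.
rewrite -[leLHS]mulrA -[leRHS]mulrA ler_wpM2l//; apply: (@weak_type _ _ _ _ rho) => //.
- by rewrite filter_uniq.
- by move=> y; rewrite /Hi; case: ifP.
move=> x; rewrite mem_filter => /andP[xlev _].
have : a ^+ i.+1 * ((2 * rho x).+1 ^ d)%:R <= \sum_(y <- Y | inbox (rho x) x y) H y.
  by rewrite -ler_pdivlMr// mulrC ltW.
have -> : a ^+ i.+1 = 2 * a ^+ i.+2 by rewrite [in RHS]exprS /a; field.
have : \sum_(y <- Y | inbox (rho x) x y) H y <=
    \sum_(y <- Y | inbox (rho x) x y) Hi y + a ^+ i.+2 * ((2 * rho x).+1 ^ d)%:R.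
  apply: le_trans (_ : _ <= \sum_(y <- Y | inbox (rho x) x y) (Hi y + a ^+ i.+2 * 1)) _.
    apply: ler_sum => y _; rewrite mulr1 /Hi; case: ltP => [_|]; last by rewrite add0r.
    by rewrite lerDl.
  by rewrite big_split /= -mulr_sumr lerD2l ler_wpM2l// count_box.
set u := \sum_(_ <- _ | _) _; set v := \sum_(_ <- _ | _) _; set w := a ^+ _ * _.
by rewrite -mulrA -/w => h1 h2; lra.
Qed.

(** Layer cake over the levels a^i, with i >= 0 since H <= 1. After the exchange of sums a point y
    meets only levels a^i < 4 H(y), and these sum geometrically to a multiple of H(y)^(q - 1)
    because q > 1 makes t < 1. *)
Lemma strong_type : exists2 C : R, 0 <= C & forall X Y (rho : V -> nat) H,
  uniq X -> uniq Y -> (forall y, 0 <= H y <= 1) ->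
  \sum_(x <- X) box_mean (rho x) Y H x `^ q <= C * \sum_(y <- Y) H y `^ q.
Proof.
have q0 : 0 < q by apply: lt_trans q1.
have /andP[t0 t1] := t01; have t1' : 0 < 1 - t by rewrite subr_gt0.
exists (4 * 2 ^+ d * (4 `^ (q - 1) / (1 - t))).
  by rewrite !mulr_ge0 ?exprn_ge0 ?powR_ge0 ?invr_ge0// ltW.
move=> X Y rho H UX UY H01.
have H0 y : 0 <= H y by have /andP[] := H01 y.
have H1 y : H y <= 1 by have /andP[] := H01 y.
pose A x := box_mean (rho x) Y H x.
have A0 x : 0 <= A x by exact: box_mean_ge0.
have A1 x : A x <= 1 by exact: box_mean_le1.
pose I := (\max_(x <- X) Num.bound (A x)^-1)%N.
have aI x : x \in X -> 0 < A x -> a ^+ I < A x.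
  move=> xX Ax; have := archi_boundP (_ : 0 <= (A x)^-1); rewrite invr_ge0 => /(_ (A0 x)) lt.
  rewrite /a exprVn invf_plt ?posrE ?exprn_gt0//; apply: lt_le_trans lt _.
  rewrite -natrX ler_nat; apply: leq_trans (ltnW (ltn_expl _ (isT : (1 < 2)%N))) _.
  by rewrite leq_exp2l//; rewrite /I (big_rem x)//= leq_max leqnn.
have tE i : (a ^+ i) `^ q = t ^+ i * a ^+ i.
  by rewrite -exprMn /t [_ * a]mulrC mulr_powRB1 ?(ltW a0)// exprn_powR// ltW.
have Aq x : x \in X -> A x `^ q <= \sum_(i < I | a ^+ i.+1 < A x) t ^+ i * a ^+ i.
  move=> xX; have [Ax|] := ltP 0 (A x); last first.
    move=> Ax; have -> : A x = 0 by apply/eqP; rewrite eq_le Ax A0.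
    rewrite powR0 ?gt_eqF//.
    by apply: sumr_ge0 => i _; rewrite mulr_ge0 ?exprn_ge0// ltW.
  have ex : exists i, a ^+ i.+1 < A x.
    exists I; apply: le_lt_trans (aI x xX Ax).
    by rewrite exprS ger_pMl ?exprn_gt0// /a invf_le1// ler1n.
  case: (ex_minnP ex) => i iA imin.
  have iI : (i < I)%N.
    rewrite ltnNge; apply/negP => Ii; have := aI x xX Ax.
    case E : I => [|J]; first by rewrite expr0 ltNge A1.
    by move=> /imin; rewrite leqNgt (leq_trans _ Ii) ?E.
  have Ai : A x <= a ^+ i.
    case: i iA imin iI => [|i] iA imin iI; first by rewrite expr0.
    by rewrite leNgt; apply/negP => /imin; rewrite ltnn.
  rewrite (bigD1 (Ordinal iI)) //=; apply: (@le_trans _ _ (t ^+ i * a ^+ i)).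
    by rewrite -tE ge0_ler_powR ?nnegrE ?exprn_ge0 ?(ltW a0) ?(ltW q0).
  by rewrite lerDl; apply: sumr_ge0 => j _; rewrite mulr_ge0 ?exprn_ge0// ltW.
apply: (@le_trans _ _ (\sum_(x <- X) \sum_(i < I | a ^+ i.+1 < A x) t ^+ i * a ^+ i)).
  by rewrite big_seq [leRHS]big_seq; apply: ler_sum.
rewrite (exchange_big_dep predT) //=.
apply: (@le_trans _ _ (\sum_(i < I) t ^+ i * (4 * 2 ^+ d * \sum_(y <- Y | a ^+ i.+2 < H y) H y))).
  apply: ler_sum => i _.
  rewrite sum_const_seq -[leLHS]mulrA ler_wpM2l ?exprn_ge0 ?(ltW t0)//.
  exact: level_card.
set K := 4 * 2 ^+ d.
have -> : \sum_(i < I) t ^+ i * (K * \sum_(y <- Y | a ^+ i.+2 < H y) H y) =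
    K * \sum_(i < I) \sum_(y <- Y | a ^+ i.+2 < H y) t ^+ i * H y.
  by rewrite [RHS]mulr_sumr; apply: eq_bigr => i _; rewrite mulrCA; congr (_ * _); rewrite mulr_sumr.
rewrite -[leRHS]mulrA ler_wpM2l ?mulr_ge0 ?exprn_ge0//.
rewrite (exchange_big_dep predT) //= mulr_sumr; apply: ler_sum => y _.
rewrite -mulr_suml mulrC.
apply: (@le_trans _ _ (H y * ((4 * H y) `^ (q - 1) / (1 - t)))).
  rewrite ler_wpM2l//; apply: (@geometric_prefix _ _ _ _ (fun i => a ^+ i.+2 < H y)) => // [|i yi]; first exact: powR_ge0.
  have -> : t ^+ i = (a ^+ i) `^ (q - 1).
    by rewrite /t exprn_powR// ltW.
  rewrite ge0_ler_powR ?nnegrE ?mulr_ge0 ?exprn_ge0 ?(ltW a0) ?subr_ge0 ?(ltW q1)//.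
  have -> : a ^+ i = 4 * a ^+ i.+2 by rewrite !exprS /a; field.
  by rewrite ler_wpM2l// ltW.
rewrite powRM// -[H y `^ q](mulr_powRB1 (H0 y))//.
by rewrite le_eqVlt; apply/orP; left; apply/eqP; ring.
Qed.

End StrongType.

(** * Sums over the sphere written as sums over a box *)

Section BoxPoints.
Variables (d N : nat).
Local Notation box := {ffun 'I_d -> 'I_(2 * N).+1}.

Definition box_point (o : box) : lattice d := \row_i ((o i : nat)%:Z - N%:Z).

Definition box_normsq (o : box) : int := \sum_i ((o i : nat)%:Z - N%:Z) ^+ 2.

Lemma normsq_box_point o : normsq (box_point o) = box_normsq o.
Proof. by apply: eq_bigr => i _; rewrite mxE. Qed.

Lemma box_point_inj : injective box_point.
Proof.
move=> o o' /rowP e; apply/ffunP => i; apply: ord_inj.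
by have := e i; rewrite !mxE => /addIr [].
Qed.

Lemma box_point_onto (u : lattice d) : normsq u <= (N ^ 2)%N%:Z -> exists o, box_point o = u.
Proof.
move=> uN.
have ui i : (absz (coord u i) <= N)%N.
  rewrite -leq_sqr -lez_nat -abszX gez0_abs ?sqr_ge0//; apply: le_trans uN.
  by rewrite /normsq (bigD1 i)//= lerDl; apply: sumr_ge0 => j _; exact: sqr_ge0.
exists [ffun i => inord (absz (coord u i + N%:Z))]; apply/rowP => i.
by rewrite mxE ffunE inordK; have := ui i; rewrite /coord; lia.
Qed.

Definition sphere_pairs (l : nat) : pred (box * box) :=
  [pred z | box_normsq z.1 + box_normsq z.2 == l%:Z].

Lemma box_normsq_ge0 o : 0 <= box_normsq o.
Proof. by apply: sumr_ge0 => i _; exact: sqr_ge0. Qed.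

(** The condition on N puts the whole sphere inside the box, so N is otherwise free: it is l for the
    lower bound and 16^k for the averages. *)
Lemma perm_bisphere l : (l <= N ^ 2)%N ->
  perm_eq (fset_set (bisphere d l)) [seq (box_point z.1, box_point z.2) | z <- enum (sphere_pairs l)].
Proof.
move=> lN; apply: uniq_perm.
- exact: fset_uniq.
- by rewrite map_inj_uniq ?enum_uniq// => -[ o o'] [u u'] /= [/box_point_inj -> /box_point_inj ->].
move=> [u v]; rewrite in_fset_set; last exact: finite_bisphere.
apply/idP/mapP => [|[[ o o']]].
  rewrite inE /bisphere /= => uvl.
  have u0 := normsq_ge0 u; have v0 := normsq_ge0 v.
  have [|o1 oE] := @box_point_onto u; first by clear -uvl u0 v0 lN; lia.
  have [|o2 oE'] := @box_point_onto v; first by clear -uvl u0 v0 lN; lia.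
  exists (o1, o2); last by rewrite /= oE oE'.
  by rewrite mem_enum inE /= -!normsq_box_point oE oE' uvl.
rewrite mem_enum inE /= => /eqP e [-> ->].
by rewrite /bisphere /= !normsq_box_point.
Qed.

Lemma bisphere_sum (M : nmodType) l (f : lattice d * lattice d -> M) : (l <= N ^ 2)%N ->
  \sum_(w \in bisphere d l) f w = \sum_(z | sphere_pairs l z) f (box_point z.1, box_point z.2).
Proof.
move=> lN; rewrite fsbig_finite; last exact: finite_bisphere.
by rewrite (perm_big _ (perm_bisphere lN)) big_map big_enum.
Qed.

Lemma npointsE l : (l <= N ^ 2)%N -> npoints d l = #|sphere_pairs l|.
Proof. by move=> lN; rewrite /npoints (perm_size (perm_bisphere lN)) size_map cardE. Qed.

Lemma sphere_pairs_sum (R : pzRingType) l (f : box -> R) :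
  \sum_(z | sphere_pairs l z) f z.1 = \sum_o f o * (box_count N d (l%:Z - box_normsq o))%:R.
Proof.
rewrite -(pair_big_dep predT (fun o o' => sphere_pairs l (o, o')) (fun o _ => f o)) /=.
apply: eq_bigr => o _; rewrite sumr_const mulr_natr; congr (_ *+ _).
apply: eq_card => o'; rewrite !inE /= -/(box_normsq o') -(inj_eq (addrI (box_normsq o))). by rewrite addrCA subrr addr0.
Qed.

End BoxPoints.

Lemma box_count_pairs (N d : nat) (l : nat) :
  (box_count N (d + d) l%:Z <= #|@sphere_pairs d N l|)%N.
Proof.
pose f (o : {ffun 'I_(d + d) -> 'I_(2 * N).+1}) :
  {ffun 'I_d -> 'I_(2 * N).+1} * {ffun 'I_d -> 'I_(2 * N).+1} :=
  ([ffun i => o (lshift d i)], [ffun i => o (rshift d i)]).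
rewrite /box_count -(card_in_imset (f := f)).
  apply/subset_leq_card/fintype.subsetP => z /imsetP[ o]; rewrite inE => /eqP e ->.
  rewrite inE /= -e big_split_ord /=; apply/eqP.
  by congr (_ + _); apply: eq_bigr => i _; rewrite ffunE.
move=> o o' _ _ [/ffunP e1 /ffunP e2]; apply/ffunP => i; rewrite -(fintype.splitK i).
by case: (fintype.split i) => j /=; [have := e1 j|have := e2 j]; rewrite !ffunE.
Qed.

Lemma npoints_lower (d : nat) : (3 <= d)%N -> exists C : nat, forall l : nat, (0 < l)%N ->
  (l ^ d.-1 <= C * npoints d l)%N.
Proof.
move=> d3; have [C HC] := even_squares_lower (d - 3); exists C => l l0.
have := HC l l; rewrite l0 leqnn => /(_ isT).
have -> : ((d - 3).+2 = d.-1)%N by lia.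
have -> : ((d - 3).*2 + 6 = d + d)%N by lia.
move=> H; apply: leq_trans H _; rewrite leq_mul2l; apply/orP; right.
rewrite (@npointsE d l); last by rewrite expnS expn1 leq_pmulr.
exact: box_count_pairs.
Qed.

Lemma box_count_neg (N d : nat) (t : int) : t < 0 -> box_count N d t = 0%N.
Proof.
move=> t0; apply/eqP; rewrite cards_eq0; apply/eqP/setP => o; rewrite !inE.
by apply: contraTF t0 => /eqP <-; rewrite -leNgt; apply: sumr_ge0 => i _; exact: sqr_ge0.
Qed.

(** Grouping the points by their norm t gives the sum of r(t) r(l - t)^2 <= r(t)^3 + r(l - t)^3:
    second moments of the weights over the box are third moments of r. *)
Lemma box_count_square_sum (N d l : nat) :
  (\sum_(o : {ffun 'I_d -> 'I_(2 * N).+1}) box_count N d (l%:Z - box_normsq o) ^ 2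
     <= 2 * \sum_(t < l.+1) box_count N d t%:Z ^ 3)%N.
Proof.
pose c (o : {ffun 'I_d -> 'I_(2 * N).+1}) : 'I_l.+1 := inord (absz (box_normsq o)).
rewrite (bigID (fun o => box_normsq o <= l%:Z)) /= [X in (_ + X)%N]big1 ?addn0; last first.
  by move=> o; rewrite -ltNge => ol; rewrite box_count_neg// subr_lt0.
rewrite (partition_big c predT) //=.
apply: (@leq_trans (\sum_(t < l.+1) box_count N d t%:Z * box_count N d (l - t)%N%:Z ^ 2)).
  apply: leq_sum => t _.
  have cE o : box_normsq o <= l%:Z -> c o == t -> box_normsq o = (t : nat)%:Z.
    move=> ol /eqP <-; rewrite /c inordK; have := box_normsq_ge0 o; lia.
  rewrite (eq_bigr (fun=> (box_count N d (l - t)%N%:Z ^ 2)%N)); last first.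
    move=> o /andP[ol ot]; rewrite (cE o ol ot) subzn//.
    by rewrite -ltnS.
  rewrite sum_nat_const leq_mul2r; apply/orP; right.
  apply/subset_leq_card/fintype.subsetP => o; rewrite unfold_in inE => /andP[ol ot].
  by rewrite -/(box_normsq o) (cE o ol ot).
apply: (@leq_trans (\sum_(t < l.+1) (box_count N d t%:Z ^ 3 + box_count N d (l - t)%N%:Z ^ 3))).
  apply: leq_sum => t _; move: (box_count N d t) (box_count N d (l - t)%N) => u v.
  case: (leqP u v) => uv.
    by rewrite (leq_trans (leq_mul uv (leqnn _)))// -expnS leq_addl.
  by rewrite (leq_trans _ (leq_addr _ _))// [leqRHS]expnS leq_mul// leq_sqr ltnW.
rewrite big_split /= mul2n -addnn leq_add2l.
rewrite (reindex_inj rev_ord_inj) /=; apply: leq_sum => t _.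
by rewrite subSS subKn// -ltnS.
Qed.

Section SphericalMean.
Variables (R : realType) (d : nat).
Hypothesis d3 : (3 <= d)%N.
Local Notation V := (lattice d).

Definition spherical_mean (l : nat) (F : V -> R) (x : V) : R :=
  (npoints d l)%:R^-1 * \sum_(w \in bisphere d l) F (x - w.1).

(* The weight of F at [x - u] is the number of representations of [l - u ^ 2] by d
   squares; it is bounded by its maximum if s = 1, and by Cauchy-Schwarz if
   s = 2. *)
Lemma spherical_mean_bound (s : nat) : (s = 1%N /\ (5 <= d)%N) \/ s = 2 ->
  exists2 C : R, 0 <= C & forall (k l : nat) (F : V -> R) (x : V), (forall y, 0 <= F y) ->
  (0 < l)%N -> (l <= (16 ^ k) ^ 2 <= 2 ^ 8 * l)%N ->
  spherical_mean l F x ^+ s <=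
    C * (((2 * 16 ^ k).+1 ^ d)%:R^-1 *
      \sum_(o : {ffun 'I_d -> 'I_(2 * 16 ^ k).+1}) F (x - box_point o) ^+ s).
Proof.
move=> hs; have [C0 HC0] := npoints_lower d3.
(* The normalization is separated first: since N^2 <= 2^8 l, [npoints_lower] allows N(l) to be
   replaced by N^(2 (d - 1)). *)
suff [C1 C10 HC1] : exists2 C1 : R, 0 <= C1 & forall (k l : nat) (F : V -> R) (x : V), (forall y, 0 <= F y) ->
  ((\sum_(o : {ffun 'I_d -> 'I_(2 * 16 ^ k).+1})
      F (x - box_point o) * (box_count (16 ^ k) d (l%:Z - box_normsq o))%:R) / (((16 ^ k) ^ 2) ^ d.-1)%:R) ^+ s
  <= C1 / ((16 ^ k) ^ d)%:R * \sum_(o : {ffun 'I_d -> 'I_(2 * 16 ^ k).+1}) F (x - box_point o) ^+ s.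
  exists (((2 ^ 8) ^ d.-1 * C0)%:R ^+ s * (C1 * (3 ^ d)%:R)); first by rewrite !mulr_ge0 ?exprn_ge0.
  move=> k l F x F0 l0 /andP[lN Nl].
  set N := (16 ^ k)%N in lN Nl *; have N0 : (0 < N)%N by rewrite expn_gt0.
  have np0 : (0 < npoints d l)%N.
    rewrite lt0n; apply/eqP => n0.
    by have := HC0 l l0; rewrite n0 muln0 leqn0 expn_eq0 -[l == 0%N]negbK -lt0n l0.
  have inv : (npoints d l)%:R^-1 <= ((2 ^ 8) ^ d.-1 * C0)%:R / ((N ^ 2) ^ d.-1)%:R :> R.
    rewrite ler_pdivlMr ?ltr0n ?expn_gt0 ?N0// mulrC ler_pdivrMr ?ltr0n// -natrM ler_nat.
    apply: (@leq_trans ((2 ^ 8 * l) ^ d.-1)); first by rewrite leq_exp2r//; lia.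
    by rewrite expnMn -mulnA leq_mul2l HC0// orbT.
  have SE : spherical_mean l F x = (npoints d l)%:R^-1 *
     \sum_(o : {ffun 'I_d -> 'I_(2 * N).+1}) F (x - box_point o) * (box_count N d (l%:Z - box_normsq o))%:R.
    rewrite /spherical_mean (bisphere_sum _ lN) /=.
    by rewrite (sphere_pairs_sum _ (fun o => F (x - box_point o))).
  have H := HC1 k l F x F0; rewrite -/N in H.
  set S := \sum_(o : {ffun _ -> _}) _ * _ in SE H; set T := \sum_(o : {ffun _ -> _}) _ in H *.
  have S0 : 0 <= S by apply: sumr_ge0 => o _; rewrite mulr_ge0.
  have T0 : 0 <= T by apply: sumr_ge0 => o _; rewrite exprn_ge0.
  apply: (@le_trans _ _ ((((2 ^ 8) ^ d.-1 * C0)%:R * (S / ((N ^ 2) ^ d.-1)%:R)) ^+ s)).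
    rewrite SE lerXn2r ?nnegrE ?mulr_ge0 ?invr_ge0 ?ler0n//.
    by rewrite [leRHS]mulrCA [leLHS]mulrC ler_wpM2l.
  rewrite exprMn -[leRHS]mulrA ler_wpM2l ?exprn_ge0//; apply: le_trans H _.
  rewrite -!mulrA ler_wpM2l// mulrA ler_wpM2r//.
  rewrite ler_pdivlMr ?ltr0n ?expn_gt0// mulrC ler_pdivrMr ?ltr0n ?expn_gt0 ?N0//.
  rewrite -natrM ler_nat -expnMn leq_exp2r; lia.
case: hs => [[-> d5]|->].
  have [C HC] := box_count_le R d5; exists C%:R => // k l F x F0; rewrite !expr1.
  set N := (16 ^ k)%N; have N0 : (0 < N)%N by rewrite expn_gt0.
  rewrite mulr_suml mulr_sumr; apply: ler_sum => o _.
  rewrite expr1 -mulrA mulrC ler_wpM2r//.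
  rewrite ler_pdivrMr ?ltr0n ?expn_gt0 ?N0// mulrAC ler_pdivlMr ?ltr0n ?expn_gt0 ?N0//.
  rewrite -!natrM ler_nat -(leq_pmul2r (_ : 0 < N ^ 2)%N) ?expn_gt0 ?N0//.
  rewrite mulnAC; apply: leq_trans (leq_mul (HC k _) (leqnn _)) _.
  rewrite -!mulnA leq_mul2l; apply/orP; right; apply/eq_leq.
  by rewrite -/N -!expnM -!expnD; congr (_ ^ _)%N; lia.
(* The squared weights sum to O(N^(3 d - 4)), and division by the squared normalization N^(4 (d -
   1)) leaves N^(- d), the inverse volume of the box up to a constant. *)
have [C HC] := box_count_cube_sum R d3; exists (2 * C)%:R => // k l F x F0.
set N := (16 ^ k)%N; have N0 : (0 < N)%N by rewrite expn_gt0.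
rewrite expr_div_n ler_pdivrMr ?exprn_gt0 ?ltr0n ?expn_gt0 ?N0//.
apply: le_trans (cauchy_schwarz_sum _ _) _.
rewrite mulrC -[leRHS]mulrA [leRHS]mulrCA [leRHS]mulrC.
rewrite ler_wpM2r//; first by apply: sumr_ge0 => o _; exact: sqr_ge0.
have := box_count_square_sum N d l; have := HC k l.+1; rewrite -big_distrl -/N /=.
set S3 := (\sum_(_ < _) _)%N => h3 h2.
apply: (@le_trans _ _ (2 * S3)%:R).
  by apply: le_trans (_ : _ <= (\sum_o box_count N d (l%:Z - box_normsq o) ^ 2)%N%:R) _; [rewrite natr_sum; apply: ler_sum => o _; rewrite natrX|rewrite ler_nat].
rewrite mulrAC ler_pdivlMr ?ltr0n ?expn_gt0 ?N0// -natrX -!natrM ler_nat -!mulnA leq_mul2l /=.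
rewrite -(leq_pmul2r (_ : 0 < N ^ 4)%N) ?expn_gt0 ?N0// mulnAC.
apply: leq_trans (leq_mul h3 (leqnn _)) _.
rewrite -!mulnA leq_mul2l; apply/orP; right; apply/eq_leq.
by rewrite -!expnM -!expnD; congr (_ ^ _)%N; lia.
Qed.

End SphericalMean.

Lemma ler_sum_uniq_sub (R : numDomainType) (T : eqType) (s1 s2 : seq T) (P : pred T) (f : T -> R) :
  uniq s1 -> (forall y, 0 <= f y) -> {in s1, forall y, (y \in s2) && P y} ->
  \sum_(y <- s1) f y <= \sum_(y <- s2 | P y) f y.
Proof.
move=> U1 f0 s12; pose s := undup [seq y <- s2 | y \in s1].
have : perm_eq s1 s.
  apply: uniq_perm => //; first exact: undup_uniq.
  by move=> y; rewrite mem_undup mem_filter; case: (boolP (y \in s1)) => // /s12 /andP[-> _].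
move=> /(perm_big s) e; rewrite e /s.
have sub_undup (u : seq T) : \sum_(y <- undup u) f y <= \sum_(y <- u) f y.
  elim: u => [|y u IH]; first by rewrite big_nil.
  rewrite /=; case: ifP => _; rewrite !big_cons ?lerD2l//.
  by apply: le_trans IH _; rewrite lerDr.
apply: le_trans (sub_undup _) _; rewrite big_filter [leRHS]big_mkcond [leLHS]big_mkcond.
apply: ler_sum => y _; case: ifP => [/s12 /andP[_ ->]//|_]; by case: ifP.
Qed.

Lemma inbox_box_point (d N : nat) (x : lattice d) (o : {ffun 'I_d -> 'I_(2 * N).+1}) :
  inbox N x (x - box_point o).
Proof.
apply/forallP => i; rewrite /coord !mxE addrAC subrr add0r opprB.
have := ltn_ord (o i); move: (nat_of_ord _) => a; lia.
Qed.

(** Only radii N = 16^k are available, because of [level_sum]; rounding l up to a power of 256 =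
    16^2 costs at most a factor 2^8. *)
Lemma dyadic_radius (l : nat) : (0 < l)%N -> exists k, (l <= (16 ^ k) ^ 2 <= 2 ^ 8 * l)%N.
Proof.
move=> l0; have E k : ((16 ^ k) ^ 2 = (2 ^ 8) ^ k)%N by rewrite -[16%N]/(2 ^ 4)%N -!expnM; congr (_ ^ _)%N; lia.
have ex : exists k, (l <= (2 ^ 8) ^ k)%N.
  by exists l; apply: leq_trans (ltnW (ltn_expl l (isT : 1 < 2)%N)) _; rewrite leq_exp2r.
case: (ex_minnP ex) => k lk kmin; exists k; rewrite E lk /=.
case: k lk kmin => [|k] lk kmin; first by rewrite expn0 muln_gt0 l0 expn_gt0.
rewrite expnS leq_pmul2l ?expn_gt0//.
by have := kmin k; rewrite ltnn => /contraFF/(_ erefl) /negbT; rewrite -ltnNge => /ltnW.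
Qed.

Section LinearMaximal.
Variables (R : realType) (d : nat).
Hypothesis d3 : (3 <= d)%N.
Local Notation V := (lattice d).

Lemma spherical_mean_swap (l : nat) (F : V -> R) x :
  (npoints d l)%:R^-1 * \sum_(w \in bisphere d l) F (x - w.2) = spherical_mean l F x.
Proof.
have lN : (l <= l ^ 2)%N by case: l => // l; rewrite expnS expn1 leq_pmulr.
rewrite /spherical_mean !(bisphere_sum _ lN) /=; congr (_ * _).
rewrite [LHS](reindex_inj (h := fun z => (z.2, z.1))) /=; last by move=> [a b] [a' b'] [-> ->].
by apply: eq_bigl => -[a b]; rewrite /sphere_pairs /= addrC.
Qed.

Lemma spherical_mean_ge0 l (F : V -> R) x : (forall y, 0 <= F y) -> 0 <= spherical_mean l F x.
Proof.
move=> F0; rewrite mulr_ge0 ?invr_ge0// fsbig_finite; last exact: finite_bisphere.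
by apply: sumr_ge0.
Qed.

(** [strong_type] is applied to F^s with the exponent r / s > 1; the choice of l at each point
    becomes a choice of box radius. *)
Lemma linear_maximal_of_bound (r : R) (s : nat) : (0 < s)%N -> s%:R < r ->
  (s = 1%N /\ (5 <= d)%N) \/ s = 2 ->
  exists2 C : R, 0 <= C & forall (X : seq V) (L : V -> nat) (F : V -> R), uniq X ->
    (forall x, (0 < L x)%N) -> (forall y, 0 <= F y) ->
    (forall Y, uniq Y -> \sum_(y <- Y) F y `^ r <= 1) ->
    \sum_(x <- X) spherical_mean (L x) F x `^ r <= C.
Proof.
move=> s0 sr hs.
have q1 : 1 < r / s%:R by rewrite ltr_pdivlMr ?mul1r ?ltr0n.
have q0 : 0 < r / s%:R by apply: lt_trans q1.
have r0 : 0 < r by apply: lt_trans sr; rewrite ltr0n.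
have [C1 C10 HC1] := spherical_mean_bound R d3 hs.
have [C2 C20 HC2] := strong_type d q1.
exists (C1 `^ (r / s%:R) * C2); first by rewrite mulr_ge0 ?powR_ge0.
move=> X L F UX L0 F0 F1.
have Fle1 y : F y <= 1.
  have := F1 [:: y] isT; rewrite big_seq1 => Fy; rewrite leNgt; apply/negP => y1.
  have /lt_le_trans/(_ Fy) : 1 `^ r < F y `^ r by rewrite gt0_ltr_powR ?nnegrE.
  by rewrite powR1 ltxx.
have powE (u : R) : 0 <= u -> (u ^+ s) `^ (r / s%:R) = u `^ r.
  by move=> u0; rewrite -powR_mulrn// -powRrM mulrCA divff ?mulr1// pnatr_eq0 -lt0n.
have [k Hk] := boolp.choice (fun x => dyadic_radius (L0 x)).
(* A finite list containing every box in use, so that the means relative to Y miss no value of F. *)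
pose Y := undup (flatten [seq [seq x - box_point o | o : {ffun 'I_d -> 'I_(2 * 16 ^ k x).+1}] | x <- X]).
pose H y := F y ^+ s.
have H0 y : 0 <= H y by rewrite exprn_ge0.
have H01 y : 0 <= H y <= 1 by rewrite H0 exprn_ile1.
have UY : uniq Y by rewrite undup_uniq.
apply: (@le_trans _ _ (\sum_(x <- X) C1 `^ (r / s%:R) * box_mean (16 ^ k x) Y H x `^ (r / s%:R))).
  rewrite big_seq [leRHS]big_seq; apply: ler_sum => x xX.
  rewrite -powE ?spherical_mean_ge0// -powRM ?box_mean_ge0//.
  apply: ge0_ler_powR; rewrite ?nnegrE ?(ltW q0) ?exprn_ge0 ?spherical_mean_ge0//.
    by rewrite mulr_ge0 ?box_mean_ge0.
  apply: le_trans (HC1 _ _ _ _ F0 (L0 x) (Hk x)) _.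
  rewrite ler_wpM2l// ler_wpM2l//.
  rewrite -(big_map (fun o => x - box_point o) predT H) /=.
  apply: ler_sum_uniq_sub => //.
    rewrite map_inj_uniq ?index_enum_uniq// => o o' /addrI /oppr_inj; exact: box_point_inj.
  move=> y /mapP[ o _ ->]; apply/andP; split.
    rewrite mem_undup; apply/flatten_mapP; exists x => //.
    by apply/mapP; exists o => //; rewrite mem_enum.
  exact: inbox_box_point.
rewrite -mulr_sumr ler_wpM2l ?powR_ge0//; apply: le_trans (HC2 _ _ _ _ UX UY H01) _.
rewrite -[leRHS]mulr1 ler_wpM2l//; apply: le_trans (F1 Y UY).
by apply: ler_sum => y _; rewrite powE.
Qed.

Lemma linear_maximal (r : R) : d%:R / (d%:R - 2) < r ->
  exists2 C : R, 0 <= C & forall (X : seq V) (L : V -> nat) (F : V -> R), uniq X ->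
    (forall x, (0 < L x)%N) -> (forall y, 0 <= F y) ->
    (forall Y, uniq Y -> \sum_(y <- Y) F y `^ r <= 1) ->
    \sum_(x <- X) spherical_mean (L x) F x `^ r <= C.
Proof.
have d20 : 0 < d%:R - 2 :> R by rewrite subr_gt0 ltr_nat.
rewrite ltr_pdivrMr// => dr.
have [d5|d5] := leqP 5 d.
  apply: (@linear_maximal_of_bound r 1) => //; last by left.
  rewrite -(ltr_pM2r d20); apply: le_lt_trans dr; lra.
apply: (@linear_maximal_of_bound r 2) => //; last by right.
rewrite -(ltr_pM2r d20); apply: le_lt_trans dr.
have : d%:R <= 4 :> R by rewrite ler_nat.
lra.
Qed.

End LinearMaximal.

(** * Norms for the counting measure *)

Section CountingLattice.
Variables (R : realType) (d : nat).
Local Notation V := (lattice d).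
Local Notation mu := (@counting V R).
Local Open Scope classical_set_scope.
Local Open Scope ereal_scope.
Implicit Types (f : V -> \bar R) (a : V -> R) (Y : seq V).

Lemma measurable_fun_lattice (d' : measure_display) (U : sigmaRingType d') (D : set V)
  (f : V -> U) : measurable_fun D f.
Proof. by move=> _ B _. Qed.

Lemma counting_set1 (x : V) : mu [set x] = 1.
Proof. by rewrite /counting asboolT// fset_set1 cardfs1. Qed.

Lemma counting_gt0 (A : set V) x : A x -> 0 < mu A.
Proof.
move=> Ax; apply: (@lt_le_trans _ _ (mu [set x])); first by rewrite counting_set1 lte01.
by apply: le_measure; rewrite ?inE// => _ ->.
Qed.

Lemma ae_counting (P : V -> Prop) : (\forall x \ae mu, P x) -> forall x, P x.
Proof.
move=> [A [_ A0 PA]] x; apply: contrapT => nPx.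
by have := counting_gt0 (PA x nPx); rewrite A0 ltxx.
Qed.

Lemma integral_counting_seq Y f : uniq Y -> (forall x, 0 <= f x) ->
  \int[mu]_(x in [set` Y]) f x = \sum_(x <- Y) f x.
Proof.
move=> UY f0; have -> : [set` Y] = \big[setU/set0]_(x <- Y) [set x].
  by rewrite -bigcup_seq; apply/seteqP; split => [x xY|x [y yY ->]//]; exists x.
rewrite (ge0_integral_bigsetU _ _ UY)//; last first.
  by move=> x y _ _ [z [-> ->]].
apply: eq_bigr => x _; rewrite (eq_integral (cst (f x))); last by move=> y /[!inE] ->.
by rewrite integral_cst// [X in _ * X]counting_set1 mule1.
Qed.

Lemma sum_le_integral_counting Y f : uniq Y -> (forall x, 0 <= f x) ->
  \sum_(x <- Y) f x <= \int[mu]_x f x.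
Proof.
move=> UY f0; rewrite -integral_counting_seq//.
by apply: ge0_subset_integral => //; exact: measurable_fun_lattice.
Qed.

(** Monotone convergence along an exhaustion of Z^d by finite sets, provided by its encoding in the
    natural numbers. *)
Lemma integral_counting_le f M : (forall x, 0 <= f x) ->
  (forall Y, uniq Y -> \sum_(x <- Y) f x <= M) -> \int[mu]_x f x <= M.
Proof.
move=> f0 fM.
pose u i : V := odflt 0%R (@choice.unpickle 'rV[int]_d i).
pose s n := undup [seq u i | i <- iota 0 n].
pose F n : set V := [set` s n].
have Fmono : nondecreasing_seq F.
  move=> m n mn; rewrite subsetEset => x; rewrite /F /= !mem_undup.
  by rewrite -(subnKC mn) iotaD map_cat mem_cat => ->.
have FT : \bigcup_n F n = setT.
  apply/seteqP; split => // x _; exists (choice.pickle (x : 'rV[int]_d)).+1 => //=.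
  rewrite /F /= mem_undup -[x in x \in _](_ : u (choice.pickle (x : 'rV[int]_d)) = x).
    by apply: map_f; rewrite mem_iota /= add0n.
  by rewrite /u choice.pickleK.
have cv : \int[mu]_(x in F i) f x @[i --> \oo] --> \int[mu]_(x in \bigcup_i F i) f x.
  apply: ge0_nondecreasing_set_cvg_integral => // i; exact: measurable_fun_lattice.
rewrite -FT -(cvg_lim _ cv)//; apply: lime_le; first by apply/cvg_ex; eexists; exact: cv.
by apply: nearW => n; rewrite integral_counting_seq ?undup_uniq// fM ?undup_uniq.
Qed.

(** The unit ball of l^p for nonnegative functions and p > 0, phrased through finite lists so as to
    match the preceding estimates. *)
Definition lp_ball (p : \bar R) a : Prop :=
  if p is p%:E then forall Y, uniq Y -> (\sum_(y <- Y) a y `^ p <= 1)%R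
  else forall y, (a y <= 1)%R.

Lemma lp_ball_le1 p a y : 0 < p -> (forall y, 0 <= a y)%R -> lp_ball p a -> (a y <= 1)%R.
Proof.
case: p => // p; rewrite lte_fin => p0 a0 /(_ [:: y] isT); rewrite big_seq1 => ay.
rewrite leNgt; apply/negP => y1.
have /lt_le_trans/(_ ay) : (1 `^ p < a y `^ p)%R by rewrite gt0_ltr_powR ?nnegrE.
by rewrite powR1 ltxx.
Qed.

Lemma lnorm_ball (p : \bar R) a (c : R) : 0 < p -> (forall y, 0 <= a y)%R -> (0 < c)%R ->
  lnorm p (EFin \o a) <= c%:E -> lp_ball p (fun y => a y / c)%R.
Proof.
case: p => // [p|] p0 a0 c0.
  rewrite lte_fin in p0; move=> ac Y UY.
  have ap Z : uniq Z -> (\sum_(y <- Z) a y `^ p <= c `^ p)%R.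
    move=> UZ; rewrite -lee_fin -sumEFin.
    apply: (@le_trans _ _ (\int[mu]_x (`|(EFin \o a) x| `^ p))).
      rewrite (eq_bigr (fun y => `|(EFin \o a) y| `^ p)); last first.
        by move=> y _; rewrite /= ger0_norm.
      by apply: sum_le_integral_counting => // x; exact: poweR_ge0.
    rewrite -poweR_Lnorm ?gt_eqF// -poweR_EFin; apply: gt0_ler_poweR; rewrite ?(ltW p0)//.
    - by rewrite in_itv /= Lnorm_ge0 leey.
    - by rewrite in_itv /= lee_fin (ltW c0) leey.
  rewrite (eq_bigr (fun y => (a y `^ p) * (c `^ p)^-1)%R); last first.
    by move=> y _; rewrite powRM ?invr_ge0 ?(ltW c0)// -powR_inv1 ?(ltW c0)// powRAC powR_inv1 ?powR_ge0.
  by rewrite -mulr_suml ler_pdivrMr ?powR_gt0// mul1r ap.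
rewrite /lnorm unlock (counting_gt0 (x := 0%R))// => /ess_supP/ae_counting H y.
rewrite ler_pdivrMr// mul1r; have := H y; rewrite /= lee_fin; exact: le_trans (ler_norm _).
Qed.

Lemma lnorm_le (r : R) (T : V -> R) (K : R) : (0 < r)%R -> (forall y, 0 <= T y)%R -> (0 <= K)%R ->
  (forall Y, uniq Y -> \sum_(y <- Y) T y `^ r <= K `^ r)%R ->
  lnorm r%:E (EFin \o T) <= K%:E.
Proof.
move=> r0 T0 K0 TK; have -> : K%:E = (K `^ r)%:E `^ r^-1.
  by rewrite poweR_EFin -powRrM mulfV ?gt_eqF// powRr1.
rewrite /lnorm unlock; apply: gt0_ler_poweR; rewrite ?invr_ge0 ?(ltW r0)//.
- by rewrite in_itv /= leey integral_ge0// => x _; exact: poweR_ge0.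
- by rewrite in_itv /= lee_fin powR_ge0 leey.
apply: integral_counting_le => [x|Y UY]; first exact: poweR_ge0.
rewrite (eq_bigr (fun y => (T y `^ r)%:E)); last first.
  by move=> y _; rewrite /= ger0_norm.
by rewrite sumEFin lee_fin TK.
Qed.

Lemma lnorm_infty_le (f : V -> \bar R) (K : \bar R) : 0 <= K -> (forall y, `|f y| <= K) ->
  lnorm +oo f <= K.
Proof.
move=> K0 fK; rewrite /lnorm unlock; case: ifP => // _; apply/ess_supP.
exact: nearW.
Qed.

End CountingLattice.

(** * The bilinear maximal operator *)

Section Bilinear.
Variables (R : realType) (d : nat).
Hypothesis d3 : (3 <= d)%N.
Local Notation V := (lattice d).
Local Notation nm := (@Normc.normc R).
Implicit Types (a b : V -> R) (f g : V -> R[i]) (x y : V).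

Lemma ler1_powR_exponent (u s t : R) : 0 <= u <= 1 -> 0 < s -> s <= t -> u `^ t <= u `^ s.
Proof.
move=> /andP[u0 u1] s0 st; move: u0; rewrite le_eqVlt => /predU1P[<-|u0].
  by rewrite !powR0 ?gt_eqF// (lt_le_trans s0).
by apply: ger_powR; rewrite ?u0.
Qed.

(** From v <= u^(p / q) the product is at most u^(1 + p / q); the exponent condition says 1 + p / q
    >= p / r, and u <= 1. *)
Lemma mul_le_powR (u v p q r : R) : 0 <= u <= 1 -> 0 <= v -> 0 < p -> 0 < q -> 0 < r ->
  r^-1 <= p^-1 + q^-1 -> v `^ q <= u `^ p -> u * v <= u `^ (p / r).
Proof.
move=> u01 v0 p0 q0 r0 pqr vu; have /andP[u0 _] := u01.
have pq0 : 0 < p / q by rewrite divr_gt0.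
have vle : v <= u `^ (p / q).
  have -> : v = (v `^ q) `^ q^-1 by rewrite -powRrM divff ?gt_eqF// powRr1.
  by rewrite powRrM ge0_ler_powR ?nnegrE ?powR_ge0// invr_ge0 ltW.
apply: (@le_trans _ _ (u `^ (1 + p / q))).
  rewrite powRD; first by rewrite powRr1// ler_wpM2l.
  by rewrite gt_eqF// addr_gt0.
apply: ler1_powR_exponent => //; first by rewrite divr_gt0.
by rewrite -(ler_pM2l p0) in pqr; apply: le_trans pqr _; rewrite mulrDr divff ?gt_eqF.
Qed.

(* [|f||g| <= |f|^(p/r) + |g|^(q/r)] on the unit balls. *)
Lemma product_majorant (p q : \bar R) (r : R) a b : (0 < p)%E -> (0 < q)%E -> 0 < r ->
  (r%:E^-1 <= p^-1 + q^-1)%E -> (forall y, 0 <= a y) -> (forall y, 0 <= b y) ->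
  lp_ball p a -> lp_ball q b ->
  exists F1 F2 : V -> R, [/\ forall y, 0 <= F1 y, forall y, 0 <= F2 y,
    forall Y, uniq Y -> \sum_(y <- Y) F1 y `^ r <= 1,
    forall Y, uniq Y -> \sum_(y <- Y) F2 y `^ r <= 1 &
    forall x y, a x * b y <= F1 x + F2 y].
Proof.
move=> p0 q0 r0 pqr a0 b0 pa qb.
have a1 y := lp_ball_le1 y p0 a0 pa; have b1 y := lp_ball_le1 y q0 b0 qb.
have ball_powR (s : R) h : 0 < s -> lp_ball s%:E h ->
    forall Y, uniq Y -> \sum_(y <- Y) (h y `^ (s / r)) `^ r <= 1.
  move=> s0 hs Y UY; apply: le_trans (hs Y UY); apply: ler_sum => y _.
  by rewrite -powRrM mulfVK// gt_eqF.
have zero_ball Y : uniq Y -> \sum_(y <- Y) (0 : R) `^ r <= 1.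
  by move=> _; rewrite big1// => y _; rewrite powR0// gt_eqF.
rewrite inver gt_eqF// in pqr.
case: p p0 pqr pa => // [p|] p0 pqr pa; case: q q0 pqr qb => // [q|] q0 pqr qb.
- rewrite !lte_fin in p0 q0; rewrite !inver !gt_eqF// -EFinD lee_fin in pqr.
  exists (fun y => a y `^ (p / r)), (fun y => b y `^ (q / r)).
  split=> [y|y|||x y]; rewrite ?powR_ge0//; [exact: ball_powR|exact: ball_powR|].
  have [ba|/ltW ab] := leP (b y `^ q) (a x `^ p).
    apply: le_trans (mul_le_powR _ _ p0 q0 r0 pqr ba) _; rewrite ?a0 ?a1//.
    by rewrite lerDl powR_ge0.
  rewrite addrC in pqr; rewrite mulrC.
  apply: le_trans (mul_le_powR _ _ q0 p0 r0 pqr ab) _; rewrite ?b0 ?b1//.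
  by rewrite lerDr powR_ge0.
(* With q infinite, b <= 1 and p <= r, so a alone is a majorant and a <= a^(p / r). *)
- rewrite lte_fin in p0; rewrite inver gt_eqF// invey adde0 lee_fin in pqr.
  exists (fun y => a y `^ (p / r)), (fun=> 0).
  split=> [y|y|||x y]; rewrite ?powR_ge0//; [exact: ball_powR|exact: zero_ball|].
  rewrite addr0; apply: (@le_trans _ _ (a x)); first by rewrite ler_piMr.
  rewrite -[leLHS]powRr1//; apply: ler1_powR_exponent; rewrite ?a0 ?a1 ?divr_gt0//.
  by rewrite ler_pdivrMr// mul1r -lef_pV2 ?posrE.
- rewrite lte_fin in q0; rewrite inver gt_eqF// invey add0e lee_fin in pqr.
  exists (fun=> 0), (fun y => b y `^ (q / r)).
  split=> [y|y|||x y]; rewrite ?powR_ge0//; [exact: zero_ball|exact: ball_powR|].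
  rewrite add0r; apply: (@le_trans _ _ (b y)); first by rewrite ler_piMl.
  rewrite -[leLHS]powRr1//; apply: ler1_powR_exponent; rewrite ?b0 ?b1 ?divr_gt0//.
  by rewrite ler_pdivrMr// mul1r -lef_pV2 ?posrE.
(* Two infinite exponents would force 1 / r <= 0 with r finite. *)
- by move: pqr; rewrite !invey adde0 lee_fin leNgt invr_gt0 r0.
Qed.

Definition bilinear_mean (l : nat) a b x : R :=
  (npoints d l)%:R^-1 * \sum_(w \in bisphere d l) a (x - w.1) * b (x - w.2).

Lemma bilinear_meanE l a b x : bilinear_mean l a b x =
  (npoints d l)%:R^-1 * \sum_(w <- fset_set (bisphere d l)) a (x - w.1) * b (x - w.2).
Proof. by rewrite /bilinear_mean fsbig_finite//; exact: finite_bisphere. Qed.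

Lemma bilinear_mean_ge0 l a b x : (forall y, 0 <= a y) -> (forall y, 0 <= b y) ->
  0 <= bilinear_mean l a b x.
Proof.
by move=> a0 b0; rewrite bilinear_meanE mulr_ge0 ?invr_ge0// sumr_ge0// => w _; rewrite mulr_ge0.
Qed.

Lemma bilinear_mean_le1 l a b x : (forall y, 0 <= a y <= 1) -> (forall y, 0 <= b y <= 1) ->
  bilinear_mean l a b x <= 1.
Proof.
move=> a01 b01; rewrite bilinear_meanE.
have [n0|n0] := posnP (npoints d l); first by rewrite n0 invr0 mul0r.
rewrite ler_pdivrMl ?ltr0n// mulr1.
apply: (@le_trans _ _ (\sum_(w <- fset_set (bisphere d l)) 1)).
  apply: ler_sum => w _; have /andP[? ?] := a01 (x - w.1); have /andP[? ?] := b01 (x - w.2).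
  exact: mulr_ile1.
by rewrite big_const_seq count_predT iter_addr_0.
Qed.

Lemma bilinear_mean_le_spherical l a b (F1 F2 : V -> R) x :
  (forall x y, a x * b y <= F1 x + F2 y) ->
  bilinear_mean l a b x <= spherical_mean l F1 x + spherical_mean l F2 x.
Proof.
move=> abF; rewrite bilinear_meanE -(spherical_mean_swap l F2) /spherical_mean.
rewrite !(fsbig_finite _ _ (finite_bisphere d l)) /= -mulrDr ler_wpM2l ?invr_ge0//.
by rewrite -big_split /=; apply: ler_sum.
Qed.

Lemma powR_addr_le (u v r : R) : 0 < r -> 0 <= u -> 0 <= v ->
  (u + v) `^ r <= 2 `^ r * (u `^ r + v `^ r).
Proof.
move=> r0; wlog uv : u v / u <= v.
  move=> H u0 v0; have [uv|/ltW vu] := leP u v; first exact: H.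
  by rewrite addrC [X in _ * X]addrC; exact: H.
move=> u0 v0; apply: (@le_trans _ _ ((2 * v) `^ r)).
  rewrite ge0_ler_powR ?nnegrE ?addr_ge0 ?mulr_ge0 ?(ltW r0)//.
  by rewrite mulr2n mulrDl mul1r lerD2r.
by rewrite powRM// ler_wpM2l ?powR_ge0// lerDr powR_ge0.
Qed.

Lemma bilinear_maximal (p q : \bar R) (r : R) : (0 < p)%E -> (0 < q)%E ->
  d%:R / (d%:R - 2) < r -> (r%:E^-1 <= p^-1 + q^-1)%E ->
  exists2 C : R, 0 <= C & forall (X : seq V) (L : V -> nat) a b, uniq X ->
    (forall x, (0 < L x)%N) -> (forall y, 0 <= a y) -> (forall y, 0 <= b y) ->
    lp_ball p a -> lp_ball q b ->
    \sum_(x <- X) bilinear_mean (L x) a b x `^ r <= C.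
Proof.
move=> p0 q0 dr pqr.
have r0 : 0 < r by apply: le_lt_trans dr; rewrite divr_ge0// subr_ge0 ler_nat ltnW.
have [C C0 HC] := linear_maximal d3 dr.
exists (2 `^ r * (C + C)); first by rewrite mulr_ge0 ?powR_ge0 ?addr_ge0.
move=> X L a b UX L0 a0 b0 pa qb.
have [F1 [F2 [F10 F20 F1s F2s abF]]] := product_majorant p0 q0 r0 pqr a0 b0 pa qb.
apply: (@le_trans _ _ (\sum_(x <- X) 2 `^ r *
    (spherical_mean (L x) F1 x `^ r + spherical_mean (L x) F2 x `^ r))).
  apply: ler_sum => x _; apply: le_trans (powR_addr_le r0 _ _); rewrite ?spherical_mean_ge0//.
  rewrite ge0_ler_powR ?nnegrE ?addr_ge0 ?spherical_mean_ge0 ?bilinear_mean_ge0 ?(ltW r0)//.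
  exact: bilinear_mean_le_spherical.
by rewrite -mulr_sumr ler_wpM2l ?powR_ge0// big_split /= lerD// HC.
Qed.

Lemma bispherical_average_le l f g x :
  nm (bispherical_average l f g x) <= bilinear_mean l (nm \o f) (nm \o g) x.
Proof.
rewrite bilinear_meanE /bispherical_average (fsbig_finite _ _ (finite_bisphere d l)) /=.
rewrite Normc.normcM Normc.normcV normc_nat ler_wpM2l ?invr_ge0//.
apply: le_trans (normc_sum _ _ _) _; apply: ler_sum => w _.
by rewrite Normc.normcM.
Qed.

Lemma bilinear_mean_scale l a b x (c1 c2 : R) : 0 < c1 -> 0 < c2 ->
  bilinear_mean l a b x = c1 * c2 * bilinear_mean l (fun y => a y / c1) (fun y => b y / c2) x.
Proof.
move=> c10 c20; rewrite !bilinear_meanE mulrCA; congr (_ * _); rewrite mulr_sumr.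
by apply: eq_bigr => w _; field; rewrite !gt_eqF.
Qed.

Local Notation Tmax := bispherical_maximal.

Section Ball.
Variables (p q : \bar R) (f g : V -> R[i]) (c1 c2 : R).
Hypotheses (p0 : (0 < p)%E) (q0 : (0 < q)%E) (c10 : 0 < c1) (c20 : 0 < c2).
Let a y := nm (f y) / c1.
Let b y := nm (g y) / c2.
Hypotheses (pa : lp_ball p a) (qb : lp_ball q b).

Let a0 y : 0 <= a y. Proof. by rewrite divr_ge0 ?normc_ge0 ?ltW. Qed.
Let b0 y : 0 <= b y. Proof. by rewrite divr_ge0 ?normc_ge0 ?ltW. Qed.

Lemma cabs_average_le l x :
  (cabs (bispherical_average l f g) x <= (c1 * c2 * bilinear_mean l a b x)%:E)%E.
Proof. by rewrite lee_fin -bilinear_mean_scale//; exact: bispherical_average_le. Qed.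

Lemma maximal_ge0 x : (0 <= Tmax f g x)%E.
Proof.
apply: (@le_trans _ _ (cabs (bispherical_average 1 f g) x)); first by rewrite lee_fin normc_ge0.
by apply: ereal_sup_ubound; exists 1%N.
Qed.

Lemma maximal_le x : (Tmax f g x <= (c1 * c2)%:E)%E.
Proof.
apply: ge_ereal_sup => _ [l _ <-]; apply: le_trans (cabs_average_le l x) _.
rewrite lee_fin -[leRHS]mulr1 ler_wpM2l ?mulr_ge0 ?(ltW c10) ?(ltW c20)//.
by apply: bilinear_mean_le1 => y; apply/andP; split=> //; [exact: (lp_ball_le1 y p0)|exact: (lp_ball_le1 y q0)].
Qed.

Lemma maximal_fin x : Tmax f g x = (fine (Tmax f g x))%:E.
Proof.
rewrite fineK// fin_numElt (lt_le_trans _ (maximal_ge0 x)) ?ltNyr//=.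
exact: le_lt_trans (maximal_le x) (ltry _).
Qed.

(** Linearizes the supremum: it is finite, so some radius comes within a factor 2 of it, and the
    estimates for a radius function L apply. *)
Lemma maximal_half x : exists l : nat,
  (0 < l)%N /\ fine (Tmax f g x) <= 2 * (c1 * c2 * bilinear_mean l a b x).
Proof.
set t := fine _; have tE : Tmax f g x = t%:E by exact: maximal_fin.
have [t0|t0] := leP t 0.
  exists 1%N; split=> //; apply: le_trans t0 _; apply: mulr_ge0 => //.
  by apply: mulr_ge0; [rewrite mulr_ge0 ?ltW|exact: bilinear_mean_ge0].
have : ((t / 2)%:E < Tmax f g x)%E by rewrite tE lte_fin; lra.
move=> /ereal_sup_gt[_ [l l0 <-] tl]; exists l; split=> //.
have := lt_le_trans tl (cabs_average_le l x); rewrite lte_fin; lra.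
Qed.

End Ball.

(** For finite r, the radii of [maximal_half] reduce the norm to [bilinear_maximal], whose constant
    bounds a sum of r-th powers and enters through its r-th root. For r = +oo, averages of products
    at most 1 are at most 1. *)
Lemma maximal_ball_bound (p q r : \bar R) : (0 < p)%E -> (0 < q)%E ->
  ((d%:R / (d%:R - 2))%:E < r)%E -> (r^-1 <= p^-1 + q^-1)%E ->
  exists2 C : R, 0 <= C & forall f g (c1 c2 : R), 0 < c1 -> 0 < c2 ->
    lp_ball p (fun y => nm (f y) / c1) -> lp_ball q (fun y => nm (g y) / c2) ->
    (lnorm r (Tmax f g) <= (C * (c1 * c2))%:E)%E.
Proof.
move=> p0 q0; case: r => // [r|] dr pqr.
  have [C C0 HC] := bilinear_maximal p0 q0 dr pqr.
  rewrite lte_fin in dr.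
  have r0 : 0 < r by apply: le_lt_trans dr; rewrite divr_ge0// subr_ge0 ler_nat ltnW.
  exists (2 * C `^ r^-1); first by rewrite mulr_ge0 ?powR_ge0.
  move=> f g c1 c2 c10 c20 pa qb; have c0 : 0 <= c1 * c2 by rewrite mulr_ge0 ?ltW.
  have [L HL] := boolp.choice (maximal_half p0 q0 c10 c20 pa qb).
  have -> : Tmax f g = EFin \o (fun x => fine (Tmax f g x)).
    by apply/funext => x; exact: (maximal_fin p0 q0 c10 c20 pa qb).
  apply: lnorm_le => // [y||Y UY].
  - by rewrite fine_ge0// (maximal_ge0 f g).
  - by rewrite mulr_ge0// mulr_ge0 ?powR_ge0.
  set a := fun y => nm (f y) / c1 in pa HL; set b := fun y => nm (g y) / c2 in qb HL.
  have a0 y : 0 <= a y by rewrite divr_ge0 ?normc_ge0 ?ltW.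
  have b0 y : 0 <= b y by rewrite divr_ge0 ?normc_ge0 ?ltW.
  apply: (@le_trans _ _ (\sum_(y <- Y) (2 * (c1 * c2)) `^ r * bilinear_mean (L y) a b y `^ r)).
    apply: ler_sum => y _; have [Ly] := HL y.
    have bm0 : 0 <= bilinear_mean (L y) a b y by exact: bilinear_mean_ge0.
    rewrite -powRM ?bilinear_mean_ge0 ?mulr_ge0 ?(ltW c10) ?(ltW c20)// mulrA => h.
    rewrite ge0_ler_powR ?nnegrE ?(ltW r0) ?fine_ge0 ?(maximal_ge0 f g)//.
    by do ?[apply: mulr_ge0 => //].
  rewrite -mulr_sumr.
  have -> : 2 * C `^ r^-1 * (c1 * c2) = 2 * (c1 * c2) * C `^ r^-1 by ring.
  rewrite [leRHS]powRM ?mulr_ge0 ?powR_ge0 ?(ltW c10) ?(ltW c20)//.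
  rewrite -[X in _ <= _ * X]powRrM mulVf ?gt_eqF// powRr1//.
  by rewrite ler_wpM2l ?powR_ge0// HC// => x; have [] := HL x.
exists 1 => // f g c1 c2 c10 c20 pa qb; rewrite mul1r.
apply: lnorm_infty_le => [|y]; first by rewrite lee_fin mulr_ge0 ?ltW.
by rewrite gee0_abs ?maximal_ge0//; exact: (maximal_le p0 q0 c10 c20 pa qb).
Qed.

End Bilinear.

Local Close Scope ring_scope.
Local Open Scope ereal_scope.

Theorem corollary1 (R : realType) (d : nat) (p q r : \bar R)
    (hd : (3 <= d)%N) (hp : 1 <= p) (hq : 1 <= q)
    (hr : (d%:R / (d%:R - 2))%R%:E < r)
    (hpqr : r^-1 <= p^-1 + q^-1) :
  exists C : R, forall f g : lattice d -> R[i],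
    in_lp p f -> in_lp q g ->
    lnorm r (bispherical_maximal f g)
      <= C%:E * lnorm p (cabs f) * lnorm q (cabs g).
Proof.
have p0 : 0 < p by apply: lt_le_trans hp; rewrite lte01.
have q0 : 0 < q by apply: lt_le_trans hq; rewrite lte01.
have [C C0 HC] := maximal_ball_bound hd p0 q0 hr hpqr.
exists C => f g; rewrite /in_lp.
have f0 : 0 <= lnorm p (cabs f) by exact: Lnorm_ge0.
have g0 : 0 <= lnorm q (cabs g) by exact: Lnorm_ge0.
case fE : (lnorm p (cabs f)) f0 => [m| |] // m0 _.
case gE : (lnorm q (cabs g)) g0 => [n| |] // n0 _.
rewrite !lee_fin in m0 n0; rewrite -!EFinM; apply/lee_addgt0Pr => e e0.
(* A norm m or n may be 0, so the functions are divided by m + t and n + t with t small. For t <= 1,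
   C (m + t) (n + t) <= C m n + t D; the last 1 in D makes it positive. *)
pose D : R := (C * (m + n + 1) + 1)%R.
have D0 : (0 < D)%R by rewrite ltr_wpDl// mulr_ge0// !addr_ge0.
pose t : R := Num.min 1%R (e / D)%R.
have t0 : (0 < t)%R by rewrite lt_min ltr01 divr_gt0.
have t1 : (t <= 1)%R by rewrite ge_min lexx.
have tD : (t * D <= e)%R by rewrite -ler_pdivlMr// ge_min lexx orbT.
have ball (s : \bar R) (h : lattice d -> R[i]) (k : R) : 0 < s -> (0 <= k)%R ->
    lnorm s (cabs h) = k%:E -> lp_ball s (fun y => Normc.normc (h y) / (k + t))%R.
  move=> s0 k0 hk; apply: (lnorm_ball (a := @Normc.normc R \o h)) => //.
  - by move=> y; exact: normc_ge0.
  - by rewrite ltr_wpDl.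
  - by rewrite [X in X <= _]hk lee_fin lerDl ltW.
apply: le_trans (HC f g (m + t)%R (n + t)%R _ _ (ball p f m p0 m0 fE) (ball q g n q0 n0 gE)) _.
- by rewrite ltr_wpDl.
- by rewrite ltr_wpDl.
rewrite -EFinD lee_fin.
apply: le_trans (_ : _ <= C * m * n + t * D)%R _; last by rewrite lerD2l.
rewrite /D -subr_ge0 [X in (_ <= X)%R](_ : _ = C * (t * (1 - t)) + t)%R; last by ring.
by rewrite addr_ge0 ?(ltW t0)// mulr_ge0// mulr_ge0 ?subr_ge0 ?(ltW t0).
Qed.
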